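(* Let $\Omega\subseteq\mathbb{R}^n$ be an open connected set, $m\ge1$ a natural number, $p\in(1,\infty)$, $\mathcal{G}$ a subgroup of $\mathrm{SO}(n)$ and $D\subseteq\mathbb{R}^n$ a bounded open set. Let $\alpha_p$ be a $p$-core functional with domain $L^p_{\mathrm{loc}}(\mathbb{R}^n;\mathbb{R}^m)\times\mathcal{G}^D(\mathbb{R}^n)$ and let $u\in L^p_{\mathrm{loc}}(\mathbb{R}^n;\mathbb{R}^m)$. Let $\mathcal{P}$ be a linear subspace of $\mathbb{R}^{m\times n}$ with $\mathbb{R}^{m\times n}=\mathcal{P}\oplus\mathcal{N}_{\psi_{\alpha_p}}$ and let $\pi_{\mathcal{P}}$ be the projection onto $\mathcal{P}$ associated with this decomposition. Assume also that for every $D'\in\mathcal{G}^D(\mathbb{R}^n)$ the restriction of $\alpha_p(\cdot,D')$ to $L^p(\mathbb{R}^n;\mathbb{R}^m)$ is a lower semicontinuous functional $L^p(\mathbb{R}^n;\mathbb{R}^m)\to[0,+\infty)$ and that $G^{\alpha_p}_-(u,\Omega)=0$. Then $D_{\pi_{\mathcal{P}}}(u|_\Omega)=0$. As a consequence, if $\psi_{\alpha_p}>0$ in $\mathbb{R}^{m\times n}\setminus\{0\}$, then $\nabla(u|_\Omega)=0$ and $u$ is constant a.e. on $\Omega$. Moreover, if we also assume that $\mathcal{G}=\{\mathrm{id}_{\mathbb{R}^n}\}$ and $\alpha_p$ is a strong $p$-core functional, then $\alpha_p(u,D')=0$ for every $D'\in\mathcal{G}^D(\Omega)$.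
   Context: Notation. $|\cdot|_2$ is the Euclidean norm on $\mathbb{R}^d$; for a matrix $A$, $|A|_2=\sup\{|Ax|_2:|x|_2\le1\}$; $l^A(x)=Ax$; $Q=(-\frac12,\frac12)^n$. For a subgroup $\mathcal{G}$ of $\mathrm{SO}(n)$, $\Gamma^{\mathcal{G}}$ is the group of all maps $x\mapsto\varepsilon\mathcal{R}x+h$ with $\varepsilon>0$, $\mathcal{R}\in\mathcal{G}$, $h\in\mathbb{R}^n$. $\mathcal{G}^D_\varepsilon(\Omega)$ is the class of all sets $\varepsilon\mathcal{R}D+h$ ($\mathcal{R}\in\mathcal{G}$, $h\in\mathbb{R}^n$) contained in $\Omega$, and $\mathcal{G}^D(\Omega)=\bigcup_{\varepsilon>0}\mathcal{G}^D_\varepsilon(\Omega)$. $p$-core functional. A function $\alpha_p:L^p_{\mathrm{loc}}(\mathbb{R}^n;\mathbb{R}^m)\times\mathcal{G}^D(\mathbb{R}^n)\to[0,+\infty)$ is a $p$-core functional (with reference set $D$, subordinated to $\Gamma^{\mathcal{G}}$) if, for all $D'\in\mathcal{G}^D(\mathbb{R}^n)$ and $u,v\in L^p_{\mathrm{loc}}(\mathbb{R}^n;\mathbb{R}^m)$: (i) $\alpha_p(u,D')=\alpha_p(v,D')$ whenever $u|_{D'}=v|_{D'}$; (ii) $\alpha_p(\cdot,D')$ is convex; (iii) $\alpha_p(tu,D')=|t|^p\alpha_p(u,D')$ for all $t\in\mathbb{R}$; (iv) $\alpha_p(u+h,D')=\alpha_p(u,D')$ for all $h\in\mathbb{R}^m$;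 (v) $\alpha_p(u\circ F,D')=\alpha_p(u,F(D'))$ for all $F\in\Gamma^{\mathcal{G}}$; (vi) there is $c_1>0$ such that $\alpha_p(u,D)\le c_1\int_D|\nabla u|_2^p\,\mathrm{d}x$ for all $u\in L^p_{\mathrm{loc}}(\mathbb{R}^n;\mathbb{R}^m)$ with $u|_D\in W^{1,p}(D;\mathbb{R}^m)$. BMO-type seminorm. $G^{\alpha_p}_\varepsilon(u,\Omega)=\varepsilon^{n-p}\sup_{\mathcal{G}_\varepsilon}\sum_{D'\in\mathcal{G}_\varepsilon}\alpha_p(u,D')$, the supremum being over all families $\mathcal{G}_\varepsilon$ of pairwise disjoint elements of $\mathcal{G}^D_\varepsilon(\Omega)$ (an empty family contributes $0$). $G^{\alpha_p}_-(u,\Omega)=\liminf_{\varepsilon\to0^+}G^{\alpha_p}_\varepsilon(u,\Omega)$. $\psi_{\alpha_p}(A)=\lim_{\varepsilon\to0^+}G^{\alpha_p}_\varepsilon(l^A,Q)$ for $A\in\mathbb{R}^{m\times n}$ (the limit exists in $[0,\infty)$), and $\mathcal{N}_{\psi_{\alpha_p}}=\{A:\psi_{\alpha_p}(A)=0\}$, a linear subspace of $\mathbb{R}^{m\times n}$. The operators $D_{\mathfrak{L}}$. For a linear map $\mathfrak{L}:\mathbb{R}^{m\times n}\to\mathbb{R}^{m\times n}$ and $u\in L^1_{\mathrm{loc}}(\Omega;\mathbb{R}^m)$, $D_{\mathfrak{L}}u$ is the $m\times n$ matrix of distributions $\langle(D_{\mathfrak{L}}u)_{ij},\phi\rangle=-\int_\Omega\mathfrak{L}(u\otimes\nabla\phi)_{ij}\,\mathrm{d}x$,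 $\phi\in C^\infty_c(\Omega)$. $W^{\mathfrak{L},p}(\Omega;\mathbb{R}^m)=\{u\in L^p(\Omega;\mathbb{R}^m):D_{\mathfrak{L}}u\in L^p(\Omega;\mathbb{R}^{m\times n})\}$. Strong $p$-core functional. A $p$-core functional $\alpha_p$ is strong if there is a linear subspace $\mathcal{P}\subseteq\mathbb{R}^{m\times n}$ with $\mathbb{R}^{m\times n}=\mathcal{P}\oplus\mathcal{N}_{\psi_{\alpha_p}}$ and a constant $c_3>0$ such that, $\pi_{\mathcal{P}}$ denoting the projection onto $\mathcal{P}$ along $\mathcal{N}_{\psi_{\alpha_p}}$, $\alpha_p(u,D)\le c_3\int_D|D_{\pi_{\mathcal{P}}}u|_2^p\,\mathrm{d}x$ for all $u\in L^p_{\mathrm{loc}}(\mathbb{R}^n;\mathbb{R}^m)$ with $u|_D\in W^{\pi_{\mathcal{P}},p}(D;\mathbb{R}^m)$. *)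

(* Defs.v *)
From HB Require Import structures.
From mathcomp Require Import all_boot all_order all_algebra.
From mathcomp Require Import all_classical all_reals all_analysis.

Set Implicit Arguments.
Unset Strict Implicit.
Unset Printing Implicit Defensive.

Import Order.TTheory GRing.Theory Num.Theory.
Import numFieldNormedType.Exports.

Local Open Scope classical_set_scope.
Local Open Scope ring_scope.

Definition measure_cV_display : measure_display.
Proof. exact: default_measure_display. Qed.

Section cV_measurable.
Context (R : realType) (n : nat).

Definition cV_coord (i : 'I_n) (x : 'cV[R]_n) : measurableTypeR R := x i 0.

(* The sigma-algebra generated by the coordinates, as the library does for
   n.-tuples; it is the Borel sigma-algebra of 'cV[R]_n.  A Lebesgue measurable
   function agrees a.e. with a Borel one, so working with Borel representatives
   does not change the L^p spaces, whose elements matter up to a.e. equality. *)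
Let cV_set0 : g_sigma_preimage cV_coord set0.
Proof. exact: sigma_algebra0. Qed.

Let cV_setC A : g_sigma_preimage cV_coord A -> g_sigma_preimage cV_coord (~` A).
Proof. exact: sigma_algebraC. Qed.

Let cV_bigcup (F : (set 'cV[R]_n)^nat) :
  (forall i, g_sigma_preimage cV_coord (F i)) ->
  g_sigma_preimage cV_coord (\bigcup_i (F i)).
Proof. exact: sigma_algebra_bigcup. Qed.

HB.instance Definition _ := @isMeasurable.Build measure_cV_display
  'cV[R]_n (g_sigma_preimage cV_coord) cV_set0 cV_setC cV_bigcup.

Lemma measurable_cV_coord i : measurable_fun setT (cV_coord i).
Proof.
move=> _ Y mY; rewrite setTI; apply: sub_sigma_algebra => /=.
rewrite -bigcup_seq/=; exists i => /=; first by rewrite mem_index_enum.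
by exists Y => //; rewrite setTI.
Qed.

Lemma measurable_fun_cVP d (T : measurableType d) (f : T -> 'cV[R]_n) :
  measurable_fun setT f <->
  forall i, measurable_fun setT (cV_coord i \o f).
Proof.
split=> [mf i|mf].
  by apply: measurableT_comp => //; exact: measurable_cV_coord.
have H : g_sigma_preimage (fun i => cV_coord i \o f) `<=` measurable.
  apply: smallest_sub; first exact: sigma_algebra_measurable.
  rewrite -bigcup_seq; apply: bigcup_sub => i _ A [B mB <-].
  by apply: (mf i).
move=> _ A mA; apply: H; rewrite g_sigma_preimage_comp.
by exists A.
Qed.

End cV_measurable.

Section cV_lebesgue.
Context (R : realType).

Definition cV_cons n (x : measurableTypeR R * 'cV[R]_n) : 'cV[R]_n.+1 :=
  col_mx (x.1)%:M x.2.

Lemma cV_cons0 n x : @cV_cons n x 0 0 = x.1.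
Proof.
rewrite /cV_cons (_ : 0 = lshift n (ord0 : 'I_1) :> 'I_n.+1); last exact: val_inj.
by rewrite (@col_mxEu R 1 n 1) mxE eqxx.
Qed.

Lemma cV_consS n x i : @cV_cons n x (lift 0 i) 0 = x.2 i 0.
Proof.
rewrite /cV_cons (_ : lift 0 i = rshift 1 i); last exact: val_inj.
by rewrite (@col_mxEd R 1 n 1).
Qed.

Lemma measurable_cV_cons n : measurable_fun setT (@cV_cons n).
Proof.
apply/measurable_fun_cVP => i.
case: (unliftP 0 i) => [j|] ->.
  rewrite (_ : _ \o _ = cV_coord j \o snd).
    by apply: measurableT_comp => //; exact: measurable_cV_coord.
  by apply/funext => x; exact: cV_consS.
rewrite (_ : _ \o _ = fst) //.
by apply/funext => x; exact: cV_cons0.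
Qed.

Definition lebesgue_cV_step n
    (mu : {sigma_finite_measure set 'cV[R]_n -> \bar R}) :
    set 'cV[R]_n.+1 -> \bar R :=
  pushforward (@lebesgue_measure R \x mu)%E (@cV_cons n).

Section lebesgue_cV_step.
Context n (mu : {sigma_finite_measure set 'cV[R]_n -> \bar R}).

Let nu : {measure set (measurableTypeR R * 'cV[R]_n)%type -> \bar R} :=
  (@lebesgue_measure R \x mu)%E.

Let step0 : lebesgue_cV_step mu set0 = 0%E.
Proof. exact: (measure0 nu). Qed.

Let step_ge0 A : (0 <= lebesgue_cV_step mu A)%E.
Proof. exact: (measure_ge0 nu). Qed.

Let step_sigma_additive : semi_sigma_additive (lebesgue_cV_step mu).
Proof.
have mf := @measurable_cV_cons n.
move=> F mF tF mUF; rewrite /lebesgue_cV_step /pushforward preimage_bigcup.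
apply: (@measure_semi_sigma_additive _ _ _ nu).
- by move=> k; rewrite -[X in measurable X]setTI; exact: mf.
- apply/trivIsetP => /= i j _ _ ij; rewrite -preimage_setI.
  by move/trivIsetP : tF => /(_ _ _ _ _ ij) ->//; rewrite preimage_set0.
- by rewrite -preimage_bigcup -[X in measurable X]setTI; exact: mf.
Qed.

HB.instance Definition _ := isMeasure.Build _ _ _ (lebesgue_cV_step mu)
  step0 step_ge0 step_sigma_additive.

Let step_sigma_finite : sigma_finite setT (lebesgue_cV_step mu).
Proof.
have /sigma_finiteP[F1 [TF1 ndF1 mF1]] := sigma_finiteT (@lebesgue_measure R).
have /sigma_finiteP[F2 [TF2 ndF2 mF2]] := sigma_finiteT mu.
pose g (y : 'cV[R]_n.+1) : measurableTypeR R * 'cV[R]_n :=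
  (y 0 0, \col_i y (lift 0 i) 0).
have mg : measurable_fun setT g.
  apply/measurable_fun_pairP; split.
    exact: (@measurable_cV_coord R n.+1 0).
  apply/measurable_fun_cVP => i.
  rewrite (_ : _ \o _ = @cV_coord R n.+1 (lift 0 i)).
    exact: measurable_cV_coord.
  by apply/funext => y; rewrite /cV_coord/= mxE.
have gK : cancel (@cV_cons n) g.
  move=> [a v]; rewrite /g; congr pair; first exact: cV_cons0.
  by apply/matrixP => i j; rewrite mxE cV_consS (ord1 j).
exists (fun k => g @^-1` (F1 k `*` F2 k)).
  apply/esym; rewrite -subTset => y _.
  have [i _ F1i] : (\bigcup_i F1 i) (g y).1 by rewrite -TF1.
  have [j _ F2j] : (\bigcup_i F2 i) (g y).2 by rewrite -TF2.
  exists (maxn i j) => //; split.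
  - by move: (g y).1 F1i; exact/subsetPset/ndF1/leq_maxl.
  - by move: (g y).2 F2j; exact/subsetPset/ndF2/leq_maxr.
move=> k; have [mF1k F1k] := mF1 k; have [mF2k F2k] := mF2 k; split.
  by rewrite -[X in measurable X]setTI; apply: mg => //; exact: measurableX.
rewrite /lebesgue_cV_step /pushforward -comp_preimage.
rewrite (_ : g \o _ = id); last by apply/funext => x; exact: gK.
by rewrite preimage_id product_measure1E// lte_mul_pinfty// ge0_fin_numE.
Qed.

HB.instance Definition _ := Measure_isSigmaFinite.Build _ _ _
  (lebesgue_cV_step mu) step_sigma_finite.

End lebesgue_cV_step.

Fixpoint lebesgue_cV n : {sigma_finite_measure set 'cV[R]_n -> \bar R} :=
  match n return {sigma_finite_measure set 'cV[R]_n -> \bar R} with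
  | 0 => \d_(0 : 'cV[R]_0)
  | n.+1 => lebesgue_cV_step (lebesgue_cV n)
  end.

End cV_lebesgue.

Notation leb := (lebesgue_cV _ _).

Section euclidean.
Context (R : realType).

Definition enorm n (x : 'cV[R]_n) : R := Num.sqrt (\sum_i x i 0 ^+ 2).

Definition opnorm m n (A : 'M[R]_(m, n)) : R :=
  sup [set enorm (A *m x) | x in [set x : 'cV[R]_n | enorm x <= 1]].

Definition SO n : set 'M[R]_n := [set A | A *m A^T = 1%:M /\ \det A = 1].

Definition subgroup_of_SO n (G : set 'M[R]_n) :=
  [/\ G `<=` @SO n, G 1%:M,
      forall A B, G A -> G B -> G (A *m B) &
      forall A, G A -> G (invmx A)].

Definition similarity n (e : R) (A : 'M[R]_n) (h x : 'cV[R]_n) : 'cV[R]_n :=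
  e *: (A *m x) + h.

Definition copies_at n (G : set 'M[R]_n) (D : set 'cV[R]_n) (e : R)
    (Omega : set 'cV[R]_n) : set (set 'cV[R]_n) :=
  [set D' | (exists A h, G A /\ D' = similarity e A h @` D) /\ D' `<=` Omega].

Definition copies n (G : set 'M[R]_n) (D Omega : set 'cV[R]_n) :
    set (set 'cV[R]_n) :=
  [set D' | exists2 e, 0 < e & copies_at G D e Omega D'].

Definition unit_cube n : set 'cV[R]_n :=
  [set x | forall i, - 2^-1 < x i 0 < 2^-1].

End euclidean.

Section function_spaces.
Context (R : realType) (n : nat).
Implicit Types (p : R) (Omega : set 'cV[R]_n).

(* Instantiated with [enorm] for vector fields and [opnorm] for matrix fields. *)
Definition in_Lp k l (nrm : 'M[R]_(k, l) -> R) p Omega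
    (f : 'cV[R]_n -> 'M[R]_(k, l)) :=
  (forall i j, measurable_fun Omega (fun x => f x i j)) /\
  (\int[leb]_(x in Omega) (nrm (f x) `^ p)%:E < +oo)%E.

Definition in_Lploc m p (u : 'cV[R]_n -> 'cV[R]_m) :=
  (forall i j, measurable_fun setT (fun x => u x i j)) /\
  (forall K, compact K -> (\int[leb]_(x in K) (enorm (u x) `^ p)%:E < +oo)%E).

Definition partial (j : 'I_n) (phi : 'cV[R]_n -> R) : 'cV[R]_n -> R :=
  fun x => 'D_(delta_mx j 0) phi x.

Definition smooth (phi : 'cV[R]_n -> R) :=
  forall s : seq 'I_n,
    continuous (foldr partial phi s) /\
    forall j x, derivable (foldr partial phi s) x (delta_mx j 0).

(* Elements of C_c^oo(Omega), extended by zero to R^n. *)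
Definition test_function Omega (phi : 'cV[R]_n -> R) :=
  [/\ smooth phi, compact (closure [set x | phi x != 0]) &
      closure [set x | phi x != 0] `<=` Omega].

Definition grad (phi : 'cV[R]_n -> R) (x : 'cV[R]_n) : 'cV[R]_n :=
  \col_j partial j phi x.

(* The matrix of pairings <(D_L u)_ij, phi>. *)
Definition DL m (L : 'M[R]_(m, n) -> 'M[R]_(m, n)) Omega
    (u : 'cV[R]_n -> 'cV[R]_m) (phi : 'cV[R]_n -> R) : 'M[R]_(m, n) :=
  \matrix_(i, j)
    (- \int[leb]_(x in Omega) (L (u x *m (grad phi x)^T) i j)).

Definition DL_eq0 m (L : 'M[R]_(m, n) -> 'M[R]_(m, n)) Omega
    (u : 'cV[R]_n -> 'cV[R]_m) :=
  forall phi, test_function Omega phi -> DL L Omega u phi = 0.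

(* [u] belongs to W^{L,p}(Omega), with D_L u represented by [V]. *)
Definition in_WLp m (L : 'M[R]_(m, n) -> 'M[R]_(m, n)) p Omega
    (u : 'cV[R]_n -> 'cV[R]_m) (V : 'cV[R]_n -> 'M[R]_(m, n)) :=
  [/\ in_Lp (@enorm R m) p Omega u,
      in_Lp (@opnorm R m n) p Omega V &
      forall phi, test_function Omega phi ->
        DL L Omega u phi =
        \matrix_(i, j) (\int[leb]_(x in Omega) (V x i j * phi x))].

End function_spaces.

Section core_functionals.
Context (R : realType) (m n : nat).
Implicit Types (alpha : ('cV[R]_n -> 'cV[R]_m) -> set 'cV[R]_n -> R)
  (u v : 'cV[R]_n -> 'cV[R]_m) (G : set 'M[R]_n) (D Omega : set 'cV[R]_n)
  (p : R).

(* [alpha] is total; only its values on L^p_loc x G^D(R^n) are constrained.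
   In the last item D_id is the weak gradient, so W^{id,p} = W^{1,p}. *)
Definition core_functional p G D alpha :=
  [/\ forall u D', in_Lploc p u -> copies G D setT D' -> 0 <= alpha u D',
      forall u v D', in_Lploc p u -> in_Lploc p v -> copies G D setT D' ->
        {ae leb, forall x, D' x -> u x = v x} ->
        alpha u D' = alpha v D',
      forall u v D' (t : R), in_Lploc p u -> in_Lploc p v ->
        copies G D setT D' -> 0 <= t <= 1 ->
        alpha (fun x => t *: u x + (1 - t) *: v x) D' <=
          t * alpha u D' + (1 - t) * alpha v D' &
      [/\ forall u D' (t : R), in_Lploc p u -> copies G D setT D' ->
            alpha (fun x => t *: u x) D' = `|t| `^ p * alpha u D',
          forall u D' (h : 'cV[R]_m), in_Lploc p u -> copies G D setT D' ->
            alpha (fun x => u x + h) D' = alpha u D',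
          forall u D' e A h, in_Lploc p u -> copies G D setT D' ->
            0 < e -> G A ->
            alpha (u \o similarity e A h) D' =
              alpha u (similarity e A h @` D') &
          exists2 c1 : R, 0 < c1 & forall u V, in_Lploc p u ->
            in_WLp id p D u V ->
            ((alpha u D)%:E <=
              c1%:E * \int[leb]_(x in D) (opnorm (V x) `^ p)%:E)%E]].

Definition bmo_eps p G D alpha Omega u (e : R) : \bar R :=
  ((e `^ (n%:R - p))%:E *
   ereal_sup [set \esum_(D' in F) (alpha u D')%:E | F in
     [set F | F `<=` copies_at G D e Omega /\ trivIset F id]])%E.

Definition bmo_liminf p G D alpha Omega u : \bar R :=
  limf_einf (bmo_eps p G D alpha Omega u) 0^'+.

Definition psi p G D alpha (A : 'M[R]_(m, n)) : \bar R :=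
  lim (bmo_eps p G D alpha (@unit_cube R n) (fun x => A *m x) e @[e --> 0^'+]).

Definition psi_null p G D alpha : set 'M[R]_(m, n) :=
  [set A | psi p G D alpha A = 0%E].

Definition direct_sum (P : {vspace 'M[R]_(m, n)}) (N : set 'M[R]_(m, n)) :=
  forall A, exists! BC : 'M[R]_(m, n) * 'M[R]_(m, n),
    [/\ BC.1 \in P, N BC.2 & A = BC.1 + BC.2].

(* Only meaningful under [direct_sum P N]. *)
Definition proj_along (P : {vspace 'M[R]_(m, n)}) (N : set 'M[R]_(m, n))
    (A : 'M[R]_(m, n)) : 'M[R]_(m, n) :=
  get [set B | B \in P /\ N (A - B)].

Definition strong_core_functional p G D alpha :=
  core_functional p G D alpha /\
  exists P : {vspace 'M[R]_(m, n)},
    direct_sum P (psi_null p G D alpha) /\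
    exists2 c3 : R, 0 < c3 & forall u V, in_Lploc p u ->
      in_WLp (proj_along P (psi_null p G D alpha)) p D u V ->
      ((alpha u D)%:E <=
        c3%:E * \int[leb]_(x in D) (opnorm (V x) `^ p)%:E)%E.

(* Lower semicontinuity for the L^p(R^n) norm. *)
Definition lsc_on_Lp p (F : ('cV[R]_n -> 'cV[R]_m) -> R) :=
  forall u, in_Lp (@enorm R m) p setT u -> forall a, a < F u ->
  exists2 d : R, 0 < d & forall v, in_Lp (@enorm R m) p setT v ->
    ('N[leb]_(p%:E)[EFin \o (fun x => enorm (v x - u x))] < d%:E)%E -> a < F v.

End core_functionals.

(* Main.v *)
(* Packing the unit cube with rescaled copies shows that the null space of psi
   consists of the matrices A with alpha(x |-> (A B) x, D) = 0 for all rotations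
   B of the group.  Let phi be a C^{1,1} kernel supported in Omega and
   v(x) = int u(z) phi(z - x) dz.  Near 0, v is affine up to a quadratic error,
   with linear part -int u (grad phi)^T.  If that matrix were not in the null
   space, lower semicontinuity would give every small copy eD + h the energy
   alpha(v, eD + h) >= a e^p.  On the other hand v is an L^p limit of
   combinations of translates u(. + y), y in supp phi, with bounded total
   weight, so by convexity the energy of v on a disjoint family of copies is
   controlled by the seminorm of u on Omega, which is small along a sequence
   e -> 0: a contradiction.  Hence int u (grad phi)^T is a null matrix and is
   killed by the projection, and the two other statements follow by choosing
   phi. *)
Require Import Defs.
From HB Require Import structures.
From mathcomp Require Import all_boot all_order all_algebra.
From mathcomp Require Import ring lra.
From mathcomp Require Import all_classical all_reals all_analysis measurable_realfun.
Import Order.TTheory GRing.Theory Num.Theory.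
Import numFieldNormedType.Exports.
Local Open Scope classical_set_scope.
Local Open Scope ring_scope.

Set Implicit Arguments.
Unset Strict Implicit.
Unset Printing Implicit Defensive.


(** Convexity of a core functional concerns finite combinations, while a mollification is an
    integral of translates. It is therefore replaced by Riemann sums with bounded total weight,
    which converge because translations are continuous in L^p_loc, and lower semicontinuity absorbs
    the error. The scaling closes the argument: about (r/e)^n disjoint copies of energy at least a
    e^p, weighted by e^(n-p), give a bound of order a r^n that does not depend on e. The blow-up
    takes place at 0 even when 0 is outside Omega, since adding a point of supp phi to a copy near 0
    brings it into Omega. Kernels are C^{1,1} in the sense of explicit inequalities: test functions
    qualify, and so does the bump (1 - |x|^2)_+^2, which carries the proof of local constancy.
    Rotations act on copies only, never on integrals, so the change of variables is needed for
    homotheties and translations alone. *)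

Section cV_topology.
Context (R : realType).

(** * Topology and Borel sets of the space of column vectors *)

Lemma coord_le_norm n (x : 'cV[R]_n) i : `|x i 0| <= `|x|.
Proof.
rewrite [leRHS]/Num.norm/= mx_normrE; apply/bigmax_geP; right => /=.
by exists (i, 0).
Qed.

Lemma cV_norm_leP n (x : 'cV[R]_n) (r : R) : 0 <= r ->
  (`|x| <= r) <-> (forall i, `|x i 0| <= r).
Proof.
move=> r0; split=> [xr i|xr]; first exact: le_trans (coord_le_norm x i) xr.
rewrite [leLHS]/Num.norm/= mx_normrE; apply/bigmax_leP; split=> // -[i j] _ /=.
by rewrite (ord1 j).
Qed.

Lemma cV_norm_ltP n (x : 'cV[R]_n) (r : R) : 0 < r ->
  (`|x| < r) <-> (forall i, `|x i 0| < r).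
Proof.
move=> r0; split=> [xr i|xr]; first exact: le_lt_trans (coord_le_norm x i) xr.
rewrite [ltLHS]/Num.norm/= mx_normrE; apply/bigmax_ltP; split=> // -[i j] _ /=.
by rewrite (ord1 j).
Qed.

(** The norm of column vectors is the maximum norm, so this is a closed cube. These cubes exhaust
    the space and replace general compact sets as domains of integration. *)
Definition cball n (r : R) : set 'cV[R]_n := [set x | `|x| <= r].
Arguments cball : clear implicits.

Lemma cball_le n (r s : R) : r <= s -> cball n r `<=` cball n s.
Proof. by move=> rs x /le_trans; apply. Qed.

Lemma trmx_continuous n : continuous (@trmx R 1 n).
Proof.
move=> M s /= /(nbhs_ballP (M^T)) [e e0 es].
apply/nbhs_ballP; exists e => //= N [_ MN]; apply/es; split=> // i j.
by rewrite !mxE; exact: MN.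
Qed.

(** A product of segments is compact as a set of row vectors; transposition is continuous and
    carries this over to columns. *)
Lemma cV_compactP n (A : set 'cV[R]_n) (r : R) :
  closed A -> A `<=` cball n r -> compact A.
Proof.
move=> cA Ar; have cr : compact (cball n r).
  have [r0|r0] := ltP r 0.
    rewrite (_ : cball n r = set0); first exact: compact0.
    apply/seteqP; split=> // x /=; rewrite /cball/= leNgt => /negP; apply.
    exact: lt_le_trans r0 (normr_ge0 _).
  rewrite (_ : cball n r = trmx @`
      [set v : 'rV[R]_n | forall i, `[- r, r]%classic (v ord0 i)]).
    apply: continuous_compact; last first.
      by apply: (@rV_compact _ _ (fun=> `[- r, r]%classic)) => _; exact: segment_compact.
    by apply: continuous_subspaceT; exact: trmx_continuous.
  apply/seteqP; split=> [x xr|_ [v vr <-]].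
    exists (x^T); last by rewrite trmxK.
    move=> i /=; rewrite mxE in_itv/= -ler_norml.
    by move/(cV_norm_leP _ r0) : xr; exact.
  apply/(cV_norm_leP _ r0) => i; rewrite mxE ler_norml.
  by have := vr i; rewrite /= in_itv.
exact: subclosed_compact cA cr Ar.
Qed.

Lemma closed_cball n r : closed (cball n r).
Proof.
have -> : cball n r = (fun x => `|x|) @^-1` [set y : R | y <= r] by [].
apply: closed_comp => [x _|]; first exact: norm_continuous.
exact: closed_le.
Qed.

Lemma compact_cball n r : compact (cball n r).
Proof. by apply: (@cV_compactP _ _ r) => //; exact: closed_cball. Qed.

Lemma compact_sub_cball n (K : set 'cV[R]_n) : compact K ->
  exists2 r, 0 < r & K `<=` cball n r.
Proof.
move=> /compact_bounded/ex_strict_bound_gt0 [r r0 Kr].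
by exists r => // x /Kr/ltW.
Qed.

Lemma measurable_cV_coord_norm n (r : R) (q : 'cV[R]_n) :
  measurable [set x : 'cV[R]_n | forall i, `|x i 0 - q i 0| < r].
Proof.
rewrite (_ : mkset _ = \bigcap_(i in [set: 'I_n])
   ((@cV_coord R n i) @^-1` [set y | `|y - q i 0| < r])); last first.
  by apply/seteqP; split=> [x xr i _|x xr i]; [exact: xr|exact: (xr i Logic.I)].
apply: fin_bigcap_measurable => // i _; rewrite -[X in measurable X]setTI.
apply: measurable_cV_coord => //.
rewrite (_ : mkset _ = `](q i 0 - r), (q i 0 + r)[%classic); first exact: measurable_itv.
by apply/seteqP; split=> y /=; rewrite in_itv/= ltr_distl.
Qed.

(** An open set is the union of the countably many rational cubes [B q] that it contains, and a cube
    is a finite intersection of preimages under coordinates. This links the sigma-algebra generated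
    by the coordinates with the topology. *)
Lemma open_cV_measurable n (U : set 'cV[R]_n) : open U -> measurable U.
Proof.
move=> oU.
pose B (q : 'cV[rat]_n * nat) := [set x : 'cV[R]_n |
  forall i, `|x i 0 - (map_mx ratr q.1 : 'cV[R]_n) i 0| < q.2.+1%:R^-1].
rewrite (_ : U = \bigcup_(q in [set q | B q `<=` U]) B q).
  rewrite bigcup_mkcond; apply: countable_bigcupT_measurable => // q.
  by case: ifP => // _; exact: measurable_cV_coord_norm.
apply/seteqP; split=> [x Ux|x [q]]; last by move=> /= Bq /Bq.
have /nbhs_ballP[e e0 eU] : nbhs x U by exact: open_nbhs_nbhs.
(* The radius is below [e / 2] because the rational centre is only within one radius of [x]: points
   of the cube are then within two radii of [x]. *)
have [k ke] : exists k, k.+1%:R^-1 < e / 2 :> R.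
  have [k _ /(_ _ (leqnn k))] := near_infty_natSinv_lt (PosNum (divr_gt0 e0 (ltr0n _ 2))).
  by exists k.
have k0 : 0 < k.+1%:R^-1 :> R by rewrite invr_gt0 ltr0n.
rewrite /B; set dl := k.+1%:R^-1 in ke k0 *.
have /choice[q qx] : forall i, exists q : rat, `|x i 0 - ratr q| < dl.
  move=> i; have : x i 0 - dl < x i 0 + dl by rewrite ltrBlDr -addrA ltrDl addr_gt0.
  move=> /rat_in_itvoo [q]; rewrite in_itv/= => /andP[q1 q2]; exists q.
  by rewrite ltr_distlC q1 q2.
exists (\col_i q i, k); last by move=> i; rewrite !mxE; exact: qx.
move=> y By; apply: eU; rewrite -ball_normE/=; apply/cV_norm_ltP => // i.
have := By i; have := qx i; rewrite !mxE /=.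
rewrite -/dl !ltr_norml => /andP[a b] /andP[c d]; apply/andP; split; lra.
Qed.

Lemma closed_cV_measurable n (K : set 'cV[R]_n) : closed K -> measurable K.
Proof.
move=> cK; rewrite -(setCK K); apply: measurableC; apply: open_cV_measurable.
exact: closed_openC.
Qed.

Lemma compact_cV_measurable n (K : set 'cV[R]_n) : compact K -> measurable K.
Proof.
by move=> cK; apply: closed_cV_measurable; apply: compact_closed => //; exact: norm_hausdorff.
Qed.

Lemma measurable_cball n r : measurable (cball n r).
Proof. by apply: closed_cV_measurable; exact: closed_cball. Qed.

Lemma continuous_cV_measurable n (f : 'cV[R]_n -> R) :
  continuous f -> measurable_fun setT f.
Proof.
move=> /continuousP cf; apply: (measurability _ (measurable_realfun.RGenOInfty.measurableE R)).
move=> _ [_ [a ->] <-]; rewrite setTI; apply: open_cV_measurable.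
by apply: cf; exact: interval_open.
Qed.

End cV_topology.
Arguments cball {R} n r _.

(** * Lebesgue measure and integrals under homotheties and translations *)

Section lebesgue_cV_affine.
Context (R : realType).
Local Open Scope ereal_scope.

(** Multiplied by [e], the push-forward of Lebesgue measure agrees with Lebesgue measure on
    half-open intervals, and uniqueness identifies the two. *)
Lemma lebesgue_measure_affine (e h : R) (A : set R) : (0 < e)%R ->
  measurable A ->
  lebesgue_measure ((fun x => e * x + h)%R @^-1` A) =
  (e^-1)%:E * lebesgue_measure A.
Proof.
move=> e0 mA.
pose f (x : measurableTypeR R) : measurableTypeR R := (e * x + h)%R.
have mf : measurable_fun setT f.
  by apply: measurable_funD => //; exact: measurable_funM.
pose nu : {measure set measurableTypeR R -> \bar R} := mscale (NngNum (ltW e0))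
  (measure_function_pushforward__canonical__measure_function_Measure
    (@lebesgue_measure R) mf).
suff -> : lebesgue_measure A = nu A.
  by rewrite /nu /= /mscale/= muleA -EFinM mulVf ?gt_eqF// mul1e.
apply: lebesgue_measure_unique => //= _ [[a b]] _ <-.
rewrite /mscale/= /pushforward/=.
have -> : f @^-1` `]a, b]%classic = `](e^-1 * (a - h))%R, (e^-1 * (b - h))%R]%classic.
  apply/seteqP; split=> x /=; rewrite !in_itv/= /f => /andP[ax xb].
    by rewrite ltr_pdivrMl// ler_pdivlMl// ltrBlDr lerBrDr ax.
  by move: ax xb; rewrite ltr_pdivrMl// ler_pdivlMl// ltrBlDr lerBrDr => ->.
rewrite !lebesgue_measure_itv/= !lte_fin ltr_pM2l ?invr_gt0// ltrD2r.
case: ifP => _; last by rewrite mule0.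
rewrite -!EFinB -EFinM; congr EFin; rewrite -mulrBr mulrA mulfV ?gt_eqF//; ring.
Qed.

Lemma measurable_affine n (e : R) (h : 'cV[R]_n) :
  measurable_fun setT (fun x : 'cV[R]_n => e *: x + h)%R.
Proof.
apply/measurable_fun_cVP => i.
rewrite (_ : _ \o _ = (fun x => e * @cV_coord R n i x + h i 0)%R); last first.
  by apply/funext => x; rewrite /= /cV_coord !mxE.
apply: measurable_funD => //; apply: measurable_funM => //.
exact: measurable_cV_coord.
Qed.

Lemma cV_cons_affine n (e : R) (h : 'cV[R]_n.+1) (x : measurableTypeR R) y :
  (e *: cV_cons (x, y) + h =
   cV_cons ((e * x + h 0 0) : measurableTypeR R, e *: y + \col_i h (lift 0 i) 0))%R.
Proof.
apply/matrixP => i j; rewrite (ord1 j) [LHS]mxE [X in (X + _)%R]mxE.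
have [k ->|->] := unliftP (0%R : 'I_n.+1) i; last by rewrite !cV_cons0.
by rewrite !cV_consS/= !mxE.
Qed.

(** Induction on the dimension: the measure is an iterated product along [cV_cons], the map acts on
    each coordinate separately, and each coordinate contributes a factor [e^-1]. In dimension 0 the
    measure is a Dirac mass and the map is the identity. *)
Lemma lebesgue_cV_affine n (e : R) (h : 'cV[R]_n) (A : set 'cV[R]_n) :
  (0 < e)%R -> measurable A ->
  lebesgue_cV R n ((fun x : 'cV[R]_n => e *: x + h)%R @^-1` A) =
  (e ^- n)%:E * lebesgue_cV R n A.
Proof.
move=> e0; elim: n h A => [|n IH] h A mA.
  by rewrite /= expr0 invr1 mul1e; congr (dirac _ _); apply/seteqP; split => x /=;
    rewrite (_ : (_ + _)%R = x) //; apply/matrixP => -[].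
rewrite /= /lebesgue_cV_step /pushforward /product_measure1/=.
pose h' : 'cV[R]_n := (\col_i h (lift 0 i) 0)%R.
have mcA : measurable (@cV_cons R n @^-1` A).
  by rewrite -[X in measurable X]setTI; exact: measurable_cV_cons.
pose g (a : measurableTypeR R) := lebesgue_cV R n (xsection (@cV_cons R n @^-1` A) a).
have mg : measurable_fun setT g by exact: measurable_fun_xsection.
pose f (x : measurableTypeR R) : measurableTypeR R := (e * x + h 0%R 0%R)%R.
have mf : measurable_fun setT f.
  by apply: measurable_funD => //; exact: measurable_funM.
transitivity (\int[lebesgue_measure]_x ((e ^- n)%:E * (g \o f) x)).
  apply: eq_integral => x _; rewrite -(IH h'); last exact: measurable_xsection.
  congr (lebesgue_cV R n _); apply/seteqP; split => y /=;
    rewrite /xsection/= !inE/= => Ay; [have := Ay|move: Ay];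
    by rewrite cV_cons_affine.
transitivity ((e ^- n)%:E * \int[lebesgue_measure]_x (g \o f) x).
  apply: ge0_integralZl => //.
  - exact: measurableT_comp.
  - by rewrite lee_fin invr_ge0 exprn_ge0// ltW.
rewrite exprS invfM mulrC EFinM -muleA; congr (_ * _).
have e0' : (0 <= e^-1)%R by rewrite invr_ge0 ltW.
rewrite -(@ge0_integral_mscale _ _ R _ setT _ (NngNum e0'))//.
rewrite -[LHS](@ge0_integral_pushforward _ _ _ _ R f mf _ setT g)//.
apply: eq_measure_integral => B mB _.
exact: lebesgue_measure_affine.
Qed.

Lemma lebesgue_cV_box n (r : R) : (0 < r)%R ->
  lebesgue_cV R n [set x : 'cV[R]_n | forall i, `|x i 0| < r]%R =
  ((2 * r) ^+ n)%:E.
Proof.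
move=> r0; elim: n => [|n IH].
  by rewrite /= /dirac/= indicE mem_set// => -[].
rewrite /= /lebesgue_cV_step /pushforward.
rewrite (_ : _ @^-1` _ = `](- r)%R, r[%classic `*`
    [set x : 'cV[R]_n | forall i, `|x i 0| < r]%R).
  rewrite [LHS]product_measure1E; last 2 first.
  - exact: measurable_itv.
  - rewrite (_ : mkset _ = [set x : 'cV[R]_n | forall i,
        `|x i 0 - (0 : 'cV[R]_n) i 0| < r]%R); first exact: measurable_cV_coord_norm.
    by apply/seteqP; split=> x /= xr i; have := xr i; rewrite mxE subr0.
  rewrite exprS EFinM -IH; congr (_ * _).
  transitivity (lebesgue_measure (`](- r)%R, r[%classic : set R)) => //.
  by rewrite lebesgue_measure_itv/= lte_fin gtrN// -EFinB opprK mulr2n mulrDl mul1r.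
apply/seteqP; split=> [[a x] /= H|[a x] /= [ar xr] i].
  split=> [|i].
    by have := H 0%R; rewrite cV_cons0 /= in_itv/= ltr_norml.
  by have := H (lift 0%R i); rewrite cV_consS.
have [k ->|->] := unliftP (0%R : 'I_n.+1) i; rewrite ?cV_consS ?cV_cons0//=.
by rewrite ltr_norml; rewrite in_itv in ar.
Qed.

Lemma lebesgue_cV_ball n (x : 'cV[R]_n) (r : R) : (0 < r)%R ->
  lebesgue_cV R n (ball x r) = ((2 * r) ^+ n)%:E.
Proof.
move=> r0; rewrite -lebesgue_cV_box//.
have -> : [set y : 'cV[R]_n | forall i, `|y i 0| < r]%R =
    (fun y : 'cV[R]_n => 1 *: y + x)%R @^-1` (ball x r).
  apply/seteqP; split=> y /=; rewrite -ball_normE/= scale1r opprD addrCA subrr addr0 normrN.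
    by move=> yr; apply/cV_norm_ltP.
  by move/cV_norm_ltP; exact.
rewrite lebesgue_cV_affine//; first by rewrite expr1n invr1 mul1e.
by apply: open_cV_measurable; exact: ball_open.
Qed.

Lemma cball_lty n (r : R) : lebesgue_cV R n (cball n r) < +oo.
Proof.
have r1 : (0 < `|r| + 1)%R by rewrite ltr_wpDl.
apply: (@le_lt_trans _ _ (lebesgue_cV R n (ball 0%R (`|r| + 1)%R))); last first.
  by rewrite lebesgue_cV_ball// ltry.
apply: le_measure; rewrite ?inE.
- exact: measurable_cball.
- by apply: open_cV_measurable; exact: ball_open.
- move=> x xr; rewrite -ball_normE/= sub0r normrN (le_lt_trans xr)//.
  by rewrite (le_lt_trans (ler_norm _))// ltrDl.
Qed.

Section integral_affine.
Context n (e : R) (h : 'cV[R]_n) (e0 : (0 < e)%R).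
Let mu := lebesgue_cV R n.

Let f (x : 'cV[R]_n) : 'cV[R]_n := (e *: x + h)%R.
Let mf : measurable_fun setT f. Proof. exact: measurable_affine. Qed.

Lemma ge0_integral_affine (A : set 'cV[R]_n) (g : 'cV[R]_n -> \bar R) :
  measurable A -> measurable_fun A g -> (forall x, A x -> 0 <= g x) ->
  \int[mu]_(x in (fun x : 'cV[R]_n => e *: x + h)%R @^-1` A) g (e *: x + h)%R =
  (e ^- n)%:E * \int[mu]_(x in A) g x.
Proof.
move=> mA mg g0.
have e0' : (0 <= e ^- n)%R by rewrite invr_ge0 exprn_ge0// ltW.
rewrite -(@ge0_integral_mscale _ _ R mu _ mA (NngNum e0'))//.
rewrite -[LHS](@ge0_integral_pushforward _ _ _ _ R f mf _ A g)//; last first.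
  by move=> x /set_mem; exact: g0.
apply: eq_measure_integral => B mB _.
exact: lebesgue_cV_affine.
Qed.

Lemma integral_affine (g : 'cV[R]_n -> \bar R) : measurable_fun setT g ->
  \int[mu]_x g (e *: x + h)%R = (e ^- n)%:E * \int[mu]_x g x.
Proof.
move=> mg; rewrite integralE [in RHS]integralE.
have e0' : (0 < e ^- n)%R by rewrite invr_gt0 exprn_gt0.
have H (k : 'cV[R]_n -> \bar R) : measurable_fun setT k -> (forall x, 0 <= k x) ->
    \int[mu]_x k (e *: x + h)%R = (e ^- n)%:E * \int[mu]_x k x.
  by move=> mk k0; rewrite -ge0_integral_affine// preimage_setT.
(* A positive real factor distributes over every difference of extended reals, infinite values
   included, so the formula covers non-integrable [g] as well. *)
have cB (c : R) (a b : \bar R) : (0 < c)%R -> c%:E * (a - b) = c%:E * a - c%:E * b.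
  move=> c0; case: a b => [a||] [b||]; rewrite -?EFinN -?EFinD -?EFinM//=
    ?gt0_muley ?gt0_muleNy ?lte_fin//= -?EFinM -?EFinB ?mulrBr//=.
rewrite cB//.
have mp : measurable_fun setT (g^\+)%E by exact: measurable_funepos.
have mn : measurable_fun setT (g^\-)%E by exact: measurable_funeneg.
rewrite -(H _ mp); last exact: funepos_ge0.
rewrite -(H _ mn); last exact: funeneg_ge0.
by congr (_ - _); apply: eq_integral => x _; rewrite ?funeposE ?funenegE.
Qed.

Lemma Rintegral_affine (g : 'cV[R]_n -> R) : measurable_fun setT g ->
  (\int[mu]_x g (e *: x + h) = e ^- n * \int[mu]_x g x)%R.
Proof.
move=> mg; rewrite /Rintegral (integral_affine (g := EFin \o g)).
  have e0' : (0 < e ^- n)%R by rewrite invr_gt0 exprn_gt0.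
  by case: (\int[mu]_x _) => [a||] //=; rewrite ?gt0_muley ?gt0_muleNy ?mulr0.
exact: measurableT_comp.
Qed.

End integral_affine.

End lebesgue_cV_affine.

Section powR_sums.
Context (R : realType).
Implicit Types (a b q : R).

Lemma ler_powRl a b q : 0 <= q -> 0 <= a -> a <= b -> a `^ q <= b `^ q.
Proof.
by move=> q0 a0 ab; rewrite ge0_ler_powR// nnegrE// (le_trans a0).
Qed.

(** The sum is at most [#|I|] times its largest term. The constant is not sharp, but it is valid for
    all [q > 0]. *)
Lemma powR_sum_le (I : finType) (a : I -> R) q : 0 < q ->
  (forall i, 0 <= a i) ->
  (\sum_i a i) `^ q <= #|I|%:R `^ q * \sum_i a i `^ q.
Proof.
move=> q0 a0; have [i0 _|I0] := pickP (fun _ : I => true); last first.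
  rewrite !big_pred0 ?mulr0 ?powR0 ?gt_eqF// => i; by have := I0 i.
have [j _ aj] := @arg_maxP _ _ _ i0 xpredT a isT.
apply: (@le_trans _ _ ((#|I|%:R * a j) `^ q)).
  apply: ler_powRl; [exact: ltW|exact: sumr_ge0|].
  by rewrite mulr_natl -sumr_const; apply: ler_sum => i _; exact: aj.
rewrite powRM// ler_wpM2l ?powR_ge0//.
by rewrite (bigD1 j)//= lerDl sumr_ge0// => i _; exact: powR_ge0.
Qed.

Lemma powR_add_le a b q : 0 < q -> 0 <= a -> 0 <= b ->
  (a + b) `^ q <= 2 `^ q * (a `^ q + b `^ q).
Proof.
move=> q0 a0 b0.
have := @powR_sum_le bool (fun c => if c then a else b) q q0.
by rewrite !big_bool card_bool; apply; case.
Qed.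

End powR_sums.

Section measurable_cV_ind.
Context (R : realType) (n : nat).

Lemma measurable_cV_ind (C : set (set 'cV[R]_n)) : sigma_algebra setT C ->
  (forall U, open U -> C U) -> forall A, measurable A -> C A.
Proof.
move=> sC oC; apply: smallest_sub => //; rewrite -bigcup_seq.
apply: bigcup_sub => i _ _ [B mB <-]; rewrite setTI.
have [C0 CD CU] := sC.
move: B mB; rewrite (measurable_realfun.RGenOInfty.measurableE R).
apply: smallest_sub; last first.
  move=> _ [x ->]; apply: oC.
  have /continuousP cc : continuous (fun x : 'cV[R]_n => x i 0).
    exact: coord_continuous.
  by apply: cc; exact: interval_open.
split => [|B CB|F CF] /=.
- by rewrite preimage_set0.
- by rewrite setTD preimage_setC -setTD; exact: CD.
- by rewrite preimage_bigcup; exact: CU.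
Qed.

End measurable_cV_ind.

(** * Continuity of translations in L^q_loc *)

Section translation.
Context (R : realType) (n : nat).
Implicit Types (q r : R) (h : 'cV[R]_n) (f g : 'cV[R]_n -> R) (A U : set 'cV[R]_n).
Let mu := lebesgue_cV R n.

Definition Lqloc q f := measurable_fun setT f /\
  forall r, (\int[mu]_(x in cball n r) (`|f x| `^ q)%:E < +oo)%E.

Definition shift_cvg q f := forall r (e : R), 0 < e ->
  exists2 d : R, 0 < d & forall h : 'cV[R]_n, `|h| <= d ->
  (\int[mu]_(x in cball n r) (`|f (x + h) - f x| `^ q)%:E <= e%:E)%E.

Definition flip A r (h : 'cV[R]_n) : set 'cV[R]_n :=
  [set x | `|x| <= r /\ ~ (A (x + h) <-> A x)].

(** Continuity of translations for the indicator of [A], in measure and on bounded sets. Bounding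
    [flip] by some measurable [V] makes the property easy to pass through complements and countable
    unions. *)
Definition small_flip A := measurable A /\ forall r (e : R), 0 < e ->
  exists2 d : R, 0 < d & forall h : 'cV[R]_n, `|h| <= d ->
    exists2 V, measurable V & flip A r h `<=` V /\ (mu V <= e%:E)%E.

Lemma measurable_fun_shift d (T : measurableType d) (f : 'cV[R]_n -> T) h :
  measurable_fun setT f -> measurable_fun setT (fun x : 'cV[R]_n => f (x + h)).
Proof.
move=> mf; apply: (@measurableT_comp _ _ _ _ _ _ f _ (fun x : 'cV[R]_n => x + h)) => //.
rewrite (_ : (fun x => _) = (fun x : 'cV[R]_n => 1 *: x + h)); last first.
  by apply/funext => x; rewrite scale1r.
exact: measurable_affine.
Qed.

Lemma measurable_shift A h : measurable A -> measurable [set x : 'cV[R]_n | A (x + h)].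
Proof.
move=> mA; rewrite (_ : mkset _ = (fun x : 'cV[R]_n => 1 *: x + h) @^-1` A).
  by rewrite -[X in measurable X]setTI; exact: measurable_affine.
by apply/seteqP; split => x; rewrite /= scale1r.
Qed.

Lemma ge0_integral_shift A (g : 'cV[R]_n -> \bar R) h :
  measurable A -> measurable_fun A g -> (forall x, A x -> 0 <= g x)%E ->
  (\int[mu]_(x in [set x : 'cV[R]_n | A (x + h)%R]) g (x + h)%R = \int[mu]_(x in A) g x)%E.
Proof.
move=> mA mg g0; have := @ge0_integral_affine R n 1 h ltr01 A g mA mg g0.
rewrite expr1n invr1 mul1e => <-.
rewrite (_ : mkset _ = (fun x : 'cV[R]_n => 1 *: x + h) @^-1` A); last first.
  by apply/seteqP; split => x; rewrite /= scale1r.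
by apply: eq_integral => x _; rewrite scale1r.
Qed.

Lemma lebesgue_cV_shift A h : measurable A -> mu [set x : 'cV[R]_n | A (x + h)] = mu A.
Proof.
move=> mA; have := @lebesgue_cV_affine R n 1 h A ltr01 mA.
rewrite expr1n invr1 mul1e => <-; congr (mu _).
by apply/seteqP; split => x; rewrite /= scale1r.
Qed.

(** If a shift by [h] makes a point enter or leave [U], then [x] or [x + h] lies in [U] at distance
    at most [|h|] from the complement. The layers [B r k] of points of [U] near the complement
    decrease to the empty set because [U] is open, so their measure tends to 0. *)
Lemma small_flip_open U : open U -> small_flip U.
Proof.
move=> oU; split; first exact: open_cV_measurable.
pose B r k := cball n r `&` U `&` \bigcup_(z in ~` U) ball z k.+1%:R^-1.
have mB r k : measurable (B r k).
  apply: measurableI; first apply: measurableI.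
  - exact: measurable_cball.
  - exact: open_cV_measurable.
  - by apply: open_cV_measurable; apply: bigcup_open => z _; exact: ball_open.
have Bsmall r e : 0 < e -> exists k, (mu (B r k) <= e%:E)%E.
  move=> e0.
  have B0 : \bigcap_k B r k = set0.
    apply/seteqP; split => // x Bx.
    have [[_ Ux] _] := Bx 0%N Logic.I.
    have /nbhs_ballP[d d0 dU] : nbhs x U by exact: open_nbhs_nbhs.
    have [k _ /(_ _ (leqnn k)) kd] := near_infty_natSinv_lt (PosNum d0).
    have [_ [z Uz xz]] := Bx k Logic.I; apply: Uz; apply: dU.
    by apply: (@le_ball _ _ _ k.+1%:R^-1); [exact: ltW|exact: ball_sym].
  have : mu \o B r @ \oo --> mu (\bigcap_k B r k).
    apply: nonincreasing_cvg_mu => //.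
    - apply: le_lt_trans (cball_lty n r); apply: le_measure; rewrite ?inE//.
      + exact: measurable_cball.
      + by move=> x [[]].
    - by rewrite B0.
    - move=> i j ij; apply/subsetPset => x [? [z Uz xz]]; split => //.
      exists z => //; apply: le_ball xz.
      by rewrite lef_pV2 ?posrE ?ltr0n// ler_nat.
  rewrite B0 measure0 => /fine_cvgP[finB /cvgrPdist_le /(_ _ e0)[k _ kB]].
  have [k' _ finB'] := finB.
  exists (maxn k k'); have := kB (maxn k k') (leq_maxl _ _).
  rewrite /= sub0r normrN -(@fineK _ (mu _)); last exact: (finB' (maxn k k') (leq_maxr _ _)).
  by move=> /(le_trans (ler_norm _)); rewrite lee_fin.
move=> r e e0.
have [k kB] := Bsmall (r + 1) (e / 2) (divr_gt0 e0 (ltr0n _ 2)).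
have k0 : 0 < k.+1%:R^-1 :> R by rewrite invr_gt0 ltr0n.
(* The bound 1 keeps [x + h] in the cube of radius [r + 1]; the halving gives the strict inequality
   that open balls require. *)
exists (Num.min 1 (k.+1%:R^-1 / 2)).
  by rewrite lt_min ltr01 divr_gt0.
move=> h; rewrite le_min => /andP[h1 hk].
have hk' : `|h| < k.+1%:R^-1 by rewrite (le_lt_trans hk)// ltr_pdivrMr// ltr_pMr// ltr1n.
exists (B (r + 1) k `|` [set x : 'cV[R]_n | B (r + 1) k (x + h)]).
  by apply: measurableU => //; exact: measurable_shift.
split; last first.
  apply: (le_trans (measureU2 mu _ _)) => //; first exact: measurable_shift.
  have kBh : (mu [set x : 'cV[R]_n | B (r + 1)%R k (x + h)%R] <= (e / 2)%:E)%E.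
    by rewrite lebesgue_cV_shift.
  by rewrite [e]splitr EFinD; exact: leeD.
move=> x [xr nA].
have [Ux|Ux] := pselect (U x); have [Uxh|Uxh] := pselect (U (x + h)).
- by exfalso; apply: nA.
- left; split; first by split => //; rewrite /cball/= (le_trans xr)// lerDl.
  by exists (x + h) => //; rewrite -ball_normE/= addrAC subrr add0r.
- right; split.
    by split => //; rewrite /cball/= (le_trans (ler_normD _ _))// lerD.
  by exists x => //; rewrite -ball_normE/= opprD addrA subrr sub0r normrN.
- by exfalso; apply: nA.
Qed.

Lemma small_flip_setU A A' : small_flip A -> small_flip A' -> small_flip (A `|` A').
Proof.
move=> [mA fA] [mA' fA']; split; first exact: measurableU.
move=> r e e0; have e2 := divr_gt0 e0 (ltr0n R 2).
have [d d0 dA] := fA r _ e2; have [d' d'0 dA'] := fA' r _ e2.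
exists (Num.min d d'); first by rewrite lt_min d0.
move=> h; rewrite le_min => /andP[/dA[V mV [fV muV]] /dA'[V' mV' [fV' muV']]].
exists (V `|` V'); first exact: measurableU.
split; last first.
  apply: (le_trans (measureU2 mu _ _)) => //.
  by rewrite [e]splitr EFinD leeD.
move=> x [xr nA]; have [Ax|Ax] := pselect (A (x + h) <-> A x); last by left; apply: fV.
right; apply: fV'; split=> // Ax'; apply: nA; rewrite /setU/=; tauto.
Qed.

(** Sets with small flips form a sigma-algebra containing the open sets. For a countable union, a
    partial union [G N] captures all but a set [W N] of small measure within a cube, and a flip of
    the union is a flip of [G N] or has [x] or [x + h] in [W N]. *)
Lemma small_flip_measurable A : measurable A -> small_flip A.
Proof.
apply: measurable_cV_ind; last exact: small_flip_open.
split => [|B [mB fB]|F fF].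
- by apply: small_flip_open; exact: open0.
- split; first exact: measurableD.
  move=> r e /(fB r)[d d0 dB]; exists d => // h /dB[V mV [fV muV]].
  exists V => //; split => // x [xr nA]; apply: fV; split => // AB; apply: nA.
  by rewrite /setD/=; tauto.
pose G N := \bigcup_(k < N) F k.
have GS N : G N.+1 = G N `|` F N.
  by rewrite /G !bigcup_mkord big_ord_recr.
have fG N : small_flip (G N).
  elim: N => [|N IH]; last by rewrite GS; exact: small_flip_setU.
  rewrite /G bigcup_mkord big_ord0; apply: small_flip_open; exact: open0.
have mF k : measurable (F k) by have [] := fF k.
have mU : measurable (\bigcup_k F k) by exact: bigcupT_measurable.
have mG N : measurable (G N) by have [] := fG N.
split=> // r e e0.
pose W N := cball n (r + 1) `&` ((\bigcup_k F k) `\` G N).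
have mW N : measurable (W N).
  apply: measurableI; first exact: measurable_cball.
  exact: measurableD.
have e3 : 0 < e / 3 by rewrite divr_gt0.
have [N muW] : exists N, (mu (W N) <= (e / 3)%:E)%E.
  have W0 : \bigcap_k W k = set0.
    apply/seteqP; split => // x Wx.
    have [_ [[k _ Fkx] _]] := Wx 0%N Logic.I.
    by have [_ [_]] := Wx k.+1 Logic.I; apply; exists k => /=.
  have : mu \o W @ \oo --> mu (\bigcap_k W k).
    apply: nonincreasing_cvg_mu => //.
    - apply: le_lt_trans (cball_lty n (r + 1)); apply: le_measure; rewrite ?inE//.
      + exact: measurable_cball.
      + by move=> x [].
    - by rewrite W0.
    - move=> i j ij; apply/subsetPset => x [? [? nG]]; split => //; split => //.
      move=> [k /= ki Fk]; apply: nG; exists k => //=.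
      exact: leq_trans ij.
  rewrite W0 measure0 => /fine_cvgP[[k' _ finB] /cvgrPdist_le /(_ _ e3)[k _ kB]].
  exists (maxn k k'); have := kB (maxn k k') (leq_maxl _ _).
  rewrite /= sub0r normrN -(@fineK _ (mu _)); last exact: (finB (maxn k k') (leq_maxr _ _)).
  by move=> /(le_trans (ler_norm _)); rewrite lee_fin.
have [_ /(_ r _ e3)[d d0 dG]] := fG N.
exists (Num.min d 1); first by rewrite lt_min d0 ltr01.
move=> h; rewrite le_min => /andP[/dG[V mV [fV muV]] h1].
have mWh : measurable [set x : 'cV[R]_n | W N (x + h)] by exact: measurable_shift.
exists (V `|` (W N `|` [set x : 'cV[R]_n | W N (x + h)])).
  by apply: measurableU => //; exact: measurableU.
split; last first.
  apply: (le_trans (measureU2 mu _ _)) => //; first exact: measurableU.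
  rewrite (_ : e = e / 3 + (e / 3 + e / 3)); last by field.
  have muWh : (mu [set x : 'cV[R]_n | W N (x + h)%R] <= (e / 3)%:E)%E.
    by rewrite lebesgue_cV_shift.
  rewrite EFinD; apply: leeD => //; apply: (le_trans (measureU2 mu _ _)) => //.
  by rewrite EFinD; exact: leeD.
move=> x [xr nA]; have [Ax|Ax] := pselect (G N (x + h) <-> G N x); last by left; apply: fV.
have GF : G N `<=` \bigcup_k F k by move=> y [k _ Fk]; exists k.
have [Gx|Gx] := pselect (G N x).
  exfalso; apply: nA; split => _; first exact: GF.
  by apply: GF; apply/Ax.
right; have [Ux|Ux] := pselect ((\bigcup_k F k) x).
  left; split; last by split.
  by rewrite /cball/= (le_trans xr)// lerDl.
right; split.
  by rewrite /cball/= (le_trans (ler_normD _ _))// lerD.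
split; last by move/Ax.
by apply: contrapT => nU; apply: nA; split.
Qed.

End translation.

Lemma ereal_cvg0_le (R : realType) (u : (\bar R)^nat) (e : R) :
  u @ \oo --> 0%E -> 0 < e -> exists k, (u k <= e%:E)%E.
Proof.
move=> /fine_cvgP[[k' _ finu] /cvgrPdist_le uc] /uc[k _ ku].
exists (maxn k k'); have := ku (maxn k k') (leq_maxl _ _).
rewrite /= sub0r normrN -[X in _ -> (X <= _)%E]fineK; last exact: (finu (maxn k k') (leq_maxr _ _)).
by move=> /(le_trans (ler_norm _)); rewrite lee_fin.
Qed.

Section translation_continuity.
Context (R : realType) (n : nat).
Implicit Types (q r : R) (h : 'cV[R]_n) (f g : 'cV[R]_n -> R) (A U : set 'cV[R]_n).
Let mu := lebesgue_cV R n.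

Lemma measurable_normr_powR d (T : measurableType d) (D : set T) (f : T -> R) q :
  measurable_fun D f -> measurable_fun D (fun x => (`|f x| `^ q)%:E).
Proof.
move=> mf; apply/measurable_EFinP.
apply: (measurableT_comp (measurable_powR q)).
exact: measurableT_comp.
Qed.

Lemma measurable_shift_diff f h : measurable_fun setT f ->
  measurable_fun setT (fun x : 'cV[R]_n => f (x + h) - f x).
Proof. by move=> mf; apply: measurable_funB => //; exact: measurable_fun_shift. Qed.

Lemma shift_cvgZ q f (c : R) : 0 < q -> measurable_fun setT f ->
  shift_cvg q f -> shift_cvg q (fun x => c * f x).
Proof.
move=> q0 mf cf r e e0.
have c0 : 0 < `|c| `^ q + 1 by rewrite ltr_wpDl// powR_ge0.
have [d d0 df] := cf r (e / (`|c| `^ q + 1)) (divr_gt0 e0 c0).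
exists d => // h /df fe.
under eq_integral => x _.
  rewrite -mulrBr normrM powRM// EFinM; over.
rewrite ge0_integralZl//; last 2 first.
- exact: measurable_cball.
- apply: measurable_funTS; apply: measurable_normr_powR; exact: measurable_shift_diff.
apply: (@le_trans _ _ ((`|c| `^ q)%:E * (e / (`|c| `^ q + 1))%:E)%E).
  by rewrite lee_wpmul2l// lee_fin powR_ge0.
rewrite -EFinM lee_fin mulrCA ger_pMr// ler_pdivrMr// mul1r.
by rewrite lerDl.
Qed.

Lemma ge0_integral_powRD (A : set 'cV[R]_n) q f g (a b : R) : 0 < q ->
  measurable A -> measurable_fun setT f -> measurable_fun setT g ->
  (\int[mu]_(x in A) (`|f x| `^ q)%:E <= a%:E)%E ->
  (\int[mu]_(x in A) (`|g x| `^ q)%:E <= b%:E)%E ->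
  (\int[mu]_(x in A) (`|f x + g x| `^ q)%:E <= (2 `^ q * (a + b))%:E)%E.
Proof.
move=> q0 mA mf mg fa gb.
have mfq : measurable_fun A (fun x => (`|f x| `^ q)%:E).
  by apply: measurable_funTS; exact: measurable_normr_powR.
have mgq : measurable_fun A (fun x => (`|g x| `^ q)%:E).
  by apply: measurable_funTS; exact: measurable_normr_powR.
apply: (@le_trans _ _ (\int[mu]_(x in A)
    ((2 `^ q)%:E * ((`|f x| `^ q)%:E + (`|g x| `^ q)%:E)))%E).
  apply: ge0_le_integral => //.
  - apply: measurable_funTS; apply: measurable_normr_powR; exact: measurable_funD.
  - by apply: emeasurable_funM => //; exact: emeasurable_funD.
  - move=> x _; rewrite -EFinD -EFinM lee_fin.
    apply: le_trans (powR_add_le q0 _ _) => //.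
    by apply: ler_powRl => //; [exact: ltW|exact: ler_normD].
rewrite ge0_integralZl//; last 2 first.
- exact: emeasurable_funD.
- by move=> x _; rewrite adde_ge0.
rewrite EFinM lee_wpmul2l ?lee_fin ?powR_ge0// ge0_integralD//.
by rewrite EFinD; exact: leeD.
Qed.

Lemma shift_cvgD q f g : 0 < q -> measurable_fun setT f -> measurable_fun setT g ->
  shift_cvg q f -> shift_cvg q g -> shift_cvg q (fun x => f x + g x).
Proof.
move=> q0 mf mg cf cg r e e0.
have c0 : 0 < e / (2 `^ q * 2) by rewrite divr_gt0// mulr_gt0// powR_gt0.
have [d d0 df] := cf r _ c0; have [d' d'0 dg] := cg r _ c0.
exists (Num.min d d'); first by rewrite lt_min d0.
move=> h; rewrite le_min => /andP[/df fe /dg ge].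
rewrite (_ : e = 2 `^ q * (e / (2 `^ q * 2) + e / (2 `^ q * 2))); last first.
  by field; rewrite gt_eqF// powR_gt0.
under eq_integral do rewrite opprD addrACA.
exact: (ge0_integral_powRD q0 (measurable_cball r) (measurable_shift_diff h mf)
  (measurable_shift_diff h mg) fe ge).
Qed.

Lemma shift_cvg_indic q A : 0 < q -> measurable A -> shift_cvg q (\1_A : _ -> R).
Proof.
move=> q0 mA r e /(proj2 (small_flip_measurable mA) r)[d d0 dA].
exists d => // h /dA[V mV [fV muV]]; apply: le_trans muV.
have -> : mu V = (\int[mu]_x (\1_V x)%:E)%E by rewrite integral_indic// setIT.
rewrite integral_mkcond; apply: ge0_le_integral => //.
- by move=> x _; apply: erestrict_ge0 => y _; rewrite lee_fin powR_ge0.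
- apply/(measurable_restrictT _ (measurable_cball r)).
  apply: measurable_funTS; apply: measurable_normr_powR.
  by apply: measurable_shift_diff; exact: measurable_indic.
- by apply/measurable_EFinP; exact: measurable_indic.
- move=> x _; rewrite patchE; case: ifPn => [/set_mem xr|_]; last first.
    by rewrite lee_fin indicE.
  rewrite lee_fin; have [Vx|Vx] := pselect (V x).
    rewrite [leRHS]indicE mem_set//= !indicE.
    by case: (_ \in A); case: (_ \in A); rewrite ?subrr ?subr0 ?sub0r ?normrN1
      ?normr0 ?normr1 ?powR0 ?powR1// gt_eqF.
  have /iff_refl [H1 H2] : A (x + h) <-> A x.
    by apply: contrapT => nA; apply: Vx; apply: fV.
  rewrite !indicE (_ : (_ + _ \in A) = (x \in A)) ?subrr ?normr0 ?powR0 ?gt_eqF//.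
  by apply/idP/idP => /set_mem H; apply/mem_set; tauto.
Qed.

Import HBNNSimple.

Lemma shift_cvg_nnsfun q (f : {nnsfun 'cV[R]_n >-> R}) : 0 < q -> shift_cvg q f.
Proof.
move=> q0; pose s := finmap.enum_fset (fset_set (range f)).
pose F (i : nat) x : R := s`_i * \1_(f @^-1` [set s`_i]) x.
have mF i : measurable_fun setT (F i).
  by apply: measurable_funM => //; exact: measurable_indic.
rewrite (_ : (f : _ -> _) = fun x => \sum_(i < size s) F i x); last first.
  by apply/funext => x; rewrite fimfunEord.
elim: (size s) => [|N IH].
  rewrite (_ : (fun x => _) = fun x => 0 * (\1_set0 x)).
    apply: (@shift_cvgZ q (\1_set0) 0 q0); last exact: shift_cvg_indic.
    exact: measurable_indic.
  by apply/funext => x; rewrite big_ord0 mul0r.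
rewrite (_ : (fun x => _) = fun x => \sum_(i < N) F i x + F N x); last first.
  by apply/funext => x; rewrite big_ord_recr.
apply: (shift_cvgD q0 _ (mF N) IH); first exact: measurable_sum.
apply: (@shift_cvgZ q (\1_(f @^-1` [set s`_N])) s`_N q0).
  exact: measurable_indic.
exact: shift_cvg_indic.
Qed.

(** The increment of [f] is the sum of [(f - g) (x + h)], [g (x + h) - g x] and [- (f - g) x]. The
    approximation is taken on radius [r + 1], which contains the shifted cube, and [c] collects the
    constants of two uses of [ge0_integral_powRD]. *)
Lemma shift_cvg_approx q f : 0 < q -> measurable_fun setT f ->
  (forall r (e : R), 0 < e -> exists g, [/\ measurable_fun setT g, shift_cvg q g &
    (\int[mu]_(x in cball n r) (`|f x - g x| `^ q)%:E <= e%:E)%E]) ->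
  shift_cvg q f.
Proof.
move=> q0 mf fg r e e0; set c : R := 2 `^ q * (2 `^ q * 2 + 1).
have p0 : 0 < 2 `^ q :> R by exact: powR_gt0.
have c0 : 0 < c by rewrite mulr_gt0// addr_gt0// mulr_gt0.
have e1 : 0 < e / c by rewrite divr_gt0.
have [g [mg cg fge]] := fg (r + 1) _ e1.
have [d d0 dg] := cg r _ e1.
exists (Num.min d 1); first by rewrite lt_min d0 ltr01.
move=> h; rewrite le_min => /andP[/dg ge h1].
rewrite (_ : e = 2 `^ q * (2 `^ q * (e / c + e / c) + e / c)); last first.
  by rewrite /c; field; rewrite -/c gt_eqF//= gt_eqF.
have mfg : measurable_fun setT (fun x => f x - g x) by exact: measurable_funB.
have fgr : (\int[mu]_(x in cball n r) (`|f x - g x| `^ q)%:E <= (e / c)%:E)%E.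
  apply: le_trans fge; apply: ge0_subset_integral => //.
  - exact: measurable_cball.
  - exact: measurable_cball.
  - by apply: measurable_funTS; exact: measurable_normr_powR.
  - by apply: cball_le; rewrite lerDl.
have fgh : (\int[mu]_(x in cball n r) (`|f (x + h)%R - g (x + h)%R| `^ q)%:E <= (e / c)%:E)%E.
  apply: le_trans fge.
  rewrite -(@ge0_integral_shift _ _ _ (fun x => (`|f x - g x| `^ q)%:E) h)//; last 2 first.
  - exact: measurable_cball.
  - by apply: measurable_funTS; exact: measurable_normr_powR.
  apply: ge0_subset_integral => //.
  - exact: measurable_cball.
  - by apply: measurable_shift; exact: measurable_cball.
  - apply: measurable_funTS; apply: measurable_normr_powR.
    exact: (@measurable_fun_shift _ _ _ _ (fun x => f x - g x)).
  - by move=> x xr; rewrite /cball/= (le_trans (ler_normD _ _))// lerD.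
have mfgh : measurable_fun setT (fun x : 'cV[R]_n => f (x + h) - g (x + h)).
  exact: (@measurable_fun_shift _ _ _ _ (fun x => f x - g x)).
rewrite (eq_integral (fun x : 'cV[R]_n => (`| ((f (x + h)%R - g (x + h)%R) + (g (x + h)%R - g x)) +
   (- (f x - g x))| `^ q)%:E)); last first.
  by move=> x _; congr ((`|_| `^ q)%:E); ring.
pose F (x : 'cV[R]_n) := f (x + h) - g (x + h).
pose G (x : 'cV[R]_n) := g (x + h) - g x.
have mG : measurable_fun setT G by exact: measurable_shift_diff.
have FG := @ge0_integral_powRD (cball n r) q F G _ _ q0 (measurable_cball r) mfgh mG fgh ge.
apply: (@ge0_integral_powRD (cball n r) q (fun x => F x + G x) (fun x => - (f x - g x))
  _ _ q0 (measurable_cball r) _ _ FG).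
- exact: measurable_funD.
- exact: measurableT_comp.
- rewrite (eq_integral (fun x => (`|f x - g x| `^ q)%:E)); first exact: fgr.
  by move=> x _; rewrite normrN.
Qed.

(** Simple functions increasing to [f] approximate it in L^q on cubes, by dominated convergence with
    majorant [|f|^q]. *)
Lemma Lqloc_shift_cvg_ge0 q f : 0 < q -> Lqloc q f -> (forall x, 0 <= f x) ->
  shift_cvg q f.
Proof.
move=> q0 [mf If] f0; apply: shift_cvg_approx => // r e e0.
have mEf : measurable_fun setT (EFin \o f) by exact/measurable_EFinP.
have [g [ndg cvg_g]] := approximation measurableT mEf (fun x _ => f0 x).
have gf k x : g k x <= f x.
  have cg : g^~ x @ \oo --> f x 
    by have /fine_cvgP[_] : EFin \o g^~ x @ \oo --> (f x)%:E by exact: cvg_g.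
  have -> : f x = limn (g^~ x) by apply/esym/cvg_lim.
  apply: (@nondecreasing_cvgn_le _ (g^~ x)); last by apply/cvg_ex; exists (f x).
  by move=> i j ij; have /lefP := ndg _ _ ij; exact.
have [] := @dominated_convergence _ _ _ mu (cball n r) (measurable_cball r)
   (fun k x => (`|f x - g k x| `^ q)%:E) (cst 0%E) (fun x => (`|f x| `^ q)%:E).
- move=> k; apply: measurable_funTS; apply: measurable_normr_powR.
  by apply: measurable_funB.
- exact: measurable_cst.
- apply/aeW => x _; apply: cvg_EFin; first by near=> k.
  have cg : g^~ x @ \oo --> f x 
    by have /fine_cvgP[_] : EFin \o g^~ x @ \oo --> (f x)%:E by exact: cvg_g.
  apply/cvgrPdist_le => e1 e10.
  move/cvgrPdist_le : cg => /(_ (e1 `^ q^-1) (powR_gt0 _ e10)).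
  apply: filterS => k fgk; rewrite sub0r normrN ger0_norm ?powR_ge0//.
  apply: (le_trans (ler_powRl (ltW q0) _ fgk)) => //.
  by rewrite -powRrM mulVf ?gt_eqF// powRr1// ltW.
- apply/integrableP; split.
    by apply: measurable_funTS; exact: measurable_normr_powR.
  rewrite (eq_integral (fun x => (`|f x| `^ q)%:E)) ?If//.
  by move=> x _; rewrite gee0_abs// lee_fin powR_ge0.
- apply/aeW => x k _; rewrite gee0_abs ?lee_fin ?powR_ge0//.
  apply: ler_powRl => //; first exact: ltW.
  by rewrite !ger0_norm// ?subr_ge0// gerBl.
move=> _ _; rewrite integral_cst//; last exact: measurable_cball.
rewrite mul0e => /ereal_cvg0_le-/(_ _ e0)[k fgk].
exists (g k); split => //; exact: shift_cvg_nnsfun.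
Unshelve. all: by end_near. Qed.

Lemma Lqloc_shift_cvg q f : 0 < q -> Lqloc q f -> shift_cvg q f.
Proof.
move=> q0 [mf If].
have mp : measurable_fun setT f^\+ by exact: measurable_funrpos.
have mn : measurable_fun setT f^\- by exact: measurable_funrneg.
have sub (g : 'cV[R]_n -> R) : measurable_fun setT g -> (forall x, `|g x| <= `|f x|) ->
    Lqloc q g.
  move=> mg gf; split; first exact: mg.
  move=> r; apply: le_lt_trans (If r).
  apply: ge0_le_integral => //.
  - exact: measurable_cball.
  - by apply: measurable_funTS; exact: measurable_normr_powR.
  - by apply: measurable_funTS; exact: measurable_normr_powR.
  - by move=> x _; rewrite lee_fin; apply: ler_powRl => //; exact: ltW.
rewrite (_ : f = fun x => f^\+ x + (-1) * f^\- x); last first.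
  by apply/funext => x; rewrite mulN1r -[in LHS](funrposBneg f).
apply: (shift_cvgD q0) => //; first exact: measurable_funM.
  apply: (Lqloc_shift_cvg_ge0 q0); last exact: funrpos_ge0.
  apply: sub; first exact: mp.
  by move=> x; rewrite ger0_norm// /funrpos ge_max normr_ge0 andbT ler_norm.
apply: (@shift_cvgZ q f^\- (-1) q0); first exact: mn.
apply: (Lqloc_shift_cvg_ge0 q0); last exact: funrneg_ge0.
apply: sub; first exact: mn.
by move=> x; rewrite ger0_norm// /funrneg ge_max normr_ge0 andbT -normrN ler_norm.
Qed.

End translation_continuity.

Lemma measurable_Rintegral_param d1 d2 (T1 : measurableType d1)
    (T2 : measurableType d2) (R : realType)
    (m2 : {sigma_finite_measure set T2 -> \bar R}) (f : T1 * T2 -> R) :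
  measurable_fun setT f ->
  measurable_fun setT (fun x => \int[m2]_y f (x, y)).
Proof.
move=> mf; have mEf : measurable_fun setT (EFin \o f) by exact/measurable_EFinP.
rewrite /Rintegral; apply: (measurableT_comp (fine_measurable measurableT)).
under eq_fun => x do rewrite integralE.
apply: emeasurable_funB.
- have := @measurable_fun_fubini_tonelli_F _ _ _ _ R m2 _
    (measurable_funepos mEf) (fun x => funepos_ge0 _ x).
  congr measurable_fun; apply/funext => x.
  by apply: eq_integral => y _; rewrite !funeposE.
- have := @measurable_fun_fubini_tonelli_F _ _ _ _ R m2 _
    (measurable_funeneg mEf) (fun x => funeneg_ge0 _ x).
  congr measurable_fun; apply/funext => x.
  by apply: eq_integral => y _; rewrite !funenegE.
Qed.

(** * A Jensen-type inequality for weighted integrals *)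

Section local_integrals.
Context (R : realType) (n : nat).
Implicit Types (q r : R) (h : 'cV[R]_n) (f g w : 'cV[R]_n -> R) (A : set 'cV[R]_n).
Let mu := lebesgue_cV R n.

(** A linear substitute for the Hoelder inequality: either [t <= s], or [t > s] and
    [(t / s)^(q - 1) >= 1]. Integrated and optimised in [s], it yields [powR_Rintegral_le]. *)
Lemma ler_split_powR (q s t : R) : 1 <= q -> 0 < s -> 0 <= t ->
  t <= s + s `^ (1 - q) * t `^ q.
Proof.
move=> q1 s0 t0; have [ts|st] := leP t s.
  by rewrite (le_trans ts)// lerDl mulr_ge0// powR_ge0.
apply: (@le_trans _ _ (s `^ (1 - q) * t `^ q)); last by rewrite lerDr ltW.
have tp : 0 < t by exact: lt_trans st.
have -> : t `^ q = t * t `^ (q - 1) by rewrite mulr_powRB1// (lt_le_trans ltr01).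
rewrite mulrCA ler_peMr// -opprB powRN ler_pdivlMl ?powR_gt0// mulr1.
by apply: ler_powRl; rewrite ?subr_ge0// ltW.
Qed.

Lemma Lqloc1 q f : 1 <= q -> Lqloc q f -> Lqloc 1 f.
Proof.
move=> q1 [mf If]; split; first exact: mf.
move=> r; apply: (@le_lt_trans _ _
    (\int[mu]_(x in cball n r) (1%:E + (`|f x| `^ q)%:E))%E).
  apply: ge0_le_integral.
  - exact: measurable_cball.
  - by move=> x _; rewrite lee_fin powR_ge0.
  - by apply: measurable_funTS; exact: measurable_normr_powR.
  - apply: emeasurable_funD => //.
    by apply: measurable_funTS; exact: measurable_normr_powR.
  - move=> x _; rewrite -EFinD lee_fin powRr1//.
    by have := ler_split_powR q1 ltr01 (normr_ge0 (f x)); rewrite powR1 mul1r.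
rewrite ge0_integralD//; last 2 first.
- exact: measurable_cball.
- by apply: measurable_funTS; exact: measurable_normr_powR.
rewrite integral_cst; last exact: measurable_cball.
by rewrite mul1e lte_add_pinfty//; exact: cball_lty.
Qed.

Definition L1_cball f r : R := \int[mu]_(x in cball n r) `|f x|.

Lemma integrable_cball f r : Lqloc 1 f ->
  mu.-integrable (cball n r) (EFin \o f).
Proof.
move=> [mf If]; apply/integrableP; split.
  by apply/measurable_EFinP; exact: measurable_funTS.
apply: le_lt_trans (If r); rewrite le_eqVlt; apply/orP; left; apply/eqP.
by apply: eq_integral => x _ /=; rewrite powRr1.
Qed.

Lemma integrable_mul_bounded f w (r B : R) : Lqloc 1 f -> measurable_fun setT w ->
  (forall x, `|w x| <= B) -> (forall x, ~ cball n r x -> w x = 0) ->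
  mu.-integrable setT (EFin \o (fun x => f x * w x)) /\
  `|\int[mu]_x (f x * w x)| <= B * L1_cball f r.
Proof.
move=> lf mw wB w0.
have mr := @measurable_cball R n r.
have intf : mu.-integrable (cball n r) (EFin \o (fun x => `|f x|)).
  exact/integrable_norm/integrable_cball.
have intB : mu.-integrable (cball n r) (EFin \o (fun x => B * `|f x|)).
  have := integrableZl mr B intf; apply: eq_integrable => //.
have mfw : measurable_fun setT (fun x => f x * w x).
  by apply: measurable_funM => //; case: lf.
have H : mu.-integrable (cball n r) (EFin \o (fun x => f x * w x)).
  apply: le_integrable intB => //.
    by apply/measurable_EFinP; exact: measurable_funTS.
  move=> x _ /=; rewrite lee_fin normrM [leRHS]ger0_norm.
    by rewrite mulrC ler_wpM2r.
  by rewrite mulr_ge0// (le_trans _ (wB x)).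
have E : (fun x => f x * w x) = (fun x => f x * w x) \_ (cball n r).
  apply/funext => x; rewrite patchE; case: ifPn => // /negP nx.
  by rewrite w0 ?mulr0// => rx; apply: nx; rewrite inE.
split.
  rewrite E -restrict_EFin; exact/(integrable_mkcond _ mr).
rewrite E -Rintegral_mkcond; apply: le_trans (le_normr_Rintegral _ _) _ => //.
rewrite -RintegralZl//; apply: le_Rintegral => //.
  exact: integrable_norm.
by move=> x _; rewrite normrM mulrC ler_wpM2r.
Qed.

Lemma L1_cball_ge0 f r : 0 <= L1_cball f r.
Proof. by apply: Rintegral_ge0. Qed.

(** Jensen's inequality with a cruder constant. With [b] the integral on the right, [ler_split_powR]
    integrates to the bound [s M + s^(1 - q) b] for every [s > 0]. *)
Lemma powR_Rintegral_le (w G : 'cV[R]_n -> R) q (M : R) : 1 <= q -> 0 <= M ->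
  measurable_fun setT w -> measurable_fun setT G ->
  (\int[mu]_y (`|w y|)%:E <= M%:E)%E ->
  ((`|\int[mu]_y (w y * G y)| `^ q)%:E <=
   ((M + 1) `^ q)%:E * \int[mu]_y (`|w y| * `|G y| `^ q)%:E)%E.
Proof.
move=> q1 M0 mw mG wM.
have q0 : 0 < q by exact: lt_le_trans q1.
have M1 : 0 < M + 1 by rewrite ltr_wpDl.
have mnw : measurable_fun setT (fun y => (`|w y|)%:E).
  by apply/measurable_EFinP; exact: measurableT_comp.
have mwG : measurable_fun setT (fun y => (`|w y| * `|G y| `^ q)%:E).
  apply/measurable_EFinP; apply: measurable_funM; first exact: measurableT_comp.
  by apply/measurable_EFinP; exact: measurable_normr_powR.
have mwG1 : measurable_fun setT (fun y => (w y * G y)).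
  exact: measurable_funM.
set I := (\int[mu]_y (`|w y| * `|G y| `^ q)%:E)%E.
have I0 : (0 <= I)%E by apply: integral_ge0 => y _; rewrite lee_fin mulr_ge0// powR_ge0.
move E : I I0 => I' I0; case: I' E I0 => [b Ib b0|_ _|//]; last first.
  by rewrite gt0_muley ?lte_fin ?powR_gt0// leey.
rewrite lee_fin in b0.
have J s : 0 < s ->
    (\int[mu]_y (`|w y * G y|)%:E <= (s * M + s `^ (1 - q) * b)%:E)%E.
  move=> s0; apply: (@le_trans _ _ (\int[mu]_y
      (s%:E * (`|w y|)%:E + (s `^ (1 - q))%:E * (`|w y| * `|G y| `^ q)%:E))%E).
    apply: ge0_le_integral.
    - exact: measurableT.
    - by move=> y _; rewrite lee_fin.
    - by apply/measurable_EFinP; exact: measurableT_comp.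
    - by apply: emeasurable_funD; exact: emeasurable_funM.
    - move=> y _; rewrite -!EFinM -EFinD lee_fin normrM mulrC [_ * `|w y|]mulrC.
      rewrite [leRHS](_ : _ = (s + s `^ (1 - q) * `|G y| `^ q) * `|w y|); last by ring.
      by rewrite mulrC ler_wpM2r// ler_split_powR.
  rewrite ge0_integralD//; last 4 first.
  - by move=> y _; rewrite -EFinM lee_fin mulr_ge0// ltW.
  - exact: emeasurable_funM.
  - by move=> y _; rewrite -EFinM lee_fin !mulr_ge0 ?powR_ge0.
  - exact: emeasurable_funM.
  rewrite ge0_integralZl//; last by rewrite lee_fin ltW.
  rewrite ge0_integralZl//; last by rewrite lee_fin powR_ge0.
  rewrite -/I Ib EFinD; apply: leeD; last by rewrite EFinM.
  by rewrite EFinM lee_wpmul2l// lee_fin ltW.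
have JR s : 0 < s -> `|\int[mu]_y (w y * G y)| <= s * M + s `^ (1 - q) * b.
  move=> /J Js; have iG : mu.-integrable setT (EFin \o (fun y => w y * G y)).
    apply/integrableP; split; first exact/measurable_EFinP.
    by apply: le_lt_trans Js _; rewrite ltry.
  apply: (le_trans (le_normr_Rintegral measurableT iG)).
  by rewrite -lee_fin; apply: le_trans Js; rewrite /Rintegral fineK//;
    apply: integrable_fin_num => //; exact: (integrable_norm iG).
rewrite -EFinM lee_fin.
(* For [b = 0] no positive [s] is optimal; small values of [s] show that the integral vanishes. *)
have [b00|bn0] := eqVneq b 0.
  suff -> : \int[mu]_y (w y * G y) = 0.
    by rewrite normr0 powR0 ?gt_eqF// mulr_ge0// powR_ge0.
  apply/eqP; rewrite -normr_le0; apply/ler_addgt0Pr => e e0; rewrite add0r.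
  have := JR (e / (M + 1)) (divr_gt0 e0 M1); rewrite b00 mulr0 addr0.
  move/le_trans; apply; by rewrite mulrAC ler_pdivrMr// ler_wpM2l// ?ltW// ltrDl ltr01.
have bp : 0 < b by rewrite lt_neqAle eq_sym bn0.
(* The choice [s = b^(1/q)] balances the two terms into [(M + 1) b^(1/q)]. *)
have := JR (b `^ q^-1) (powR_gt0 _ bp).
have -> : (b `^ q^-1) `^ (1 - q) * b = b `^ q^-1.
  rewrite -powRrM -[X in _ * X]powRr1; last exact: ltW.
  rewrite -powRD ?(negPf bn0) ?implybT//; congr (_ `^ _).
  by field; rewrite gt_eqF.
rewrite -[X in _ + X]mul1r [_ * M]mulrC -mulrDl => Jb.
apply: (le_trans (ler_powRl (ltW q0) _ Jb)) => //.
rewrite powRM; [|exact: ltW|exact: powR_ge0].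
by rewrite -powRrM mulVf ?gt_eqF// powRr1// ltW.
Qed.

End local_integrals.

Lemma Rintegral_sum d (T : measurableType d) (R : realType)
    (mu : {measure set T -> \bar R}) (I : Type) (s : seq I) (F : I -> T -> R) :
  (forall i, mu.-integrable setT (EFin \o F i)) ->
  mu.-integrable setT (EFin \o (fun x => \sum_(i <- s) F i x)) /\
  \int[mu]_x (\sum_(i <- s) F i x) = \sum_(i <- s) \int[mu]_x F i x.
Proof.
move=> iF; elim: s => [|i s [ih1 ih2]].
  split.
    rewrite (_ : _ \o _ = cst 0%E); first exact: integrable0.
    by apply/funext => x /=; rewrite big_nil.
  rewrite big_nil (@eq_Rintegral _ _ _ _ _ (cst 0)); last by move=> x _; rewrite big_nil.
  by rewrite /Rintegral integral0_eq.
have E x : \sum_(j <- i :: s) F j x = F i x + \sum_(j <- s) F j x by rewrite big_cons.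
split.
  rewrite (_ : _ \o _ = (fun x => (F i x)%:E + (\sum_(j <- s) F j x)%:E)%E); last first.
    by apply/funext => x /=; rewrite E.
  by apply: integrableD => //; exact: iF.
rewrite (@eq_Rintegral _ _ _ _ _ (fun x => F i x + \sum_(j <- s) F j x)); last first.
  by move=> x _; rewrite E.
by rewrite (RintegralD measurableT (iF i) ih1) ih2 big_cons.
Qed.

Lemma lipschitz_continuous (R : realType) (V W : normedModType R) (F : V -> W) (c : R) :
  (forall x y, `|F y - F x| <= c * `|y - x|) -> continuous F.
Proof.
move=> HF x s /= /(nbhs_ballP (F x)) [e /= e0 es]; apply/nbhs_ballP.
have c1 : 0 < `|c| + 1 by rewrite ltr_wpDl.
exists (e / (`|c| + 1)) => /=; first by rewrite divr_gt0.
move=> y; rewrite -ball_normE/= distrC => xy.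
apply: es; rewrite -ball_normE/= distrC; apply: le_lt_trans (HF x y) _.
apply: (@le_lt_trans _ _ ((`|c| + 1) * `|y - x|)).
  by rewrite ler_wpM2r// (le_trans (ler_norm _))// lerDl.
by rewrite mulrC -ltr_pdivlMr.
Qed.

(** * C^{1,1} kernels and correlations *)

Section kernels.
Context (R : realType) (n : nat).
Implicit Types (q r : R) (h x : 'cV[R]_n) (f : 'cV[R]_n -> R) (K : set 'cV[R]_n)
  (phi : 'cV[R]_n -> R) (g : 'cV[R]_n -> 'cV[R]_n).
Let mu := lebesgue_cV R n.

(** A kernel with its gradient, described by inequalities alone: Taylor's formula with quadratic
    error and a Lipschitz gradient, with one global constant. The class is stable under homotheties
    and translations of the variable, and contains the test functions as well as a piecewise
    polynomial bump. *)
Definition C11_kernel K phi g :=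
  [/\ compact K, forall x, ~ K x -> phi x = 0 /\ g x = 0,
      exists B : R, forall x, `|phi x| <= B /\ `|g x| <= B &
      exists2 C : R, 0 <= C & forall a h,
        `|phi (a + h) - phi a - \sum_j g a j 0 * h j 0| <= C * `|h| ^+ 2 /\
        `|g (a + h) - g a| <= C * `|h|].

(** Cross-correlation. Since [x] enters the kernel with a minus sign, differentiating in [x] gives
    minus the correlation with the gradient of [phi]; hence the plus signs in the expansions
    below. *)
Definition corr f phi x : R := \int[mu]_z (f z * phi (z - x)).

Lemma Rintegral_shift f h : measurable_fun setT f ->
  \int[mu]_x f (x + h) = \int[mu]_x f x.
Proof.
move=> mf; have := Rintegral_affine h ltr01 mf.
rewrite expr1n invr1 mul1r => <-.
by apply: eq_Rintegral => x _; rewrite scale1r.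
Qed.

Lemma corrE f phi x : measurable_fun setT f -> measurable_fun setT phi ->
  corr f phi x = \int[mu]_y (f (x + y) * phi y).
Proof.
move=> mf mphi; rewrite /corr -(@Rintegral_shift _ x).
  by apply: eq_Rintegral => y _; rewrite addrK [x + y]addrC.
apply: measurable_funM => //.
exact: (@measurable_fun_shift _ _ _ _ phi).
Qed.

Lemma lipschitz_at_continuous (f : 'cV[R]_n -> R) :
  (forall x, exists2 C : R, 0 <= C &
    forall y, `|y - x| <= 1 -> `|f y - f x| <= C * `|y - x|) ->
  continuous f.
Proof.
move=> H x s /= /(nbhs_ballP (f x)) [e /= e0 es]; have [C C0 HC] := H x.
apply/nbhs_ballP.
have C1 : 0 < C + 1 by rewrite ltr_wpDl.
exists (Num.min 1 (e / (C + 1))) => /=; first by rewrite lt_min ltr01 divr_gt0.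
move=> y; rewrite -ball_normE/= distrC lt_min => /andP[/ltW yx1 /ltW yx].
apply: es; rewrite -ball_normE/= distrC; apply: le_lt_trans (HC y yx1) _.
apply: le_lt_trans (ler_wpM2l C0 yx) _.
by rewrite mulrCA gtr_pMr// ltr_pdivrMr// mul1r ltrDl.
Qed.

Lemma ler_sum_coord (a h : 'cV[R]_n) : `|\sum_j a j 0 * h j 0| <= n%:R * (`|a| * `|h|).
Proof.
apply: le_trans (ler_norm_sum _ _ _) _.
apply: (@le_trans _ _ (\sum_(j < n) (`|a| * `|h|))).
  by apply: ler_sum => j _; rewrite normrM ler_pM// coord_le_norm.
by rewrite sumr_const card_ord mulr_natl.
Qed.

Section one_kernel.
Variables (K : set 'cV[R]_n) (phi : 'cV[R]_n -> R) (g : 'cV[R]_n -> 'cV[R]_n).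
Hypothesis ker : C11_kernel K phi g.

Lemma kernel_lipschitz : exists2 C : R, 0 <= C &
  forall a h, `|h| <= 1 -> `|phi (a + h) - phi a| <= C * `|h|.
Proof.
have [_ _ [B HB] [C C0 HC]] := ker.
have B0 : 0 <= B by apply: le_trans (proj1 (HB 0)).
exists (C + n%:R * B); first by rewrite addr_ge0// mulr_ge0.
move=> a h h1; have [H _] := HC a h.
rewrite -[X in `|X|](subrK (\sum_j g a j 0 * h j 0)).
apply: le_trans (ler_normD _ _) _; rewrite mulrDl lerD//.
  by apply: le_trans H _; rewrite ler_wpM2l// expr2 ler_piMr.
apply: le_trans (ler_sum_coord _ _) _; rewrite -mulrA ler_wpM2l//.
by rewrite ler_wpM2r// (proj2 (HB a)).
Qed.

Lemma kernel_continuous : continuous phi.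
Proof.
apply: lipschitz_at_continuous => x; have [C C0 HC] := kernel_lipschitz.
by exists C => // y yx; have := HC x (y - x) yx; rewrite subrKC.
Qed.

Lemma kernel_grad_continuous j : continuous (fun x => g x j 0).
Proof.
apply: lipschitz_at_continuous => x; have [_ _ _ [C C0 HC]] := ker.
exists C => // y _; have [_] := HC x (y - x); rewrite subrKC.
by apply: le_trans; have := coord_le_norm (g y - g x) j; rewrite !mxE.
Qed.

Lemma kernel_measurable : measurable_fun setT phi.
Proof. by apply: continuous_cV_measurable; exact: kernel_continuous. Qed.

Lemma kernel_grad_measurable j : measurable_fun setT (fun x => g x j 0).
Proof. by apply: continuous_cV_measurable; exact: kernel_grad_continuous. Qed.

Lemma kernel_affine (e : R) h : 0 < e ->
  C11_kernel [set x | K (e *: x + h)] (fun x => phi (e *: x + h))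
    (fun x => e *: g (e *: x + h)).
Proof.
move=> e0; have [cK K0 [B HB] [C C0 HC]] := ker.
have ek a k : e *: (a + k) + h = (e *: a + h) + e *: k by rewrite scalerDr addrAC.
have nek (k : 'cV[R]_n) : `|e *: k| = e * `|k| by rewrite normrZ gtr0_norm.
split.
- rewrite (_ : mkset _ = (fun x : 'cV[R]_n => e^-1 *: (x - h)) @` K).
    apply: continuous_compact => //; apply: continuous_subspaceT.
    apply: (@lipschitz_continuous _ _ _ _ e^-1) => x y.
    by rewrite -scalerBr opprB addrA subrK normrZ gtr0_norm ?invr_gt0.
  apply/seteqP; split=> [x Kx|_ [y Ky <-]] /=.
    by exists (e *: x + h) => //; rewrite addrK scalerA mulVf ?gt_eqF// scale1r.
  by rewrite scalerA mulfV ?gt_eqF// scale1r subrK.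
- by move=> x /K0[-> ->]; rewrite scaler0.
- exists (B + e * B) => x; have [b1 b2] := HB (e *: x + h).
  have B0 : 0 <= B by exact: le_trans b1.
  rewrite nek; split; first by rewrite (le_trans b1)// lerDl mulr_ge0// ltW.
  by rewrite -[leLHS]add0r lerD// ler_wpM2l// ltW.
- exists (C * e ^+ 2); first by rewrite mulr_ge0// sqr_ge0.
  move=> a k; rewrite ek; have [c1 c2] := HC (e *: a + h) (e *: k); split.
    move: c1; rewrite nek exprMn mulrA.
    rewrite (_ : \sum_j _ = \sum_j (e *: g (e *: a + h)) j 0 * k j 0)//.
    by apply: eq_bigr => j _; rewrite !mxE mulrCA mulrA.
  rewrite -scalerBr nek expr2 !mulrA [C * e]mulrC -!mulrA.
  by rewrite ler_wpM2l ?(ltW e0)// -nek.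
Qed.

Lemma kernel_shift (x0 : 'cV[R]_n) :
  C11_kernel [set x | K (x - x0)] (fun x => phi (x - x0)) (fun x => g (x - x0)).
Proof.
have := kernel_affine (- x0) ltr01.
by congr C11_kernel; apply/funext => x; rewrite /= !scale1r.
Qed.

Lemma kernel_cball : exists2 r : R, 0 < r &
  forall x, ~ cball n r x -> phi x = 0 /\ g x = 0.
Proof.
have [cK K0 _ _] := ker; have [r r0 Kr] := compact_sub_cball cK.
by exists r => // x xr; apply: K0 => /Kr.
Qed.

Lemma kernel_integrable_mul f : Lqloc 1 f ->
  mu.-integrable setT (EFin \o (fun z => f z * phi z)) /\
  forall j, mu.-integrable setT (EFin \o (fun z => f z * g z j 0)).
Proof.
move=> lf; have [_ _ [B HB] _] := ker; have [r r0 Hr] := kernel_cball.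
split=> [|j].
  apply: (proj1 (@integrable_mul_bounded _ _ f phi r B lf kernel_measurable _ _)).
    by move=> x; exact: (proj1 (HB x)).
  by move=> x /Hr[].
apply: (proj1 (@integrable_mul_bounded _ _ f _ r B lf (kernel_grad_measurable j) _ _)).
  move=> x; exact: le_trans (coord_le_norm _ _) (proj2 (HB x)).
by move=> x /Hr[_ ->]; rewrite mxE.
Qed.

End one_kernel.

(** Taylor's formula for [phi] at [z - x'] in the direction [x' - x], integrated against [f]. For
    [x] and [x'] in the cube of radius [rho], the integrands vanish outside the cube of radius
    [r + rho], so the L^1 norm of [f] there enters the constant. *)
Lemma corr_C11 K phi g f (rho : R) : C11_kernel K phi g -> Lqloc 1 f -> 0 <= rho ->
  exists2 C : R, 0 <= C & forall x x', `|x| <= rho -> `|x'| <= rho ->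
   `|corr f phi x - corr f phi x' +
     \sum_j corr f (fun z => g z j 0) x' * (x - x') j 0| <= C * `|x - x'| ^+ 2 /\
   forall j, `|corr f (fun z => g z j 0) x - corr f (fun z => g z j 0) x'| <=
     C * `|x - x'|.
Proof.
move=> ker lf rho0.
have [_ _ _ [C C0 HC]] := ker; have [r r0 Hr] := kernel_cball ker.
have mf : measurable_fun setT f by case: lf.
have kx x := kernel_shift ker x.
have I0 := L1_cball_ge0 f (r + rho).
exists (C * L1_cball f (r + rho)); first by rewrite mulr_ge0.
move=> x x' xr x'r.
have out z y : ~ cball n (r + rho) z -> `|y| <= rho -> ~ cball n r (z - y).
  move=> nz yr zy; apply: nz; rewrite /cball/= -[z](subrK y).
  by rewrite (le_trans (ler_normD _ _))// lerD.
have intphi y := proj1 (kernel_integrable_mul (kx y) lf).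
have intg y := proj2 (kernel_integrable_mul (kx y) lf).
have mphi y := kernel_measurable (kx y).
have mg y := kernel_grad_measurable (kx y).
split=> [|j].
  have intS : forall j, mu.-integrable setT
      (EFin \o (fun z => (f z * g (z - x') j 0) * (x - x') j 0)).
    move=> j; have := integrableZr measurableT ((x - x') j 0) (intg x' j).
    by apply: eq_integrable.
  have [iS ES] := Rintegral_sum (index_enum 'I_n) intS.
  rewrite (_ : _ + _ = \int[mu]_z (f z * (phi (z - x) - phi (z - x') +
      \sum_j g (z - x') j 0 * (x - x') j 0))).
    rewrite mulrAC; apply: (proj2 (@integrable_mul_bounded _ _ f _ (r + rho) _ lf _ _ _)).
    - apply: measurable_funD; first exact: measurable_funB.
      apply: measurable_sum => j; exact: measurable_funM.
    - move=> z; have [+ _] := HC (z - x') (x' - x).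
      rewrite addrA subrK [`|x' - x|]distrC; congr (_ <= _); congr (`|_|).
      rewrite -sumrN; congr (_ + _); apply: eq_bigr => j _.
      by rewrite !mxE -mulrN opprB.
    - move=> z nz; have [-> _] := Hr _ (out _ _ nz xr).
      have [-> ->] := Hr _ (out _ _ nz x'r).
      by rewrite subrr add0r big1// => j _; rewrite mxE mul0r.
  rewrite (@eq_Rintegral _ _ _ _ _ (fun z => f z * phi (z - x) - f z * phi (z - x') +
     \sum_j (f z * g (z - x') j 0) * (x - x') j 0)); last first.
    move=> z _; rewrite mulrDr mulrBr mulr_sumr; congr (_ + _).
    by apply: eq_bigr => j _; rewrite mulrA.
  rewrite RintegralD//; last first.
    have := integrableB measurableT (intphi x) (intphi x').
    by apply: eq_integrable.
  rewrite (RintegralB measurableT (intphi x) (intphi x')).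
  rewrite ES; congr (_ + _); apply: eq_bigr => j _.
  by rewrite (RintegralZr _ measurableT (intg x' j)).
rewrite /corr -(RintegralB measurableT (intg x j) (intg x' j)).
rewrite (@eq_Rintegral _ _ _ _ _ (fun z => f z * (g (z - x) j 0 - g (z - x') j 0))); last first.
  by move=> z _; rewrite mulrBr.
rewrite mulrAC; apply: (proj2 (@integrable_mul_bounded _ _ f _ (r + rho) _ lf _ _ _)).
- by apply: measurable_funB; exact: mg.
- move=> z; have [_ +] := HC (z - x') (x' - x).
  rewrite addrA subrK [`|x' - x|]distrC; apply: le_trans.
  by have := coord_le_norm (g (z - x) - g (z - x')) j; rewrite !mxE.
- move=> z nz; have [_ ->] := Hr _ (out _ _ nz xr).
  have [_ ->] := Hr _ (out _ _ nz x'r).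
  by rewrite mxE subrr.
Qed.

Lemma corr_continuous K phi g f : C11_kernel K phi g -> Lqloc 1 f ->
  continuous (corr f phi).
Proof.
move=> ker lf; apply: lipschitz_at_continuous => x.
have [C C0 HC] := corr_C11 ker lf (addr_ge0 (normr_ge0 x) ler01).
pose D : 'cV[R]_n := \col_j corr f (fun z => g z j 0) x.
exists (C + n%:R * `|D|); first by rewrite addr_ge0// mulr_ge0.
move=> y yx.
have xr : `|x| <= `|x| + 1 by rewrite lerDl.
have yr : `|y| <= `|x| + 1.
  by rewrite -[y](subrK x) (le_trans (ler_normD _ _))// addrC lerD.
have [H _] := HC y x yr xr.
rewrite -[X in `|X|](addrK (\sum_j D j 0 * (y - x) j 0)).
apply: le_trans (ler_normB _ _) _; rewrite mulrDl lerD//.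
  under eq_bigr do rewrite mxE.
  by apply: le_trans H _; rewrite ler_wpM2l// expr2 ler_piMr.
by apply: le_trans (ler_sum_coord _ _) _; rewrite mulrA.
Qed.

Lemma continuous_Lqloc q f : 0 < q -> continuous f -> Lqloc q f.
Proof.
move=> q0 cf; split; first exact: continuous_cV_measurable.
move=> r; have /compact_bounded/ex_strict_bound_gt0[B B0 HB] :
    compact (f @` cball n r).
  apply: continuous_compact; last exact: compact_cball.
  exact: continuous_subspaceT.
apply: (@le_lt_trans _ _ (\int[mu]_(x in cball n r) (cst (B `^ q)%:E x))%E).
  apply: ge0_le_integral.
  - exact: measurable_cball.
  - by move=> x _; rewrite lee_fin powR_ge0.
  - apply: measurable_funTS; apply: measurable_normr_powR.
    exact: continuous_cV_measurable.
  - exact: measurable_cst.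
  - move=> x xr; rewrite lee_fin; apply: ler_powRl => //; first exact: ltW.
    by apply/ltW/HB; exists x.
rewrite integral_cst; last exact: measurable_cball.
by rewrite lte_mul_pinfty ?cball_lty// lee_fin powR_ge0.
Qed.

Lemma Lqloc_cst q (c : R) : 0 < q -> Lqloc q (cst c : 'cV[R]_n -> R).
Proof.
move=> q0; apply: (continuous_Lqloc q0); apply: lipschitz_at_continuous => x.
by exists 0 => // z _; rewrite subrr normr0 mul0r.
Qed.

Lemma kernel_integrable K phi g : C11_kernel K phi g ->
  mu.-integrable setT (EFin \o phi).
Proof.
move=> ker; have [+ _] := kernel_integrable_mul ker (Lqloc_cst 1 ltr01).
by congr (_.-integrable _ _); apply/funext => x /=; rewrite mul1r.
Qed.

End kernels.

(** A finite cover of [K] by balls of radius [d] centred in [K] is made disjoint by removing from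
    each ball the earlier ones [U j]; a point goes to the smallest index whose ball contains it. *)
Lemma compact_small_partition (R : realType) n (K : set 'cV[R]_n) (d : R) :
  0 < d -> compact K ->
  exists N (y : 'I_N -> 'cV[R]_n) (C : 'I_N -> set 'cV[R]_n),
  [/\ forall j, K (y j), forall j, measurable (C j),
      forall j x, C j x -> `|y j - x| <= d,
      forall i j x, C i x -> C j x -> i = j &
      forall x, K x -> exists j, C j x].
Proof.
move=> d0 cK.
have [] := (_ : @cover_compact _ K) 'cV[R]_n K (fun y => ball y d).
- by rewrite -compact_cover.
- by move=> y _; exact: ball_open.
- by move=> x Kx; exists x => //; exact: ballxx.
move=> D' D'K KD'; pose s : seq 'cV[R]_n := finmap.enum_fset D'.
pose y (j : 'I_(size s)) := nth 0 s j.
exists (size s), y.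
pose U (j : 'I_(size s)) := \bigcup_(i in [set i : 'I_(size s) | (i < j)%N]) ball (y i) d.
exists (fun j => ball (y j) d `&` ~` U j); split.
- by move=> j; have /set_mem := D'K _ (mem_nth 0 (ltn_ord j)).
- move=> j; apply: measurableI.
    by apply: open_cV_measurable; exact: ball_open.
  apply: measurableC; apply: open_cV_measurable; apply: bigcup_open => i _.
  exact: ball_open.
- by move=> j x [+ _]; rewrite -ball_normE => /ltW.
- move=> i j x [xi Ui] [xj Uj]; apply/val_inj; case: (ltngtP i j) => // ij.
    by exfalso; apply: Uj; exists i.
  by exfalso; apply: Ui; exists j.
- move=> x /KD'[z /= zD' zx].
  have P : exists k, (k < size s)%N && `[< ball (nth 0 s k) d x >].
    exists (index z s); rewrite index_mem zD'/=; apply/asboolP.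
    by rewrite nth_index.
  case: (ex_minnP P) => k /andP[ks /asboolP kx] kmin.
  exists (Ordinal ks); split => // -[i /= ik ix].
  have := kmin i; rewrite ltn_ord/= => /(_ (introT (asboolP _) ix)).
  by rewrite leqNgt ik.
Qed.

(** * Correlations as limits of finite combinations of translates *)

Section corr_approximation.
Context (R : realType) (n : nat).
Implicit Types (q r : R) (h x : 'cV[R]_n) (f phi : 'cV[R]_n -> R)
  (K : set 'cV[R]_n) (sg : 'cV[R]_n -> 'cV[R]_n).
Let mu := lebesgue_cV R n.

Lemma measurable_cVD d (T : measurableType d) (F G : T -> 'cV[R]_n) :
  measurable_fun setT F -> measurable_fun setT G ->
  measurable_fun setT (fun t => F t + G t).
Proof.
move=> /measurable_fun_cVP mF /measurable_fun_cVP mG.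
apply/measurable_fun_cVP => i.
rewrite (_ : _ \o _ = (fun t => (@cV_coord R n i \o F) t + (@cV_coord R n i \o G) t)).
  by apply: measurable_funD; [exact: mF|exact: mG].
by apply/funext => t; rewrite /cV_coord/= mxE.
Qed.

(** The inequality [powR_Rintegral_le] in [y] and Tonelli reduce the error to L^q distances between
    [f] and its translates by [sg y - y]; a change of variable by [y] enlarges the cube from [r] to
    [r + rho]. The map [sg] is a step function for Riemann sums, and the constant 0 when a
    mollification is compared with [f]. *)
Lemma corr_error_le phi sg f q (M r rho d e : R) : 1 <= q -> 0 <= M -> 0 <= e ->
  measurable_fun setT phi -> (\int[mu]_y (`|phi y|)%:E <= M%:E)%E ->
  (forall y, phi y != 0 -> `|y| <= rho) ->
  measurable_fun setT sg -> (forall y, phi y != 0 -> `|sg y - y| <= d) ->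
  measurable_fun setT f ->
  (forall h, `|h| <= d ->
    (\int[mu]_(x in cball n (r + rho)%R) (`|f (x + h)%R - f x| `^ q)%:E <= e%:E)%E) ->
  (\int[mu]_(x in cball n r)
     (`|\int[mu]_y (phi y * (f (x + sg y)%R - f (x + y)%R))| `^ q)%:E <=
   ((M + 1) `^ q * (M * e))%:E)%E.
Proof.
move=> q1 M0 e0 mphi phiM phirho msg sgd mf fe.
have q0 : 0 < q by exact: lt_le_trans q1.
have mr := @measurable_cball R n r.
pose T := ('cV[R]_n * 'cV[R]_n)%type.
have mfst : measurable_fun setT (fst : T -> 'cV[R]_n) by exact: measurable_fst.
have msnd : measurable_fun setT (snd : T -> 'cV[R]_n) by exact: measurable_snd.
pose F (z : T) := f (z.1 + sg z.2) - f (z.1 + z.2).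
have mF : measurable_fun setT F.
  apply: measurable_funB; apply: (measurableT_comp mf); apply: measurable_cVD => //.
  exact: measurableT_comp.
have mFx x : measurable_fun setT (fun y => F (x, y)).
  exact: (measurableT_comp mF (pair1_measurable x)).
have mphiF : measurable_fun setT (fun z : T => phi z.2 * F z).
  by apply: measurable_funM => //; exact: measurableT_comp.
(* The indicator of the cube is part of [H], so that Tonelli applies on the whole product space. *)
pose H (z : T) := (\1_(cball n r) z.1 * (`|phi z.2| * `|F z| `^ q))%:E.
have mH : measurable_fun setT H.
  apply/measurable_EFinP; apply: measurable_funM.
    by apply: (measurableT_comp _ mfst); exact: measurable_indic.
  apply: measurable_funM.
    by apply: (measurableT_comp _ (measurableT_comp mphi msnd)); exact: normr_measurable.
  by apply/measurable_EFinP; exact: measurable_normr_powR.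
have H0 z : (0 <= H z)%E by rewrite lee_fin !mulr_ge0// powR_ge0.
have H0' x y : (0 <= H (x, y))%E by exact: H0.
have mHx x : measurable_fun setT (fun y => H (x, y)).
  exact: (measurableT_comp mH (pair1_measurable x)).
have mHy y : measurable_fun setT (fun x => H (x, y)).
  exact: (measurableT_comp mH (pair2_measurable y)).
apply: (@le_trans _ _ (((M + 1) `^ q)%:E * \int[mu]_x \int[mu]_y H (x, y))%E).
  rewrite -ge0_integralZl; last 4 first.
  - exact: measurableT.
  - exact: measurable_fun_fubini_tonelli_F.
  - by move=> x _; apply: integral_ge0 => y _; exact: H0.
  - by rewrite lee_fin powR_ge0.
  rewrite [leLHS]integral_mkcond; apply: ge0_le_integral.
  - exact: measurableT.
  - by move=> x _; apply: erestrict_ge0 => y _; rewrite lee_fin powR_ge0.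
  - apply/(measurable_restrictT _ mr)/measurable_funTS.
    apply: measurable_normr_powR.
    exact: (@measurable_Rintegral_param _ _ _ _ R mu (fun z : T => phi z.2 * F z)).
  - apply: emeasurable_funM; first exact: measurable_cst.
    exact: measurable_fun_fubini_tonelli_F.
  - move=> x _; rewrite patchE; case: ifPn => [xr|_]; last first.
      by rewrite mule_ge0 ?lee_fin ?powR_ge0// integral_ge0.
    apply: le_trans (@powR_Rintegral_le _ _ phi (fun y => F (x, y)) q M q1 M0 mphi (mFx x) phiM) _.
    rewrite le_eqVlt; apply/orP; left; apply/eqP; congr (_ * _)%E.
    by apply: eq_integral => y _; rewrite /H/= indicE xr mul1r.
rewrite (fubini_tonelli H mH H0) EFinM; apply: lee_wpmul2l; first by rewrite lee_fin powR_ge0.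
apply: (@le_trans _ _ (\int[mu]_y ((`|phi y|)%:E * e%:E))%E); last first.
  rewrite ge0_integralZr//; last first.
    by apply/measurable_EFinP; exact: measurableT_comp.
  by rewrite EFinM; apply: lee_wpmul2r.
apply: ge0_le_integral.
- exact: measurableT.
- by move=> y _; apply: integral_ge0.
- exact: measurable_fun_fubini_tonelli_G.
- apply: emeasurable_funM; last exact: measurable_cst.
  by apply/measurable_EFinP; exact: measurableT_comp.
move=> y _; have [p0|pn0] := eqVneq (phi y) 0.
  rewrite p0 normr0 mul0e le_eqVlt; apply/orP; left; apply/eqP.
  by apply: integral0_eq => x _; rewrite /H/= p0 normr0 mul0r mulr0.
have mFy : measurable_fun setT (fun x => F (x, y)).
  exact: (measurableT_comp mF (pair2_measurable y)).
have mFq : measurable_fun setT (fun x => (`|F (x, y)| `^ q)%:E).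
  exact: measurable_normr_powR.
have -> : (\int[mu]_x H (x, y) =
    \int[mu]_(x in cball n r) ((`|phi y|)%:E * (`|F (x, y)| `^ q)%:E))%E.
  rewrite [RHS]integral_mkcond; apply: eq_integral => x _.
  rewrite patchE /H/= indicE; have [xr|xr] := boolP (x \in cball n r).
    by rewrite mul1r EFinM.
  by rewrite mul0r.
rewrite ge0_integralZl; last 4 first.
- exact: mr.
- exact: measurable_funTS.
- by move=> x _; rewrite lee_fin powR_ge0.
- by rewrite lee_fin.
apply: lee_wpmul2l; first by rewrite lee_fin.
apply: le_trans (fe (sg y - y) (sgd y pn0)).
pose Gy (x : 'cV[R]_n) := (`|f (x + (sg y - y)) - f x| `^ q)%:E.
have mGy : measurable_fun setT Gy.
  by apply: measurable_normr_powR; exact: measurable_shift_diff.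
have mrr := @measurable_cball R n (r + rho).
have Gy0 x : (0 <= Gy x)%E by rewrite lee_fin powR_ge0.
rewrite -(@ge0_integral_shift _ _ (cball n (r + rho)) Gy y mrr); last 2 first.
- exact: measurable_funTS.
- by move=> x _.
rewrite (@eq_integral _ _ _ mu _ (fun x => Gy (x + y))); last first.
  by move=> x _; rewrite /Gy /F/= -addrA subrKC.
apply: ge0_subset_integral.
- exact: mr.
- exact: measurable_shift.
- by apply: measurable_funTS; exact: measurable_fun_shift.
- by move=> x _.
- move=> x xr; rewrite /cball/= (le_trans (ler_normD _ _))// lerD//.
  exact: phirho.
Qed.

End corr_approximation.

Section corr_finite_approximation.
Context (R : realType) (n : nat).
Implicit Types (q r : R) (h x : 'cV[R]_n) (f phi : 'cV[R]_n -> R)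
  (K : set 'cV[R]_n).
Let mu := lebesgue_cV R n.

Lemma Lqloc_affine q f (e : R) h : 0 < e -> Lqloc q f ->
  Lqloc q (fun x => f (e *: x + h)).
Proof.
move=> e0 [mf If]; have maff := measurable_affine e h.
split; first exact: (measurableT_comp mf maff).
move=> r; pose rho : R := e * r + `|h|.
have mq : measurable_fun setT (fun x => (`|f x| `^ q)%:E) by exact: measurable_normr_powR.
have mrho := @measurable_cball R n rho.
have := ge0_integral_affine h e0 mrho (measurable_funTS mq)
  (fun x _ => powR_ge0 _ _ : (0 <= (`|f x| `^ q)%:E)%E).
move=> E; apply: (@le_lt_trans _ _ ((e ^- n)%:E *
    \int[mu]_(x in cball n rho) (`|f x| `^ q)%:E)%E).
  rewrite -E; apply: ge0_subset_integral.
  - exact: measurable_cball.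
  - by rewrite -[X in measurable X]setTI; exact: maff.
  - by apply: measurable_funTS; exact: (measurableT_comp mq maff).
  - by move=> x _; rewrite lee_fin powR_ge0.
  - move=> x xr; rewrite /cball/= (le_trans (ler_normD _ _))// lerD2r normrZ.
    by rewrite gtr0_norm// ler_wpM2l// ltW.
by rewrite lte_mul_pinfty// lee_fin invr_ge0 exprn_ge0// ltW.
Qed.

Lemma Lqloc_shift q f h : Lqloc q f -> Lqloc q (fun x => f (x + h)).
Proof.
move=> /(Lqloc_affine h ltr01); congr Lqloc.
by apply/funext => x; rewrite scale1r.
Qed.

Lemma shift_cvg_fin (I : finType) (f : I -> 'cV[R]_n -> R) q r (e : R) :
  0 < q -> (forall i, Lqloc q (f i)) -> 0 < e ->
  exists2 d : R, 0 < d & forall i h, `|h| <= d ->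
  (\int[mu]_(x in cball n r) (`|f i (x + h)%R - f i x| `^ q)%:E <= e%:E)%E.
Proof.
move=> q0 lf e0.
have /choice[d dP] : forall i, exists d : R, 0 < d /\ forall h, `|h| <= d ->
    (\int[mu]_(x in cball n r) (`|f i (x + h)%R - f i x| `^ q)%:E <= e%:E)%E.
  by move=> i; have [d d0 dh] := Lqloc_shift_cvg q0 (lf i) r e0; exists d.
exists (\big[Num.min/1]_i d i).
  by apply: lt_bigmin => // i _; case: (dP i).
move=> i h hd; apply: (proj2 (dP i)).
by apply: le_trans hd _; exact: bigmin_le_cond.
Qed.

(** The weights are the integrals of [phi] over the cells of a fine partition of [K], the nodes are
    the cell centres. One choice of weights and nodes serves all the [f i], which will be the
    components of a vector field. *)
Lemma corr_approx (I : finType) (f : I -> 'cV[R]_n -> R) phi K q (M B r e : R) :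
  1 <= q -> 0 <= M -> 0 < e -> compact K -> measurable_fun setT phi ->
  (forall y, ~ K y -> phi y = 0) -> (forall y, `|phi y| <= B) ->
  (\int[mu]_y (`|phi y|)%:E <= M%:E)%E -> (forall i, Lqloc q (f i)) ->
  exists N (c : 'I_N -> R) (y : 'I_N -> 'cV[R]_n),
  [/\ forall j, K (y j), \sum_j `|c j| <= M &
    forall i, (\int[mu]_(x in cball n r)
      (`|corr (f i) phi x - \sum_j c j * f i (x + y j)%R| `^ q)%:E <= e%:E)%E].
Proof.
move=> q1 M0 e0 cK mphi phi0 phiB phiM lf.
have q0 : 0 < q by exact: lt_le_trans q1.
have M1 : 0 < M + 1 by rewrite ltr_wpDl.
have [rho rho0 Krho] := compact_sub_cball cK.
have phirho y : phi y != 0 -> K y.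
  by move=> /eqP py; apply: contrapT => /phi0.
(* The last factor is [M + 1] in place of [M], which keeps the divisor positive when [M = 0]. *)
pose e' := e / ((M + 1) `^ q * (M + 1)).
have e'0 : 0 < e' by rewrite divr_gt0// mulr_gt0// powR_gt0.
have [d d0 dP] := shift_cvg_fin (r + rho) q0 lf e'0.
have [N [y [C [Ky mC Cd CI KC]]]] := compact_small_partition d0 cK.
(* On the cell [C j] this is the constant [y j]; outside the cells it is 0, and [phi] vanishes
   there. *)
pose sg (z : 'cV[R]_n) : 'cV[R]_n := \col_k \sum_j \1_(C j) z * y j k 0.
have msg : measurable_fun setT sg.
  apply/measurable_fun_cVP => k.
  rewrite (_ : _ \o _ = (fun z => \sum_j \1_(C j) z * y j k 0)); last first.
    by apply/funext => z; rewrite /= /cV_coord mxE.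
  apply: measurable_sum => j.
  apply: measurable_funM; [exact: measurable_indic|exact: measurable_cst].
have sgE j z : C j z -> sg z = y j.
  move=> Cz; apply/matrixP => k l; rewrite (ord1 l) mxE (bigD1 j)//=.
  rewrite indicE mem_set// mul1r big1 ?addr0// => i ij.
  rewrite indicE memNset ?mul0r// => Ciz; move: ij; rewrite (CI _ _ _ Ciz Cz).
  by rewrite eqxx.
pose phij j z := phi z * \1_(C j) z.
have mphij j : measurable_fun setT (phij j).
  by apply: measurable_funM => //; exact: measurable_indic.
have one1 : Lqloc 1 (cst 1 : 'cV[R]_n -> R) by exact: Lqloc_cst.
have B0 : 0 <= B by apply: le_trans (phiB 0).
have phijB j z : `|phij j z| <= B.
  rewrite normrM (le_trans _ (phiB z))// ler_piMr// indicE.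
  by case: (_ \in _); rewrite ?normr1 ?normr0.
have phij0 j z : ~ cball n rho z -> phij j z = 0.
  by move=> zr; rewrite /phij phi0 ?mul0r// => /Krho.
have iphij j : mu.-integrable setT (EFin \o phij j).
  have [] := @integrable_mul_bounded _ _ (cst 1) (phij j) rho B one1 (mphij j)
    (phijB j) (phij0 j).
  by move=> + _; apply: eq_integrable => // z _ /=; rewrite mul1r.
have phi_rho z : ~ cball n rho z -> phi z = 0.
  by move=> zr; rewrite phi0// => /Krho.
have phiE z : phi z = \sum_j phij j z.
  have [Kz|Kz] := pselect (K z); last first.
    by rewrite phi0// big1// => j _; rewrite /phij phi0// mul0r.
  have [j Cz] := KC z Kz; rewrite (bigD1 j)//= big1 ?addr0.
    by rewrite /phij indicE mem_set// mulr1.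
  move=> i ij; rewrite /phij indicE memNset ?mulr0// => Ciz.
  by move: ij; rewrite (CI _ _ _ Ciz Cz) eqxx.
pose c j := \int[mu]_z phij j z.
exists N, c, y; split => //.
  have iphijn j : mu.-integrable setT (EFin \o (fun z => `|phij j z|)).
    by have := integrable_norm (iphij j).
  have [iS ES] := Rintegral_sum (index_enum 'I_N) iphijn.
  apply: (@le_trans _ _ (\sum_j \int[mu]_z `|phij j z|)).
    by apply: ler_sum => j _; exact: le_normr_Rintegral.
  rewrite -ES (@eq_Rintegral _ _ _ _ _ (fun z => `|phi z|)).
    rewrite -lee_fin /Rintegral fineK; first exact: phiM.
    rewrite ge0_fin_numE; first by apply: le_lt_trans phiM _; rewrite ltry.
    by apply: integral_ge0 => z _; rewrite lee_fin.
  move=> z _; have [Kz|Kz] := pselect (K z); last first.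
    by rewrite phi0// normr0 big1// => j _; rewrite /phij phi0// mul0r normr0.
  have [j Cz] := KC z Kz; rewrite (bigD1 j)//= big1 ?addr0.
    by rewrite /phij indicE mem_set// mulr1.
  move=> i ij; rewrite /phij indicE memNset ?mulr0 ?normr0// => Ciz.
  by move: ij; rewrite (CI _ _ _ Ciz Cz) eqxx.
move=> i; have mfi : measurable_fun setT (f i) by case: (lf i).
have lfi : Lqloc 1 (f i) by exact: Lqloc1 (lf i).
have corrsg x : corr (f i) phi x - \sum_j c j * f i (x + y j) =
    - \int[mu]_z (phi z * (f i (x + sg z) - f i (x + z))).
  have intj j : mu.-integrable setT (EFin \o (fun z => phij j z * f i (x + y j))).
    have := integrableZr measurableT (f i (x + y j)) (iphij j).
    by apply: eq_integrable.
  have [iS ES] := Rintegral_sum (index_enum 'I_N) intj.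
  have sgS z : phi z * f i (x + sg z) = \sum_j phij j z * f i (x + y j).
    rewrite phiE mulr_suml; apply: eq_bigr => j _.
    have [Cz|Cz] := pselect (C j z); first by rewrite (sgE _ _ Cz).
    by rewrite /phij indicE memNset// mulr0 !mul0r.
  have i1 : mu.-integrable setT (EFin \o (fun z => phi z * f i (x + z))).
    have lx : Lqloc 1 (fun z => f i (z + x)) by exact: Lqloc_shift.
    have [+ _] := @integrable_mul_bounded _ _ _ phi rho B lx mphi phiB phi_rho.
    by apply: eq_integrable => // z _ /=; rewrite mulrC [x + z]addrC.
  rewrite corrE// (@eq_Rintegral _ _ _ _ _ (fun z =>
     (\sum_j phij j z * f i (x + y j)) - phi z * f i (x + z))
     (fun z => phi z * (f i (x + sg z) - f i (x + z)))); last first.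
    by move=> z _; rewrite mulrBr sgS.
  rewrite (RintegralB measurableT iS i1) ES opprB; congr (_ - _).
    by apply: eq_Rintegral => z _; rewrite mulrC.
  by apply: eq_bigr => j _; rewrite (RintegralZr _ measurableT (iphij j)).
under eq_integral => x _ do rewrite corrsg normrN.
have E1 : (M + 1) `^ q * (M * e') <= e.
  have P0 : 0 < (M + 1) `^ q by exact: powR_gt0.
  rewrite (_ : _ * _ = e * (M / (M + 1))); last by rewrite /e'; field; rewrite !gt_eqF.
  by rewrite ger_pMr// ler_pdivrMr// mul1r lerDl.
apply: (@le_trans _ _ (((M + 1) `^ q * (M * e'))%:E)); last by rewrite lee_fin.
apply: (@corr_error_le _ _ phi sg (f i) q M r rho d e' q1 M0 (ltW e'0) mphi phiM).
- by move=> z /phirho/Krho.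
- exact: msg.
- move=> z /phirho/KC[j Cz]; rewrite (sgE _ _ Cz); exact: Cd.
- exact: mfi.
- by move=> h hd; exact: dP.
Qed.

End corr_finite_approximation.

(** * Vector fields in L^p_loc, component by component *)

Section enorm_facts.
Context (R : realType).

Lemma coord_le_enorm m (x : 'cV[R]_m) i : `|x i 0| <= enorm x.
Proof.
rewrite -sqrtr_sqr; apply: ler_wsqrtr; rewrite (bigD1 i)//= lerDl.
by apply: sumr_ge0 => j _; exact: sqr_ge0.
Qed.

Lemma enorm_ge0 m (x : 'cV[R]_m) : 0 <= enorm x.
Proof. exact: sqrtr_ge0. Qed.

Lemma enorm0 m : enorm (0 : 'cV[R]_m) = 0.
Proof. by rewrite /enorm big1 ?sqrtr0// => i _; rewrite mxE expr0n. Qed.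

Lemma enorm_le_sum m (x : 'cV[R]_m) : enorm x <= \sum_i `|x i 0|.
Proof.
have S0 : 0 <= \sum_i `|x i 0| by exact: sumr_ge0.
rewrite -[leRHS]ger0_norm// -sqrtr_sqr; apply: ler_wsqrtr.
rewrite expr2 mulr_suml; apply: ler_sum => i _.
rewrite -(@real_normK _ (x i 0)) ?num_real// expr2 ler_wpM2l//.
by rewrite (bigD1 i)//= lerDl sumr_ge0.
Qed.

Lemma enorm_powR_le m (x : 'cV[R]_m) (p : R) : 0 < p ->
  enorm x `^ p <= m%:R `^ p * \sum_i `|x i 0| `^ p.
Proof.
move=> p0; apply: le_trans (ler_powRl (ltW p0) (enorm_ge0 x) (enorm_le_sum x)) _.
by have := @powR_sum_le R 'I_m (fun i => `|x i 0|) p p0; rewrite card_ord; apply.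
Qed.

Lemma measurable_enorm_powR d (T : measurableType d) m (u : T -> 'cV[R]_m)
    (A : set T) (p : R) : (forall i, measurable_fun A (fun x => u x i 0)) ->
  measurable_fun A (fun x => (enorm (u x) `^ p)%:E).
Proof.
move=> mu; apply/measurable_EFinP.
rewrite (_ : (fun x => _) = (fun x => ((\sum_i u x i 0 ^+ 2) `^ 2^-1) `^ p)).
  apply: (measurableT_comp (measurable_powR p)).
  apply: (measurableT_comp (measurable_powR 2^-1)).
  by apply: measurable_sum => i; exact: measurable_funX.
apply/funext => x; rewrite powR12_sqrt//.
by apply: sumr_ge0 => j _; exact: sqr_ge0.
Qed.

End enorm_facts.

Section Lploc_facts.
Context (R : realType) (m n : nat) (p : R) (p0 : 0 < p).
Implicit Types u v : 'cV[R]_n -> 'cV[R]_m.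
Let mu := lebesgue_cV R n.

(** The Euclidean norm lies between the modulus of each coordinate and the sum of these moduli, so
    scalar results on cubes transfer to vector fields on compact sets. *)
Lemma in_LplocP u : in_Lploc p u <-> forall i, Lqloc p (fun x => u x i 0).
Proof.
split=> [[mfu iu] i|lu].
  split=> [|r]; first exact: mfu.
  apply: le_lt_trans (iu _ (@compact_cball R n r)).
  apply: ge0_le_integral.
  - exact: measurable_cball.
  - by move=> x _; rewrite lee_fin powR_ge0.
  - by apply: measurable_funTS; apply: measurable_normr_powR; exact: mfu.
  - apply: measurable_funTS; apply: measurable_enorm_powR => j; exact: mfu.
  - move=> x _; rewrite lee_fin; apply: ler_powRl => //; first exact: ltW.
    exact: coord_le_enorm.
have mfu i : measurable_fun setT (fun x => u x i 0) by case: (lu i).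
split=> [i j|K cK]; first by rewrite (ord1 j).
have [r r0 Kr] := compact_sub_cball cK.
have mr := @measurable_cball R n r.
apply: (@le_lt_trans _ _ (\int[mu]_(x in cball n r)
    ((m%:R `^ p)%:E * \sum_i (`|u x i 0| `^ p)%:E))%E).
  apply: (@le_trans _ _ (\int[mu]_(x in cball n r) (enorm (u x) `^ p)%:E)%E).
    apply: ge0_subset_integral.
    - exact: compact_cV_measurable.
    - exact: mr.
    - by apply: measurable_funTS; exact: measurable_enorm_powR.
    - by move=> x _; rewrite lee_fin powR_ge0.
    - exact: Kr.
  apply: ge0_le_integral.
  - exact: mr.
  - by move=> x _; rewrite lee_fin powR_ge0.
  - by apply: measurable_funTS; exact: measurable_enorm_powR.
  - apply: emeasurable_funM; first exact: measurable_cst.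
    apply: emeasurable_sum => i; apply: measurable_funTS.
    exact: measurable_normr_powR.
  - by move=> x _; rewrite sumEFin -EFinM lee_fin enorm_powR_le.
rewrite ge0_integralZl; last 4 first.
- exact: mr.
- apply: emeasurable_sum => i; apply: measurable_funTS.
  exact: measurable_normr_powR.
- by move=> x _; apply: sume_ge0 => i _; rewrite lee_fin powR_ge0.
- by rewrite lee_fin powR_ge0.
rewrite lte_mul_pinfty ?lee_fin ?powR_ge0//.
rewrite ge0_integral_sum; last 3 first.
- exact: mr.
- by move=> i; apply: measurable_funTS; exact: measurable_normr_powR.
- by move=> i x _; rewrite lee_fin powR_ge0.
apply: lte_sum_pinfty => i _; exact: (proj2 (lu i)).
Qed.

Lemma in_Lploc_continuous u : (forall i, continuous (fun x => u x i 0)) ->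
  in_Lploc p u.
Proof. by move=> cu; apply/in_LplocP => i; exact: continuous_Lqloc. Qed.

Lemma in_Lploc_affine u (e : R) (h : 'cV[R]_n) : 0 < e -> in_Lploc p u ->
  in_Lploc p (fun x => u (e *: x + h)).
Proof.
move=> e0 /in_LplocP lu; apply/in_LplocP => i.
exact: (Lqloc_affine h e0 (lu i)).
Qed.

Lemma in_Lploc_shift u (h : 'cV[R]_n) : in_Lploc p u ->
  in_Lploc p (fun x => u (x + h)).
Proof.
move=> /(in_Lploc_affine h ltr01); congr in_Lploc.
by apply/funext => x; rewrite scale1r.
Qed.

Lemma LqlocD (f g : 'cV[R]_n -> R) : Lqloc p f -> Lqloc p g ->
  Lqloc p (fun x => f x + g x).
Proof.
move=> [mf If] [mg Ig]; split; first exact: measurable_funD.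
move=> r; have mr := @measurable_cball R n r.
have fin (k : 'cV[R]_n -> R) : (\int[mu]_(x in cball n r) (`|k x| `^ p)%:E < +oo)%E ->
    (\int[mu]_(x in cball n r) (`|k x| `^ p)%:E <=
      (fine (\int[mu]_(x in cball n r) (`|k x| `^ p)%:E))%:E)%E.
  move=> kr; rewrite fineK// ge0_fin_numE//.
  by apply: integral_ge0 => x _; rewrite lee_fin powR_ge0.
apply: le_lt_trans (ge0_integral_powRD p0 mr mf mg (fin _ (If r)) (fin _ (Ig r))) _.
exact: ltry.
Qed.

Lemma LqlocZ (f : 'cV[R]_n -> R) (c : R) : Lqloc p f -> Lqloc p (fun x => c * f x).
Proof.
move=> [mf If]; split; first exact: measurable_funM.
move=> r; under eq_integral => x _ do rewrite normrM powRM// EFinM.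
rewrite ge0_integralZl; last 4 first.
- exact: measurable_cball.
- by apply: measurable_funTS; exact: measurable_normr_powR.
- by move=> x _; rewrite lee_fin powR_ge0.
- by rewrite lee_fin powR_ge0.
by rewrite lte_mul_pinfty ?lee_fin ?powR_ge0.
Qed.

Lemma in_LplocD u v : in_Lploc p u -> in_Lploc p v ->
  in_Lploc p (fun x => u x + v x).
Proof.
move=> /in_LplocP lu /in_LplocP lv; apply/in_LplocP => i.
rewrite (_ : (fun x => _) = fun x => u x i 0 + v x i 0); first exact: LqlocD.
by apply/funext => x; rewrite mxE.
Qed.

Lemma in_LplocZ u (c : R) : in_Lploc p u -> in_Lploc p (fun x => c *: u x).
Proof.
move=> /in_LplocP lu; apply/in_LplocP => i.
rewrite (_ : (fun x => _) = fun x => c * u x i 0); first exact: LqlocZ.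
by apply/funext => x; rewrite mxE.
Qed.

Lemma in_Lploc_cst (c : 'cV[R]_m) : in_Lploc p (fun _ : 'cV[R]_n => c).
Proof.
apply/in_LplocP => i.
exact: (Lqloc_cst n (c i 0)) p0.
Qed.

Lemma in_Lploc_sum N (c : 'I_N -> R) (w : 'I_N -> 'cV[R]_n -> 'cV[R]_m) :
  (forall j, in_Lploc p (w j)) -> in_Lploc p (fun x => \sum_j c j *: w j x).
Proof.
elim: N c w => [|N IH] c w lw.
  rewrite (_ : (fun x => _) = fun _ : 'cV[R]_n => 0); first exact: in_Lploc_cst.
  by apply/funext => x; rewrite big_ord0.
rewrite (_ : (fun x => _) = fun x =>
   \sum_(j < N) c (widen_ord (leqnSn N) j) *: w (widen_ord (leqnSn N) j) x
    + c ord_max *: w ord_max x); last first.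
  by apply/funext => x; rewrite big_ord_recr.
apply: in_LplocD; last exact: in_LplocZ.
exact: (IH (fun j => c (widen_ord (leqnSn N) j)) (fun j => w (widen_ord (leqnSn N) j))).
Qed.

Lemma norm_mulmx_le k l (A : 'M[R]_(k, l)) (x : 'cV[R]_l) :
  `|A *m x| <= l%:R * `|A| * `|x|.
Proof.
have r0 : 0 <= l%:R * `|A| * `|x| by rewrite !mulr_ge0.
apply/(cV_norm_leP _ r0) => i; rewrite mxE.
apply: le_trans (ler_norm_sum _ _ _) _.
apply: (@le_trans _ _ (\sum_(j < l) (`|A| * `|x|))).
  apply: ler_sum => j _; rewrite normrM ler_pM// ?coord_le_norm//.
  rewrite [leRHS]/Num.norm/= mx_normrE; apply/bigmax_geP; right => /=.
  by exists (i, j).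
by rewrite sumr_const card_ord -mulrA mulr_natl.
Qed.

Lemma in_Lploc_linear (A : 'M[R]_(m, n)) : in_Lploc p (fun x : 'cV[R]_n => A *m x).
Proof.
apply: in_Lploc_continuous => i; apply: lipschitz_at_continuous => x.
exists (n%:R * `|A|); first by rewrite mulr_ge0.
move=> y _; rewrite (le_trans _ (norm_mulmx_le A (y - x)))// mulmxBr.
by have := coord_le_norm (A *m y - A *m x) i; rewrite !mxE.
Qed.

End Lploc_facts.

(** * Convexity, homogeneity and locality of core functionals *)

Section core_functional_theory.
Context (R : realType) (m n : nat) (p : R) (G : set 'M[R]_n) (D : set 'cV[R]_n).
Variable alpha : ('cV[R]_n -> 'cV[R]_m) -> set 'cV[R]_n -> R.
Hypotheses (p1 : 1 < p) (GSO : subgroup_of_SO G) (core : core_functional p G D alpha).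
Implicit Types (u v : 'cV[R]_n -> 'cV[R]_m).
Let mu := lebesgue_cV R n.

Let p0 : 0 < p. Proof. exact: lt_trans p1. Qed.

Lemma subgroup1 : G 1%:M. Proof. by case: GSO. Qed.

Lemma copies_similarity (e : R) A h : 0 < e -> G A ->
  copies G D setT (similarity e A h @` D).
Proof. by move=> e0 GA; exists e => //; split => //; exists A, h. Qed.

Lemma similarityE (e : R) h x : similarity e (1%:M : 'M[R]_n) h x = e *: x + h.
Proof. by rewrite /similarity mul1mx. Qed.

Lemma similarity_comp (t e : R) k A h (x : 'cV[R]_n) :
  similarity t 1%:M k (similarity e A h x) = similarity (t * e) A (t *: h + k) x.
Proof. by rewrite similarityE /similarity scalerDr scalerA addrA. Qed.

Lemma copies_ref : copies G D setT D.
Proof.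
have E : D = similarity 1 (1%:M : 'M[R]_n) 0 @` D.
  apply/seteqP; split=> [x Dx|_ [x Dx <-]].
    by exists x => //; rewrite similarityE scale1r addr0.
  by rewrite similarityE scale1r addr0.
rewrite [X in copies _ _ _ X]E; apply: copies_similarity => //; exact: subgroup1.
Qed.

Lemma alpha_ge0 u (D' : set 'cV[R]_n) : in_Lploc p u -> copies G D setT D' -> 0 <= alpha u D'.
Proof. by case: core => + _ _ _; exact. Qed.

Lemma alpha_local u v (D' : set 'cV[R]_n) : in_Lploc p u -> in_Lploc p v -> copies G D setT D' ->
  (forall x, D' x -> u x = v x) -> alpha u D' = alpha v D'.
Proof. by case: core => _ H _ _ lu lv cD uv; apply: H => //; apply/aeW. Qed.

Lemma alphaZ u (D' : set 'cV[R]_n) (t : R) : in_Lploc p u -> copies G D setT D' ->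
  alpha (fun x => t *: u x) D' = `|t| `^ p * alpha u D'.
Proof. by case: core => _ _ _ [+ _ _ _]; exact. Qed.

Lemma alphaD_cst u (D' : set 'cV[R]_n) h : in_Lploc p u -> copies G D setT D' ->
  alpha (fun x => u x + h) D' = alpha u D'.
Proof. by case: core => _ _ _ [_ + _ _]; exact. Qed.

Lemma alpha_comp u (D' : set 'cV[R]_n) (e : R) A h : in_Lploc p u -> copies G D setT D' -> 0 < e -> G A ->
  alpha (u \o similarity e A h) D' = alpha u (similarity e A h @` D').
Proof. by case: core => _ _ _ [_ _ + _]; exact. Qed.

(** Homogeneity with [t = 0] gives the value 0 at the zero function, and adding a constant does not
    change it. *)
Lemma alpha_cst (D' : set 'cV[R]_n) (c : 'cV[R]_m) : copies G D setT D' ->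
  alpha (fun _ => c) D' = 0.
Proof.
move=> cD; have l0 := @in_Lploc_cst R m n p p0 0.
transitivity (alpha (fun _ => 0 + c) D').
  by congr alpha; apply/funext => x; rewrite add0r.
rewrite (@alphaD_cst (fun _ => 0) D' c)//.
transitivity (alpha (fun x => 0 *: (fun _ : 'cV[R]_n => 0 : 'cV[R]_m) x) D').
  by congr alpha; apply/funext => x; rewrite scaler0.
by rewrite alphaZ// normr0 powR0 ?mul0r// gt_eqF.
Qed.

Lemma alpha_set0 u (D' : set 'cV[R]_n) : in_Lploc p u -> copies G D setT D' -> D' = set0 ->
  alpha u D' = 0.
Proof.
move=> lu cD D0; rewrite (@alpha_local u (fun _ => 0) D' lu _ cD).
- exact: alpha_cst.
- exact: in_Lploc_cst.
- by rewrite D0.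
Qed.

Lemma alphaZ_le u (D' : set 'cV[R]_n) (c : R) : in_Lploc p u -> copies G D setT D' ->
  0 <= c <= 1 -> alpha (fun x => c *: u x) D' <= c * alpha u D'.
Proof.
move=> lu cD /andP[c0 c1]; rewrite alphaZ// ger0_norm//.
have [->|cn0] := eqVneq c 0; first by rewrite powR0 ?mul0r// gt_eqF.
apply: ler_wpM2r; first exact: alpha_ge0.
apply: ge1r_powR; last exact: ltW.
by rewrite lt_neqAle eq_sym cn0 c0.
Qed.

(** The missing weight [1 - a - b] falls on the zero function, which has no energy: [b v] is [1 - a]
    times a multiple of [v] with factor in [0, 1], to which [alphaZ_le] applies. *)
Lemma alpha_subconvex u v (D' : set 'cV[R]_n) (a b : R) : in_Lploc p u -> in_Lploc p v ->
  copies G D setT D' -> 0 <= a -> 0 <= b -> a + b <= 1 ->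
  alpha (fun x => a *: u x + b *: v x) D' <= a * alpha u D' + b * alpha v D'.
Proof.
move=> lu lv cD a0 b0 ab.
have [a1|an1] := eqVneq a 1.
  have -> : b = 0 by apply/eqP; rewrite eq_le b0 andbT; move: ab; rewrite a1 gerDl.
  rewrite a1 mul1r mul0r addr0 le_eqVlt; apply/orP; left; apply/eqP.
  by congr alpha; apply/funext => x; rewrite scale1r scale0r addr0.
have a1 : 0 < 1 - a.
  by rewrite subr_gt0 lt_neqAle an1/= (le_trans _ ab)// lerDl.
have lbv : in_Lploc p (fun x => (b / (1 - a)) *: v x) by exact: in_LplocZ.
case: core => _ _ cvx _; have := cvx u _ D' a lu lbv cD.
rewrite a0/= (le_trans _ ab) ?lerDl// => /(_ isT) H.
rewrite (_ : (fun x => _) =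
    fun x => a *: u x + (1 - a) *: ((b / (1 - a)) *: v x)); last first.
  by apply/funext => x; rewrite scalerA mulrC divfK// gt_eqF.
apply: le_trans H _; rewrite lerD2l.
apply: le_trans (ler_wpM2l (ltW a1) (alphaZ_le lv cD _)) _.
  by rewrite divr_ge0 ?(ltW a1)//= ler_pdivrMr// mul1r lerBrDr addrC.
by rewrite mulrA [_ * (b / _)]mulrC divfK// gt_eqF.
Qed.

Lemma alpha_subconvex_sum N (l : 'I_N -> R) (w : 'I_N -> 'cV[R]_n -> 'cV[R]_m) (D' : set 'cV[R]_n) :
  copies G D setT D' -> (forall j, in_Lploc p (w j)) -> (forall j, 0 <= l j) ->
  \sum_j l j <= 1 ->
  alpha (fun x => \sum_j l j *: w j x) D' <= \sum_j l j * alpha (w j) D'.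
Proof.
move=> cD; elim: N l w => [|N IH] l w lw l0 l1.
  rewrite big_ord0 (_ : (fun x => _) = fun _ => 0) ?alpha_cst//.
  by apply/funext => x; rewrite big_ord0.
pose i (j : 'I_N) : 'I_N.+1 := widen_ord (leqnSn N) j.
have l1' : \sum_(j < N) l (i j) + l ord_max <= 1.
  by move: l1; rewrite big_ord_recr.
rewrite [leRHS]big_ord_recr/=.
rewrite (_ : (fun x => _) = fun x =>
    \sum_(j < N) l (i j) *: w (i j) x + l ord_max *: w ord_max x); last first.
  by apply/funext => x; rewrite big_ord_recr.
have [s0|sn0] := eqVneq (\sum_(j < N) l (i j)) 0.
  have li j : l (i j) = 0.
    by have /psumr_eq0P := s0; apply => // k _; exact: l0.
  rewrite (_ : (fun x => _) = fun x => l ord_max *: w ord_max x); last first.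
    apply/funext => x; rewrite big1 ?add0r// => j _.
    by rewrite li scale0r.
  rewrite big1 ?add0r => [|j _]; last by rewrite -/(i j) li mul0r.
  by apply: alphaZ_le => //; rewrite l0/=; move: l1'; rewrite s0 add0r.
set s := \sum_(j < N) l (i j) in l1' sn0.
have s_ge0 : 0 <= s by apply: sumr_ge0 => j _; exact: l0.
have sp : 0 < s by rewrite lt_neqAle eq_sym sn0.
have lwi : in_Lploc p (fun x => \sum_(j < N) (l (i j) / s) *: w (i j) x).
  by apply: in_Lploc_sum => // j; exact: lw.
rewrite (_ : (fun x => _) = fun x =>
   s *: (\sum_(j < N) (l (i j) / s) *: w (i j) x) + l ord_max *: w ord_max x); last first.
  apply/funext => x; rewrite scaler_sumr; congr (_ + _); apply: eq_bigr => j _.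
  by rewrite scalerA mulrCA mulfV// mulr1.
apply: le_trans (alpha_subconvex lwi (lw ord_max) cD s_ge0 (l0 _) l1') _.
rewrite lerD2r; apply: (@le_trans _ _ (s * \sum_(j < N) (l (i j) / s) * alpha (w (i j)) D')).
  apply: ler_wpM2l => //; apply: IH.
  - by move=> j; exact: lw.
  - by move=> j; rewrite divr_ge0.
  - by rewrite -mulr_suml -/s mulfV.
rewrite mulr_sumr le_eqVlt; apply/orP; left; apply/eqP; apply: eq_bigr => j _.
by rewrite mulrA mulrCA mulfV// mulr1.
Qed.

(** The signs of the [c j] go into the functions, where homogeneity gives them a factor at most 1.
    The scale [S] comes out with the power [p], and the remaining weights sum to at most 1. *)
Lemma alpha_comb N (c : 'I_N -> R) (w : 'I_N -> 'cV[R]_n -> 'cV[R]_m) (D' : set 'cV[R]_n) (S : R) :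
  copies G D setT D' -> (forall j, in_Lploc p (w j)) -> 0 < S ->
  \sum_j `|c j| <= S ->
  alpha (fun x => \sum_j c j *: w j x) D' <=
    S `^ p * \sum_j (`|c j| / S) * alpha (w j) D'.
Proof.
move=> cD lw S0 cS.
pose w' j x := (Num.sg (c j)) *: w j x.
have lw' j : in_Lploc p (w' j) by exact: in_LplocZ.
have lsum : in_Lploc p (fun x => \sum_j (`|c j| / S) *: w' j x) by exact: in_Lploc_sum.
rewrite (_ : (fun x => _) = fun x => S *: (\sum_j (`|c j| / S) *: w' j x)); last first.
  apply/funext => x; rewrite scaler_sumr; apply: eq_bigr => j _.
  rewrite /w' !scalerA [S * _]mulrCA mulfV ?gt_eqF// mulr1.
  by rewrite mulrC -numEsg.
rewrite alphaZ// gtr0_norm//; apply: ler_wpM2l; first exact: powR_ge0.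
apply: (@le_trans _ _ (\sum_j (`|c j| / S) * alpha (w' j) D')).
  apply: alpha_subconvex_sum => //.
  - by move=> j; rewrite divr_ge0// ltW.
  - by rewrite -mulr_suml ler_pdivrMr// mul1r.
apply: ler_sum => j _; apply: ler_wpM2l; first by rewrite divr_ge0// ltW.
have E := alphaZ (Num.sg (c j)) (lw j) cD.
have a0 := alpha_ge0 (lw j) cD.
rewrite /w'.
rewrite [leLHS]E.
apply: ler_piMl; first exact: a0.
rewrite normr_sg; case: eqP => _ /=; last by rewrite powR1.
by rewrite powR0 ?ler01// gt_eqF.
Qed.

(** Orthogonality of [A] makes the copy the preimage of [D] under the continuous map sending [y] to
    [e^-1 A^T (y - h)]. *)
Lemma copies_open_bounded (D' : set 'cV[R]_n) : open D -> bounded_set D -> copies G D setT D' ->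
  open D' /\ exists2 r : R, 0 < r & D' `<=` cball n r.
Proof.
move=> oD bD [e e0 [[A [h [GA ->]]] _]].
have [AT _] : SO A by case: GSO => + _ _ _; exact.
have A1 : A^T *m A = 1%:M by exact: mulmx1C.
split.
  rewrite (_ : _ @` _ = (fun y => e^-1 *: (A^T *m (y - h))) @^-1` D).
    apply: open_comp => // y _; apply: (@lipschitz_continuous _ _ _ _
      (e^-1 * (n%:R * `|A^T|))) => x z.
    rewrite -scalerBr -mulmxBr opprB addrA subrK normrZ.
    by rewrite gtr0_norm ?invr_gt0// -mulrA ler_wpM2l ?invr_ge0 ?(ltW e0)// norm_mulmx_le.
  apply/seteqP; split=> [_ [x Dx <-]|y Dy] /=.
    by rewrite /similarity addrK -scalemxAr mulmxA A1 mul1mx scalerA mulVf ?gt_eqF// scale1r.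
  exists (e^-1 *: (A^T *m (y - h))) => //.
  by rewrite /similarity -scalemxAr mulmxA AT mul1mx scalerA mulfV ?gt_eqF// scale1r subrK.
have [r r0 Dr] := ex_strict_bound_gt0 bD.
exists (e * (n%:R * `|A| * r) + `|h| + 1).
  by rewrite ltr_wpDl// addr_ge0// !mulr_ge0// ltW.
move=> _ [x Dx <-]; rewrite /cball/= /similarity.
rewrite (le_trans (ler_normD _ _))// -addrA lerD// ?lerDl// normrZ gtr0_norm//.
rewrite ler_wpM2l ?(ltW e0)// (le_trans (norm_mulmx_le _ _))// ler_wpM2l//.
by apply/ltW/Dr.
Qed.

(** Lower semicontinuity is assumed on L^p of the whole space. Cutting functions off outside the
    bounded set [D'] puts them there, and locality preserves their energy on [D']; closeness on
    [D'], component by component, is then enough. *)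
Lemma alpha_lsc_local (D' : set 'cV[R]_n) v (a : R) : open D -> bounded_set D ->
  copies G D setT D' -> lsc_on_Lp p (fun w => alpha w D') -> in_Lploc p v ->
  a < alpha v D' ->
  exists2 eta : R, 0 < eta & forall w, in_Lploc p w ->
    (forall i, \int[mu]_(x in D') (`|w x i 0 - v x i 0| `^ p)%:E <= eta%:E)%E ->
    a < alpha w D'.
Proof.
move=> oD bD cD lsc lv av.
have [oD' [r r0 Dr]] := copies_open_bounded oD bD cD.
have mD : measurable D' by exact: open_cV_measurable.
have mr := @measurable_cball R n r.
pose cut (w : 'cV[R]_n -> 'cV[R]_m) x := (\1_D' x : R) *: w x.
have cutE w x i : cut w x i 0 = \1_D' x * w x i 0 by rewrite mxE.
have mcut w : in_Lploc p w -> forall i, measurable_fun setT (fun x => cut w x i 0).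
  move=> [mw _] i; under eq_fun do rewrite cutE.
  by apply: measurable_funM; [exact: measurable_indic|exact: mw].
have lcut w : in_Lploc p w -> in_Lploc p (cut w).
  move=> lw; apply/(in_LplocP p0) => i; have /(in_LplocP p0)/(_ i)[mwi lwi] := lw.
  split; first exact: mcut.
  move=> s; apply: le_lt_trans (lwi s); apply: ge0_le_integral.
  - exact: measurable_cball.
  - by move=> x _; rewrite lee_fin powR_ge0.
  - by apply: measurable_funTS; apply: measurable_normr_powR; exact: mcut.
  - by apply: measurable_funTS; exact: measurable_normr_powR.
  - move=> x _; rewrite lee_fin; apply: ler_powRl => //; first exact: ltW.
    rewrite cutE normrM ler_piMl// indicE.
    by case: (_ \in _); rewrite ?normr1 ?normr0.
have cutD w x : D' x -> cut w x = w x.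
  by move=> Dx; rewrite /cut indicE mem_set// scale1r.
have cutN w x : ~ D' x -> cut w x = 0.
  by move=> Dx; rewrite /cut indicE memNset// scale0r.
have Lpcut w : in_Lploc p w -> in_Lp (@enorm R m) p setT (cut w).
  move=> lw; have lcw := lcut w lw; split=> [i j|].
    by rewrite (ord1 j); exact: mcut.
  apply: le_lt_trans (proj2 lcw _ (@compact_cball R n r)).
  rewrite [leRHS]integral_mkcond; apply: ge0_le_integral.
  - exact: measurableT.
  - by move=> x _; rewrite lee_fin powR_ge0.
  - by apply: measurable_enorm_powR; exact: mcut.
  - apply/(measurable_restrictT _ mr)/measurable_funTS.
    by apply: measurable_enorm_powR; exact: mcut.
  - move=> x _; rewrite patchE; case: ifPn => // /negP xr.
    rewrite cutN; last by move=> /Dr xD; apply: xr; rewrite inE.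
    by rewrite enorm0 powR0// gt_eqF.
have alcut w : in_Lploc p w -> alpha (cut w) D' = alpha w D'.
  by move=> lw; exact: (alpha_local (lcut w lw) lw cD (cutD w)).
have [d d0 dP] := lsc (cut v) (Lpcut _ lv) a (eq_ind_r (fun z => a < z) av (alcut v lv)).
have M0 : 0 < m%:R `^ p * m%:R + 1 :> R by rewrite ltr_wpDl// mulr_ge0// powR_ge0.
(* Chosen so that [m ^ p * m * eta < d ^ p]: the factor [m ^ p] compares the Euclidean norm with the
   coordinates, [m] counts them, and the added 1 makes the inequality strict. *)
exists (d `^ p / (m%:R `^ p * m%:R + 1)); first by rewrite divr_gt0// powR_gt0.
move=> w lw wv; rewrite -alcut//; apply: dP; first exact: Lpcut.
set F := EFin \o _.
have mw i : measurable_fun setT (fun x => w x i 0) by case: lw => + _; exact.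
have mv i : measurable_fun setT (fun x => v x i 0) by case: lv => + _; exact.
have mwv i : measurable_fun setT (fun x => w x i 0 - v x i 0) by exact: measurable_funB.
have : (\int[mu]_x `|F x| `^ p < (d `^ p)%:E)%E.
  apply: (@le_lt_trans _ _ (\int[mu]_(x in D')
     ((m%:R `^ p)%:E * \sum_i (`|w x i 0 - v x i 0| `^ p)%:E))%E).
    rewrite [leRHS]integral_mkcond; apply: ge0_le_integral.
    - exact: measurableT.
    - by move=> x _; exact: poweR_ge0.
    - rewrite (_ : (fun x => _) = (fun x => (enorm (cut w x - cut v x) `^ p)%:E)).
        apply: measurable_enorm_powR => i.
        rewrite (_ : (fun x => _) = (fun x => cut w x i 0 - cut v x i 0)).
          by apply: measurable_funB; exact: mcut.
        by apply/funext => x; rewrite !mxE.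
      by apply/funext => x; rewrite /F gee0_abs ?lee_fin ?enorm_ge0//= poweR_EFin.
    - apply/(measurable_restrictT _ mD); apply: emeasurable_funM; first exact: measurable_cst.
      apply: emeasurable_sum => i; apply: measurable_funTS.
      by apply: measurable_normr_powR.
    - move=> x _; rewrite patchE /F gee0_abs ?lee_fin ?enorm_ge0//= ?poweR_EFin; case: ifPn => [/set_mem xD|/negP xD].
        rewrite !cutD// sumEFin -EFinM lee_fin (le_trans (enorm_powR_le _ p0))//.
        by rewrite ler_wpM2l ?powR_ge0//; apply: ler_sum => i _; rewrite !mxE.
      by rewrite !cutN ?subrr ?enorm0 ?powR0 ?gt_eqF// => xD'; apply: xD; rewrite inE.
  rewrite ge0_integralZl; last 4 first.
  - exact: mD.
  - apply: emeasurable_sum => i; apply: measurable_funTS; exact: measurable_normr_powR.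
  - by move=> x _; apply: sume_ge0 => i _; rewrite lee_fin powR_ge0.
  - by rewrite lee_fin powR_ge0.
  rewrite ge0_integral_sum; last 3 first.
  - exact: mD.
  - by move=> i; apply: measurable_funTS; exact: measurable_normr_powR.
  - by move=> i x _; rewrite lee_fin powR_ge0.
  set eta := d `^ p / _ in wv *.
  apply: (@le_lt_trans _ _ ((m%:R `^ p * (m%:R * eta))%:E)).
    rewrite EFinM; apply: lee_wpmul2l; first by rewrite lee_fin powR_ge0.
    apply: (@le_trans _ _ (\sum_(i < m) eta%:E)%E); first by apply: lee_sum => i _; exact: wv.
    by rewrite sumEFin sumr_const card_ord mulr_natl.
  have dp0 : 0 < d `^ p by exact: powR_gt0.
  rewrite lte_fin (_ : _ * _ = d `^ p * (m%:R `^ p * m%:R / (m%:R `^ p * m%:R + 1))).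
    by rewrite gtr_pMr// ltr_pdivrMr// mul1r ltrDl.
  by rewrite /eta mulrA mulrCA -!mulrA.
move=> Flt; rewrite ltNge; apply/negP => dN; move: Flt; apply/negP.
rewrite -leNgt -poweR_Lnorm ?gt_eqF// -poweR_EFin.
apply: gt0_ler_poweR => //; first exact: ltW.
  by rewrite in_itv/= leey andbT lee_fin ltW.
by rewrite in_itv/= leey andbT Lnorm_ge0.
Qed.

End core_functional_theory.

(** * The null space of psi *)

Section null_matrices.
Context (R : realType) (m n : nat) (p : R) (G : set 'M[R]_n) (D : set 'cV[R]_n).
Variable alpha : ('cV[R]_n -> 'cV[R]_m) -> set 'cV[R]_n -> R.
Hypotheses (p1 : 1 < p) (GSO : subgroup_of_SO G) (core : core_functional p G D alpha).
Implicit Types (u v : 'cV[R]_n -> 'cV[R]_m) (Omega : set 'cV[R]_n).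

Let p0 : 0 < p. Proof. exact: lt_trans p1. Qed.

Lemma copies_at_copies (e : R) Omega D' : 0 < e -> copies_at G D e Omega D' ->
  copies G D setT D'.
Proof. by move=> e0 [H _]; exists e. Qed.

(** Injectivity is separate from disjointness because the seminorm sums over a set of copies: empty
    copies are pairwise disjoint, yet they coincide and are counted once. *)
Lemma bmo_eps_ge_fin (I : finType) (F : I -> set 'cV[R]_n) u Omega (e : R) :
  0 < e -> in_Lploc p u -> (forall i, copies_at G D e Omega (F i)) ->
  (forall i j, F i `&` F j !=set0 -> i = j) -> injective F ->
  ((e `^ (n%:R - p) * \sum_i alpha u (F i))%:E <= bmo_eps p G D alpha Omega u e)%E.
Proof.
move=> e0 lu FC FD Finj; rewrite /bmo_eps EFinM.
apply: lee_wpmul2l; first by rewrite lee_fin powR_ge0.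
apply: ereal_sup_ge; exists (\esum_(D' in range F) (alpha u D')%:E).
  exists (range F) => //; split.
    by move=> _ [i _ <-].
  move=> _ _ [i _ <-] [j _ <-] /FD ->//.
rewrite esum_fset.
- rewrite -sumEFin -big_enum fsbig_seq ?enum_uniq//.
  rewrite (_ : [set` enum I] = setT); last first.
    by apply/seteqP; split=> i //= _; rewrite mem_enum.
  rewrite fsbig_image//; exact: in2W.
- by apply: finite_image; exact: finite_finset.
- move=> D' /set_mem [i _ <-]; rewrite lee_fin (alpha_ge0 core)//.
  exact: (copies_at_copies e0 (FC i)).
Qed.

Lemma alpha_linear_similarity A B (e : R) h : 0 < e -> G B ->
  alpha (fun x => A *m x) (similarity e B h @` D) =
  e `^ p * alpha (fun x => (A *m B) *m x) D.
Proof.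
move=> e0 GB; have cD := copies_ref D GSO.
have lA (C : 'M[R]_(m, n)) := in_Lploc_linear p0 C.
rewrite -(alpha_comp core h (lA A) cD e0 GB).
transitivity (alpha (fun x => e *: ((A *m B) *m x) + A *m h) D).
  congr alpha; apply/funext => x /=.
  by rewrite /similarity mulmxDr -scalemxAr mulmxA.
rewrite (@alphaD_cst _ _ _ _ _ _ _ core (fun x => e *: ((A *m B) *m x)))//; last first.
  exact: in_LplocZ.
by rewrite (alphaZ core e (lA _) cD) gtr0_norm.
Qed.

(** An explicit form of the null space of [psi], identified with it in [psi_nullE]: the linear map
    has no energy on any copy of [D], whatever its rotation. *)
Definition rot_null : set 'M[R]_(m, n) :=
  [set A | forall B, G B -> alpha (fun x => (A *m B) *m x) D = 0].

Lemma bmo_eps_ge0 u Omega (e : R) : (0 <= bmo_eps p G D alpha Omega u e)%E.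
Proof.
rewrite /bmo_eps mule_ge0 ?lee_fin ?powR_ge0//.
apply: ereal_sup_ge; exists 0%E => //; exists set0.
  by split => //; exact: trivIset_set0.
exact: esum_set0.
Qed.

Lemma rot_null_bmo A Omega (e : R) : rot_null A -> 0 < e ->
  bmo_eps p G D alpha Omega (fun x => A *m x) e = 0%E.
Proof.
move=> A0 e0; apply/eqP; rewrite eq_le bmo_eps_ge0 andbT.
rewrite /bmo_eps mule_ge0_le0 ?lee_fin ?powR_ge0//.
apply: ge_ereal_sup => _ [F [FC _] <-].
rewrite esum1// => D' /FC [[B [h [GB ->]]] _].
by rewrite alpha_linear_similarity// A0// mulr0.
Qed.

End null_matrices.

Lemma cvg_ereal_sup_le (R : realType) (T : Type) (F : set_system T)
    (FF : Filter F) (f : T -> \bar R) (s : \bar R) : (0 <= s)%E ->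
  (\forall x \near F, (0 <= f x <= s)%E) ->
  (forall b : R, (b%:E < s)%E -> \forall x \near F, (b%:E <= f x)%E) ->
  f x @[x --> F] --> s.
Proof.
case: s => [s| |//] s0 fs sf; last by apply/cvgeyPge => A; apply: sf; exact: ltry.
apply/fine_cvgP; split.
  apply: filterS fs => x /andP[f0 fs]; rewrite ge0_fin_numE//.
  exact: le_lt_trans fs (ltry _).
apply/cvgrPdist_le => e e0.
have : \forall x \near F, ((s - e)%:E <= f x)%E.
  by apply: sf; rewrite lte_fin ltrBlDr ltrDl.
move=> sef; apply: filterS2 fs sef => x /andP[f0 fs] sef.
have ffin : f x \is a fin_num by rewrite ge0_fin_numE// (le_lt_trans fs) ?ltry.
move: fs sef; rewrite -(fineK ffin) !lee_fin => fs sef /=.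
by rewrite ger0_norm ?subr_ge0// lerBlDr addrC -lerBlDr.
Qed.

Lemma bernoulli_ineq (R : realType) (t : R) k : 0 <= t <= 1 ->
  1 - k%:R * t <= (1 - t) ^+ k.
Proof.
move=> /andP[t0 t1]; elim: k => [|k IH]; first by rewrite mul0r subr0 expr0.
rewrite exprS; have t1' : 0 <= 1 - t by rewrite subr_ge0.
apply: le_trans (ler_wpM2l t1' IH).
rewrite -subr_ge0 (_ : _ - _ = k%:R * t ^+ 2); first by rewrite mulr_ge0// sqr_ge0.
by rewrite -[k.+1%:R]natr1; ring.
Qed.

Section psi_convergence.
Context (R : realType) (m n : nat) (p : R) (G : set 'M[R]_n) (D : set 'cV[R]_n).
Variable alpha : ('cV[R]_n -> 'cV[R]_m) -> set 'cV[R]_n -> R.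
Hypotheses (p1 : 1 < p) (GSO : subgroup_of_SO G) (core : core_functional p G D alpha).
Hypothesis D_bounded : bounded_set D.

Let p0 : 0 < p. Proof. exact: lt_trans p1. Qed.
Let Q := @unit_cube R n.
Let lin (A : 'M[R]_(m, n)) (x : 'cV[R]_n) : 'cV[R]_m := A *m x.
Let lin_Lploc A : in_Lploc p (lin A). Proof. exact: in_Lploc_linear. Qed.

Lemma similarity_nonempty (D' : set 'cV[R]_n) (t : R) A k : D' !=set0 ->
  similarity t A k @` D' !=set0.
Proof. by move=> [x Dx]; exists (similarity t A k x), x. Qed.

(* The cube [Q] contains [N^n] disjoint translates of [t Q] as soon as
   [N t <= 1]; each of them carries a copy of the given family. *)
Lemma bmo_eps_pack A k (F : 'I_k -> set 'cV[R]_n) (e0 e : R) :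
  0 < e -> e < e0 -> D !=set0 ->
  (forall i, copies_at G D e0 Q (F i)) ->
  (forall i j, F i `&` F j !=set0 -> i = j) ->
  (((1 - e / e0) ^+ n * (e0 `^ (n%:R - p) * \sum_i alpha (lin A) (F i)))%:E <=
    bmo_eps p G D alpha Q (lin A) e)%E.
Proof.
move=> e_gt0 ee0 D0 FC FD; have e0_gt0 : 0 < e0 by exact: lt_trans ee0.
pose t := e / e0; have t0 : 0 < t by rewrite divr_gt0.
have t1 : t < 1 by rewrite ltr_pdivrMr// mul1r.
(* Along each edge of [Q] there is room for [N] subcubes of side [t], and [1 - t <= t N] bounds the
   length left over. *)
pose N := Num.trunc (t^-1).
have /andP[Nt tN] : N%:R <= t^-1 < N.+1%:R.
  by apply: truncn_itv; rewrite invr_ge0 ltW.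
have tN1 : t * N%:R <= 1 by rewrite mulrC -ler_pdivlMr// mul1r.
have tN2 : 1 - t <= t * N%:R.
  rewrite lerBlDr -[X in _ + X]mulr1 -mulrDr natr1 mulrC -ler_pdivrMr// mul1r.
  exact: ltW.
(* This translation carries [t Q] onto the subcube of index [z], counted from the corner of [Q] with
   all coordinates [- 1/2]. *)
pose shift (z : {ffun 'I_n -> 'I_N}) : 'cV[R]_n :=
  \col_i (t * (z i)%:R + t / 2 - 2^-1).
pose H (iz : 'I_k * {ffun 'I_n -> 'I_N}) := similarity t 1%:M (shift iz.2) @` F iz.1.
have cF i : copies G D setT (F i) by exact: copies_at_copies (FC i).
have FQ i : F i `<=` Q by case: (FC i).
have F0 i : F i !=set0.
  by have [[B [h [_ ->]]] _] := FC i; exact: similarity_nonempty.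
have coord i z (x : 'cV[R]_n) : similarity t (1%:M : 'M[R]_n) (shift z) x i 0 =
    t * (x i 0 + (z i)%:R + 2^-1) - 2^-1.
  by rewrite similarityE !mxE; ring.
have HC iz : copies_at G D e Q (H iz).
  have [[B [h [GB EF]]] _] := FC iz.1; split.
    exists B, (t *: h + shift iz.2); split => //.
    rewrite /H EF; have te : t * e0 = e by rewrite /t divfK// gt_eqF.
    apply/seteqP; split=> [_ [_ [x Dx <-] <-]|_ [x Dx <-]].
      by exists x => //; rewrite similarity_comp te.
    exists (similarity e0 B h x); first by exists x.
    by rewrite similarity_comp te.
  move=> _ [x /FQ xQ <-] i; rewrite coord.
  have /andP[x1 x2] := xQ i.
  have zN : (iz.2 i)%:R + 1 <= N%:R :> R by rewrite natr1 ler_nat ltn_ord.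
  have z0 : 0 <= (iz.2 i)%:R :> R by exact: ler0n.
  apply/andP; split.
    rewrite ltrBrDr addNr mulr_gt0// -[ltLHS](addNr (2^-1 : R)) ltrD2r.
    by apply: lt_le_trans x1 _; rewrite lerDl.
  rewrite ltrBlDr (lt_le_trans _ (_ : 1 <= _))//; last by lra.
  apply: lt_le_trans tN1; rewrite ltr_pM2l//.
  by apply: lt_le_trans zN; rewrite addrAC addrC ltrD2l; lra.
have HD iz jz : H iz `&` H jz !=set0 -> iz = jz.
  case: iz jz => [i z] [j z'] /= [y [[x Fx xy] [x' Fx' x'y]]].
  have zz : z = z'.
    apply/ffunP => l.
    have E : t * (x l 0 + (z l)%:R + 2^-1) = t * (x' l 0 + (z' l)%:R + 2^-1).
      by apply: (addIr (- 2^-1)); rewrite -!coord xy x'y.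
    move/(mulfI (lt0r_neq0 t0)) : E => E.
    have /andP[x1 x2] := FQ _ _ Fx l; have /andP[x1' x2'] := FQ _ _ Fx' l.
    apply/val_inj; case: (ltngtP (z l) (z' l)) => // zl; exfalso.
      have : (z l)%:R + 1 <= (z' l)%:R :> R by rewrite natr1 ler_nat.
      by move: E x1 x2 x1' x2' => /=; lra.
    have : (z' l)%:R + 1 <= (z l)%:R :> R by rewrite natr1 ler_nat.
    by move: E x1 x2 x1' x2' => /=; lra.
  rewrite zz; congr pair; apply: FD; exists x; split => //.
  suff -> : x = x' by [].
  have : t *: x = t *: x'.
    by apply: (addIr (shift z')); rewrite -!similarityE x'y -xy zz.
  by move/(congr1 ( *:%R t^-1)); rewrite !scalerA mulVf ?gt_eqF// !scale1r.
have Hinj : injective H.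
  move=> iz jz E; apply: HD; rewrite -E setIid.
  exact: similarity_nonempty.
apply: le_trans (bmo_eps_ge_fin core e_gt0 (lin_Lploc A) HC HD Hinj).
have alphaH iz : alpha (lin A) (H iz) = t `^ p * alpha (lin A) (F iz.1).
  rewrite /H -(alpha_comp core _ (lin_Lploc A) (cF _) t0 (subgroup1 GSO)).
  transitivity (alpha (fun x => t *: lin A x + A *m shift iz.2) (F iz.1)).
    congr alpha; apply/funext => x /=.
    by rewrite similarityE /lin mulmxDr scalemxAr.
  rewrite (@alphaD_cst _ _ _ _ _ _ _ core (fun x => t *: lin A x))//; last first.
    exact: in_LplocZ.
  by rewrite (alphaZ core t (lin_Lploc A) (cF _)) gtr0_norm.
set S := \sum_i alpha (lin A) (F i).
have S0 : 0 <= S by apply: sumr_ge0 => i _; exact: (alpha_ge0 core (lin_Lploc A) (cF i)).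
have -> : \sum_iz alpha (lin A) (H iz) = t `^ p * (N%:R ^+ n * S).
  under eq_bigr do rewrite alphaH.
  rewrite -(pair_big xpredT xpredT (fun i (z : {ffun 'I_n -> 'I_N}) =>
     t `^ p * alpha (lin A) (F i)))/=.
  under eq_bigr do rewrite sumr_const card_ffun !card_ord -mulr_natl.
  rewrite /S !mulr_sumr; apply: eq_bigr => i _.
  by rewrite natrX mulrCA.
(* Each small copy carries the factor [t ^ p], the weight passes from scale [e0] to [e = t e0], and
   [N ^ n] copies replace one: the total factor is [(t N) ^ n], at least [(1 - t) ^ n]. *)
have tn : e `^ (n%:R - p) * t `^ p = e0 `^ (n%:R - p) * t ^+ n.
  have -> : e = t * e0 by rewrite /t divfK// gt_eqF.
  rewrite powRM ?ltW// mulrAC mulrC -powRD; last by rewrite lt0r_neq0 ?implybT.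
  by rewrite subrK powR_mulrn// ltW.
rewrite lee_fin mulrA tn -mulrA mulrCA ler_wpM2l ?powR_ge0//.
rewrite !mulrA ler_wpM2r// -exprMn.
apply: lerXn2r => //; rewrite nnegrE; first by rewrite subr_ge0 ltW.
by rewrite mulr_ge0// ltW.
Qed.

End psi_convergence.

Section psi_null_characterization.
Context (R : realType) (m n : nat) (p : R) (G : set 'M[R]_n) (D : set 'cV[R]_n).
Variable alpha : ('cV[R]_n -> 'cV[R]_m) -> set 'cV[R]_n -> R.
Hypotheses (p1 : 1 < p) (GSO : subgroup_of_SO G) (core : core_functional p G D alpha).
Hypothesis D_bounded : bounded_set D.

Let p0 : 0 < p. Proof. exact: lt_trans p1. Qed.
Let Q := @unit_cube R n.
Let lin (A : 'M[R]_(m, n)) (x : 'cV[R]_n) : 'cV[R]_m := A *m x.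
Let lin_Lploc A : in_Lploc p (lin A). Proof. exact: in_Lploc_linear. Qed.
Let f A (e : R) := bmo_eps p G D alpha Q (lin A) e.

Lemma alpha_neq0_nonempty (u : 'cV[R]_n -> 'cV[R]_m) : in_Lploc p u ->
  alpha u D != 0 -> D !=set0.
Proof.
move=> lu au; apply/set0P/eqP => D0; move/eqP: au; apply.
by apply: (alpha_set0 p1 core lu) => //; exact: copies_ref.
Qed.

(** One copy suffices: [c] exceeds the norm of [B x] on [D], so at the scale [1 / (2 c)] the copy
    [e B D] lies in the unit cube. *)
Lemma bmo_eps_linear_gt0 A B : G B -> alpha (lin (A *m B)) D != 0 ->
  exists2 e : R, 0 < e & (0 < f A e)%E.
Proof.
move=> GB aB; have lAB := lin_Lploc (A *m B).
have [r r0 Dr] := ex_strict_bound_gt0 D_bounded.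
pose c := n%:R * `|B| * r + 1; have c0 : 0 < c by rewrite ltr_wpDl// !mulr_ge0// ltW.
pose e := (2 * c)^-1; have e0 : 0 < e by rewrite invr_gt0 mulr_gt0.
exists e => //.
have DQ : similarity e B 0 @` D `<=` Q.
  move=> _ [x Dx <-] i; rewrite /similarity addr0 -ltr_norml.
  apply: le_lt_trans (coord_le_norm _ _) _; rewrite normrZ gtr0_norm//.
  rewrite /e invfM -[ltRHS]mulr1 -mulrA ltr_pM2l ?invr_gt0//.
  rewrite ltr_pdivrMl// mulr1; apply: le_lt_trans (norm_mulmx_le _ _) _.
  rewrite /c ltr_pwDr// ler_wpM2l ?mulr_ge0//; exact/ltW/Dr.
have HC (i : 'I_1) : copies_at G D e Q (similarity e B 0 @` D) by split => //; exists B, 0.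
apply: lt_le_trans (bmo_eps_ge_fin core e0 (lin_Lploc A) HC _ _); last 2 first.
- by move=> i j _; rewrite (ord1 i) (ord1 j).
- by move=> i j _; rewrite (ord1 i) (ord1 j).
rewrite big_ord1 (alpha_linear_similarity p1 GSO core)// lte_fin.
rewrite mulr_gt0 ?powR_gt0// mulr_gt0 ?powR_gt0// lt_neqAle eq_sym aB.
exact: (alpha_ge0 core lAB (copies_ref D GSO)).
Qed.

(** By [bmo_eps_pack], energy present at one scale is present at all small scales up to a factor
    tending to 1, so the limit at 0 is the supremum over all scales. A vanishing limit thus forces
    vanishing at every scale. *)
Lemma bmo_eps_linear_cvg A : D !=set0 ->
  f A e @[e --> 0^'+] --> ereal_sup [set f A e | e in [set e | 0 < e]].
Proof.
move=> D0; set s := ereal_sup _.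
have fs (e : R) : 0 < e -> (0 <= f A e <= s)%E.
  move=> e0; rewrite (bmo_eps_ge0 p G D alpha (lin A) Q e)/=.
  by apply: ereal_sup_ubound; exists e.
have s0 : (0 <= s)%E by have /andP[] := fs 1 ltr01; exact: le_trans.
apply: cvg_ereal_sup_le => //.
  by near=> e; apply: fs; near: e; exact: nbhs_right_gt.
move=> b bs; have [b0|b0] := ltP b 0.
  near=> e; have e0 : 0 < e by near: e; exact: nbhs_right_gt.
  by apply: (@le_trans _ _ 0%E); [rewrite lee_fin ltW|have /andP[] := fs e e0].
(* From a scale [e0] whose seminorm exceeds [b], a finite disjoint family is extracted whose
   weighted energy [V] still exceeds [b]: infinite sums are suprema of finite ones. *)
have [_ [e0 /= e0_gt0 <-] bf] := ereal_sup_gt bs.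
pose c : R := e0 `^ (n%:R - p); have c0 : 0 < c by exact: powR_gt0.
move: bf; rewrite /f /bmo_eps -/c -lte_pdivrMl// => /ereal_sup_gt[_ [F [FC FT] <-]].
move=> /ereal_sup_gt[_ [X [finX XF] <-]].
rewrite fsbig_finite// sumEFin -EFinM lte_fin ltr_pdivrMl//.
set xs := finmap.enum_fset _ => bV.
have inF i : F (nth set0 xs (i : 'I_(size xs))).
  apply: XF; have : nth set0 xs i \in xs by exact: mem_nth.
  by rewrite /xs in_fset_set// => /set_mem.
pose H (i : 'I_(size xs)) := nth set0 xs i.
have HC i : copies_at G D e0 Q (H i) by exact/FC/inF.
have HD i j : H i `&` H j !=set0 -> i = j.
  move=> /(FT _ _ (inF i) (inF j)) /eqP; rewrite nth_uniq//.
    by move=> /eqP/val_inj.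
  exact: finmap.fset_uniq.
set V := c * _ in bV.
have VE : V = c * \sum_i alpha (lin A) (H i).
  by rewrite /V (big_nth set0) big_mkord.
have V0 : 0 < V by exact: le_lt_trans b0 bV.
have W0 : 0 < n%:R * V + 1 by rewrite ltr_wpDl// mulr_ge0// ltW.
(* By Bernoulli's inequality the packed energy is at least [(1 - n e / e0) V], which is at least [b]
   for [e] below this threshold. *)
have e1_gt0 : 0 < (V - b) / (n%:R * V + 1) * e0.
  by rewrite mulr_gt0// divr_gt0// subr_gt0.
near=> e.
have e_gt0 : 0 < e by near: e; exact: nbhs_right_gt.
have ee0 : e < e0 by near: e; exact: nbhs_right_lt.
have := bmo_eps_pack p1 GSO core A e_gt0 ee0 D0 HC HD; rewrite -/c -VE.
apply: le_trans; rewrite lee_fin.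
have t01 : 0 <= e / e0 <= 1.
  by rewrite divr_ge0 ?(ltW e_gt0) ?(ltW e0_gt0)//= ler_pdivrMr// mul1r ltW.
have et : e / e0 * (n%:R * V + 1) <= V - b.
  rewrite -ler_pdivlMr// ler_pdivrMr//; near: e; exact: nbhs_right_le.
apply: (@le_trans _ _ ((1 - n%:R * (e / e0)) * V)); last first.
  by apply: ler_wpM2r; [exact: ltW|exact: bernoulli_ineq].
have e00 : 0 <= e / e0 by case/andP: t01.
have : e / e0 * (n%:R * V) <= V - b.
  by apply: le_trans et; rewrite ler_wpM2l// lerDl.
rewrite mulrBl mul1r [n%:R * _]mulrC -mulrA; lra.
Unshelve. all: by end_near. Qed.

Lemma psi_nullE : psi_null p G D alpha = rot_null G D alpha.
Proof.
apply/seteqP; split => A /=; last first.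
  move=> A0; apply/cvg_lim => //.
  apply: (@cvg_trans _ (cst 0%E e @[e --> 0^'+])); last exact: cvg_cst.
  apply: near_eq_cvg; near=> e.
  rewrite (rot_null_bmo p1 GSO core)//; near: e; exact: nbhs_right_gt.
rewrite /psi_null/= /psi => psi0 B GB; apply/eqP/negP => /negP aB.
have D0 := alpha_neq0_nonempty (lin_Lploc (A *m B)) aB.
have s0 : ereal_sup [set f A e | e in [set e | 0 < e]] = 0%E.
  by rewrite -psi0; apply/esym/cvg_lim => //; exact: bmo_eps_linear_cvg.
have [e e0 fe] := bmo_eps_linear_gt0 GB aB.
have : (f A e <= 0)%E by rewrite -s0; apply: ereal_sup_ubound; exists e.
by rewrite leNgt fe.
Unshelve. all: by end_near. Qed.

(** Two terms without energy in [alpha_comb]. With [psi_nullE] this makes the null space of [psi]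
    linear, hence the projection along it linear too. *)
Lemma rot_null_comb A A' (a : R) : rot_null G D alpha A -> rot_null G D alpha A' ->
  rot_null G D alpha (a *: A + A').
Proof.
move=> A0 A0' B GB; have cD := copies_ref D GSO.
pose w (j : 'I_2) := if j == 0 then lin (A *m B) else lin (A' *m B).
pose c (j : 'I_2) : R := if j == 0 then a else 1.
have lw j : in_Lploc p (w j) by rewrite /w; case: ifP.
have cS : \sum_j `|c j| <= `|a| + 1.
  by rewrite big_ord_recl big_ord1 /c/= normr1.
have S0 : 0 < `|a| + 1 by rewrite ltr_wpDl.
apply/eqP; rewrite eq_le; apply/andP; split; last first.
  exact: (alpha_ge0 core (lin_Lploc _) cD).
have := alpha_comb p1 core cD lw S0 cS.
rewrite big_ord_recl big_ord1 /w/= A0// A0'// !mulr0 addr0 mulr0.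
congr (_ <= _); congr alpha; apply/funext => x.
by rewrite big_ord_recl big_ord1 /c/= scale1r /lin !mulmxDl -!scalemxAl.
Qed.

End psi_null_characterization.

(** * The projection along the null space *)

Section projection.
Context (R : realType) (m n : nat) (P : {vspace 'M[R]_(m, n)}) (N : set 'M[R]_(m, n)).
Hypothesis (NZD : forall a A A', N A -> N A' -> N (a *: A + A')).
Hypothesis PN : direct_sum P N.

Lemma proj_alongP A : proj_along P N A \in P /\ N (A - proj_along P N A).
Proof.
have [[B C] /= [[BP NC AE] _]] := PN A.
apply: (@getPex _ [set B | B \in P /\ N (A - B)]).
by exists B; split => //; rewrite AE addrAC subrr add0r.
Qed.

(** [proj_along] is a choice among admissible values; uniqueness of the decomposition pins it down,
    and linearity follows. *)
Lemma proj_along_uniq A B : B \in P -> N (A - B) -> proj_along P N A = B.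
Proof.
move=> BP NB; have [pP pN] := proj_alongP A.
have [x [_ xu]] := PN A.
have /(congr1 fst)/= <- := xu (proj_along P N A, A - proj_along P N A)
  (And3 pP pN (esym (subrKC _ _))).
by have /(congr1 fst)/= <- := xu (B, A - B) (And3 BP NB (esym (subrKC _ _))).
Qed.

Lemma proj_along_comb a A A' :
  proj_along P N (a *: A + A') = a *: proj_along P N A + proj_along P N A'.
Proof.
have [AP AN] := proj_alongP A; have [AP' AN'] := proj_alongP A'.
apply: proj_along_uniq; first by rewrite memvD// memvZ.
by rewrite opprD addrACA -scalerBr; exact: NZD.
Qed.

Lemma proj_along_null A : N A -> proj_along P N A = 0.
Proof. by move=> NA; apply: proj_along_uniq; rewrite ?mem0v// subr0. Qed.

End projection.

(** A Lebesgue number: radii whose doubled balls lie in [Omega], a finite subcover, and half of the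
    smallest radius. *)
Lemma compact_margin (R : realType) n (K Omega : set 'cV[R]_n) :
  compact K -> open Omega -> K `<=` Omega ->
  exists2 d : R, 0 < d & forall k y, K k -> `|y| <= d -> Omega (k + y).
Proof.
move=> cK oO KO.
have /choice[r rP] : forall k, exists r : R, 0 < r /\ (K k -> ball k (2 * r) `<=` Omega).
  move=> k; have [Kk|Kk] := pselect (K k); last by exists 1; split.
  have /nbhs_ballP[e /= e0 eO] : nbhs k Omega.
    by apply: open_nbhs_nbhs; split => //; exact: KO.
  exists (e / 2); split => [|_]; first by rewrite divr_gt0.
  by rewrite mulrC divfK.
have [] := (_ : @cover_compact _ K) 'cV[R]_n K (fun k => ball k (r k)).
- by rewrite -compact_cover.
- by move=> y _; exact: ball_open.
- by move=> x Kx; exists x => //; apply: ballxx; case: (rP x).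
move=> D' D'K KD'; pose s : seq 'cV[R]_n := finmap.enum_fset D'.
pose d0 := \big[Num.min/1]_(k <- s) r k.
have d00 : 0 < d0 by apply: lt_bigmin => // k _; case: (rP k).
exists (d0 / 2); first by rewrite divr_gt0.
move=> k y Kk yd; have [k' /= k's kk'] := KD' k Kk.
have Kk' : K k' by have /set_mem := D'K _ k's.
apply: (proj2 (rP k') Kk'); move: kk'; rewrite -!ball_normE/= => kk'.
rewrite opprD addrA (le_lt_trans (ler_normB _ _))// mulr2n mulrDl mul1r ltrD//.
have dr : d0 <= r k' by apply: (@ge_bigmin_seq _ _ _ _ _ k' xpredT r).
have rk' : 0 < r k' by case: (rP k').
by apply: le_lt_trans yd _; rewrite ltr_pdivrMr// mulrC; lra.
Qed.

(** * Blow-up of the mollified field at 0 *)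

Section blow_up.
Context (R : realType) (m n : nat) (p : R) (G : set 'M[R]_n) (D : set 'cV[R]_n).
Variable alpha : ('cV[R]_n -> 'cV[R]_m) -> set 'cV[R]_n -> R.
Hypotheses (p1 : 1 < p) (GSO : subgroup_of_SO G) (core : core_functional p G D alpha).
Hypotheses (D_bounded : bounded_set D) (D_open : open D).
Hypothesis lsc : forall D', copies G D setT D' -> lsc_on_Lp p (fun v => alpha v D').
Variables (u : 'cV[R]_n -> 'cV[R]_m) (K : set 'cV[R]_n) (phi : 'cV[R]_n -> R)
  (g : 'cV[R]_n -> 'cV[R]_n).
Hypotheses (lu : in_Lploc p u) (ker : C11_kernel K phi g).
Let mu := lebesgue_cV R n.

Let p0 : 0 < p. Proof. exact: lt_trans p1. Qed.
Let lui i : Lqloc p (fun x => u x i 0). Proof. by move/(in_LplocP p0) : lu; exact. Qed.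
Let lui1 i : Lqloc 1 (fun x => u x i 0). Proof. exact: Lqloc1 (ltW p1) (lui i). Qed.

Definition corr_vec (x : 'cV[R]_n) : 'cV[R]_m := \col_i corr (fun z => u z i 0) phi x.

(** The integral of [u g^T], which is minus the differential of [corr_vec] at 0. *)
Definition corr_grad : 'M[R]_(m, n) :=
  \matrix_(i, j) corr (fun z => u z i 0) (fun z => g z j 0) 0.

Lemma corr_vec_continuous i : continuous (fun x => corr_vec x i 0).
Proof.
rewrite (_ : (fun x => _) = corr (fun z => u z i 0) phi).
  exact: corr_continuous ker (lui1 i).
by apply/funext => x; rewrite mxE.
Qed.

Lemma similarity_continuous (e : R) A (h : 'cV[R]_n) : continuous (similarity e A h).
Proof.
apply: (@lipschitz_continuous _ _ _ _ (`|e| * (n%:R * `|A|))) => x y.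
rewrite /similarity opprD addrACA subrr addr0 -scalerBr -mulmxBr normrZ.
by rewrite -mulrA ler_wpM2l// norm_mulmx_le.
Qed.

(** Taylor's formula at [h] costs [|y|^2], and exchanging the gradient at [h] for the one at 0 costs
    [|h| |y|]. Relative to [|y|] the error is small uniformly in [h] near 0, so all small copies
    near 0 are treated at once. *)
Lemma corr_vec_expansion : exists2 C : R, 0 <= C & forall (h y : 'cV[R]_n) i,
  `|h| <= 1 -> `|y| <= 1 ->
  `|corr_vec (y + h) i 0 - corr_vec h i 0 + (corr_grad *m y) i 0| <=
    C * (`|y| * (`|y| + `|h|)).
Proof.
have /choice[C CP] : forall i, exists C : R, 0 <= C /\
    forall x x' : 'cV[R]_n, `|x| <= 2 -> `|x'| <= 2 ->
   `|corr (fun z => u z i 0) phi x - corr (fun z => u z i 0) phi x' +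
     \sum_j corr (fun z => u z i 0) (fun z => g z j 0) x' * (x - x') j 0| <=
       C * `|x - x'| ^+ 2 /\
   forall j, `|corr (fun z => u z i 0) (fun z => g z j 0) x -
               corr (fun z => u z i 0) (fun z => g z j 0) x'| <= C * `|x - x'|.
  by move=> i; have [C C0 CP] := corr_C11 ker (lui1 i) (ler0n R 2); exists C.
pose C' := \sum_i C i.
have CC' i : C i <= C'.
  by rewrite /C' (bigD1 i)//= lerDl sumr_ge0// => j _; case: (CP j).
have C'0 : 0 <= C' by apply: sumr_ge0 => j _; case: (CP j).
exists (C' * (n%:R + 1)); first by rewrite mulr_ge0// addr_ge0.
move=> h y i h1 y1; have [Ci0 CPi] := CP i.
have le2 (x : 'cV[R]_n) : `|x| <= 1 -> `|x| <= 2 by move=> /le_trans; apply; rewrite ler1n.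
have yh2 : `|y + h| <= 2 by rewrite (le_trans (ler_normD _ _))// -[2]/(1 + 1) lerD.
have zero2 : `|0 : 'cV[R]_n| <= 2 by rewrite normr0.
have [H1 _] := CPi (y + h) h yh2 (le2 _ h1).
have [_ H2] := CPi h 0 (le2 _ h1) zero2.
pose S1 := \sum_j corr (fun z => u z i 0) (fun z => g z j 0) h * y j 0.
have E1 : \sum_j corr (fun z => u z i 0) (fun z => g z j 0) h * (y + h - h) j 0 = S1.
  by rewrite addrK.
rewrite E1 addrK in H1.
have -> : corr_vec (y + h) i 0 - corr_vec h i 0 + (corr_grad *m y) i 0 =
    (corr_vec (y + h) i 0 - corr_vec h i 0 + S1) + ((corr_grad *m y) i 0 - S1).
  by ring.
apply: le_trans (ler_normD _ _) _.
apply: (@le_trans _ _ (C i * `|y| ^+ 2 + n%:R * (C i * `|h| * `|y|))).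
  apply: lerD; first by rewrite !mxE.
  rewrite mxE /S1 -sumrB; apply: le_trans (ler_norm_sum _ _ _) _.
  apply: (@le_trans _ _ (\sum_(j < n) (C i * `|h| * `|y|))); last first.
    by rewrite sumr_const card_ord mulr_natl.
  apply: ler_sum => j _; rewrite mxE -mulrBl normrM ler_pM// ?coord_le_norm//.
  by have := H2 j; rewrite subr0 distrC.
have y0 := normr_ge0 y; have h0 := normr_ge0 h.
have n0 := ler0n R n.
have CyC : C i * (`|y| * (`|y| + n%:R * `|h|)) <= C' * (`|y| * (`|y| + n%:R * `|h|)).
  by apply: ler_wpM2r => //; rewrite mulr_ge0// addr_ge0// mulr_ge0.
apply: le_trans (_ : C i * (`|y| * (`|y| + n%:R * `|h|)) <= _).
  by rewrite le_eqVlt; apply/orP; left; apply/eqP; ring.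
apply: le_trans CyC _; rewrite -mulrA; apply: ler_wpM2l => //.
rewrite mulrCA; apply: ler_wpM2l => //.
have ny0 : 0 <= n%:R * `|y| by rewrite mulr_ge0.
by rewrite mulrDl mul1r mulrDr; lra.
Qed.

(* If [corr_grad] is not annihilated by the rotated copy of [D], then every
   small copy of [D] near the origin carries a fixed share of energy of
   [corr_vec], because [corr_vec] is close to an affine map there. *)
Lemma alpha_blow_up A (a : R) : G A ->
  a < alpha (fun x => (corr_grad *m A) *m x) D ->
  exists2 r0 : R, 0 < r0 & forall (e : R) (h : 'cV[R]_n), 0 < e -> e <= r0 -> `|h| <= r0 ->
    e `^ p * a < alpha corr_vec (similarity e A h @` D).
Proof.
move=> GA aD; have cD := copies_ref D GSO.
have lin (M : 'M[R]_(m, n)) := in_Lploc_linear p0 M.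
(* The sign is that of the differential of [corr_vec]; the energy is even, so it is unchanged. *)
pose v0 (x : 'cV[R]_n) := (-1) *: ((corr_grad *m A) *m x).
have lv0 : in_Lploc p v0 by exact: (in_LplocZ p0 (-1) (lin _)).
have av0 : a < alpha v0 D.
  by have := alphaZ core (-1) (lin (corr_grad *m A)) cD; rewrite normrN1 powR1 mul1r => ->.
have [eta eta0 etaP] := alpha_lsc_local p1 GSO core D_open D_bounded cD (lsc cD) lv0 av0.
have [r r_gt0 Dr] := ex_strict_bound_gt0 D_bounded.
have mD : measurable D by exact: open_cV_measurable.
have muD : (mu D < +oo)%E.
  apply: le_lt_trans (cball_lty n r); apply: le_measure; rewrite ?inE//.
    exact: measurable_cball.
  by move=> x /Dr/ltW.
pose M := fine (mu D) + 1.
have M0 : 0 < M by rewrite ltr_wpDl// fine_ge0.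
have muM : (mu D <= M%:E)%E.
  rewrite -(@fineK _ (mu D)) ?lee_fin ?lerDl//.
  by rewrite ge0_fin_numE// measure_ge0.
(* A uniform distance at most [kappa] on [D] keeps the integral of its [p]-th power within the
   tolerance [eta] of lower semicontinuity. *)
pose kappa := (eta / M) `^ p^-1.
have kappa0 : 0 < kappa by rewrite powR_gt0// divr_gt0.
have kappaE : kappa `^ p * M = eta.
  rewrite /kappa -powRrM mulVf ?gt_eqF// powRr1 ?divfK ?gt_eqF//.
  by rewrite divr_ge0 ?ltW.
have [C C0 CP] := corr_vec_expansion.
pose L := n%:R * `|A| * r + 1.
have L1 : 1 <= L by rewrite lerDr !mulr_ge0// ltW.
have L0 : 0 < L by exact: lt_le_trans L1.
have AL x : D x -> `|A *m x| <= L.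
  move=> /Dr xr; apply: le_trans (norm_mulmx_le _ _) _.
  by rewrite /L (le_trans (ler_wpM2l _ (ltW xr)))// ?mulr_ge0// lerDl.
pose T := C * L * (L + 1) + 1.
have L0' := ltW L0.
have T0 : 0 < T by rewrite ltr_wpDl// !mulr_ge0// addr_ge0.
(* The bound [L^-1] keeps [h] and [e A x] at norm at most 1, where the expansion holds; [kappa / T]
   makes its error at most [e kappa]. *)
exists (Num.min L^-1 (kappa / T)).
  by rewrite lt_min invr_gt0 L0 divr_gt0.
move=> e h e0; rewrite !le_min => /andP[eL eT] /andP[hL hT].
have cFD := copies_similarity D h e0 GA.
have lv : in_Lploc p corr_vec.
  by apply: in_Lploc_continuous => //; exact: corr_vec_continuous.
rewrite -(alpha_comp core h lv cD e0 GA).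
(* The difference quotient of [corr_vec] on the reference set [D], uniformly close there to the
   linear map [v0]. *)
pose w (y : 'cV[R]_n) := e^-1 *: (corr_vec (similarity e A h y) + - corr_vec h).
have lvF : in_Lploc p (corr_vec \o similarity e A h).
  apply: in_Lploc_continuous => // i y.
  apply: (@continuous_comp _ _ _ (similarity e A h) (fun x => corr_vec x i 0)).
    exact: similarity_continuous.
  exact: corr_vec_continuous.
have lw : in_Lploc p w.
  have lsum : in_Lploc p (fun y => corr_vec (similarity e A h y) + - corr_vec h).
    by apply: (in_LplocD p0); [exact: lvF|exact: in_Lploc_cst].
  exact: (in_LplocZ p0 e^-1 lsum).
have aw : a < alpha w D.
  apply: (etaP _ lw) => i.
  apply: (@le_trans _ _ (\int[mu]_(x in D) (cst (kappa `^ p)%:E x))%E).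
    apply: ge0_le_integral.
    - exact: mD.
    - by move=> x _; rewrite lee_fin powR_ge0.
    - apply: measurable_funTS; apply: measurable_normr_powR; apply: measurable_funB.
        by case: lw => + _; exact.
      by case: lv0 => + _; exact.
    - exact: measurable_cst.
    move=> x Dx; rewrite lee_fin; apply: ler_powRl => //; first exact: ltW.
    have Ax := AL x Dx.
    have eAx : `|e *: (A *m x)| <= e * L.
      by rewrite normrZ gtr0_norm// ler_wpM2l// ltW.
    have h1 : `|h| <= 1 by apply: le_trans hL _; rewrite invf_le1.
    have eL1 : e * L <= 1 by rewrite -ler_pdivlMr// mul1r.
    have := CP h (e *: (A *m x)) i h1 (le_trans eAx eL1).
    have -> : w x i 0 - v0 x i 0 = e^-1 * (corr_vec (e *: (A *m x) + h) i 0 -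
        corr_vec h i 0 + (corr_grad *m (e *: (A *m x))) i 0).
      have wE : w x i 0 = e^-1 * (corr_vec (e *: (A *m x) + h) i 0 - corr_vec h i 0).
        by rewrite /w mxE [X in _ * X]mxE [X in _ + X]mxE.
      have v0E : v0 x i 0 = - ((corr_grad *m A) *m x) i 0 by rewrite /v0 mxE mulN1r.
      have gE : (corr_grad *m (e *: (A *m x))) i 0 = e * ((corr_grad *m A) *m x) i 0.
        by rewrite -scalemxAr mulmxA mxE.
      by rewrite wE v0E gE opprK [RHS]mulrDr mulrA mulVf ?gt_eqF// mul1r.
    rewrite normrM gtr0_norm ?invr_gt0// => H.
    rewrite ler_pdivrMl//; apply: le_trans H _.
    have Y0 := normr_ge0 (e *: (A *m x)); have h0 := normr_ge0 h.
    apply: (@le_trans _ _ (C * (e * L * (e * L + `|h|)))).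
      by apply: ler_wpM2l => //; apply: ler_pM => //; exact: lerD.
    apply: (@le_trans _ _ (C * (e * L * (kappa / T * L + kappa / T)))).
      apply: ler_wpM2l => //; apply: ler_wpM2l; first by rewrite mulr_ge0 ?ltW.
      by apply: lerD => //; apply: ler_wpM2r => //; exact: ltW.
    rewrite (_ : _ * _ = e * kappa * (C * L * (L + 1) / T)); last by ring.
    have ek0 : 0 <= e * kappa by rewrite mulr_ge0 ?(ltW e0) ?(ltW kappa0).
    by rewrite ler_piMr// ler_pdivrMr// mul1r lerDl.
  rewrite integral_cst//; apply: (@le_trans _ _ ((kappa `^ p)%:E * M%:E)%E).
    by apply: lee_wpmul2l => //; rewrite lee_fin powR_ge0.
  by rewrite -EFinM kappaE.
have -> : corr_vec \o similarity e A h = (fun x => e *: w x + corr_vec h).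
  apply/funext => x; rewrite /w scalerA mulfV ?gt_eqF// scale1r subrK//.
rewrite (alphaD_cst core (corr_vec h) (in_LplocZ p0 e lw) cD).
by rewrite (alphaZ core e lw cD) gtr0_norm// ltr_pM2l// powR_gt0.
Qed.

End blow_up.

Lemma limf_einf_ge (R : realType) (T : choiceType) (X : filteredType T)
    (f : X -> \bar R) (F : set (set X)) (c : \bar R) :
  F [set x | (c <= f x)%E] -> (c <= limf_einf f F)%E.
Proof.
move=> Fc; rewrite limf_einfE; apply: ereal_sup_ge.
exists (ereal_inf (f @` [set x | (c <= f x)%E])); first by exists [set x | (c <= f x)%E].
by apply: le_ereal_inf_tmp => _ [x cx <-].
Qed.

(** * Energy of the mollified field against the seminorm of the field *)

Section mollified_energy.
Context (R : realType) (m n : nat) (p : R) (G : set 'M[R]_n) (D : set 'cV[R]_n).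
Variable alpha : ('cV[R]_n -> 'cV[R]_m) -> set 'cV[R]_n -> R.
Hypotheses (p1 : 1 < p) (GSO : subgroup_of_SO G) (core : core_functional p G D alpha).
Hypotheses (D_bounded : bounded_set D) (D_open : open D).
Hypothesis lsc : forall D', copies G D setT D' -> lsc_on_Lp p (fun v => alpha v D').
Variables (u : 'cV[R]_n -> 'cV[R]_m) (K : set 'cV[R]_n) (phi : 'cV[R]_n -> R)
  (g : 'cV[R]_n -> 'cV[R]_n).
Hypotheses (lu : in_Lploc p u) (ker : C11_kernel K phi g).
Let mu := lebesgue_cV R n.

Let p0 : 0 < p. Proof. exact: lt_trans p1. Qed.
Let lui i : Lqloc p (fun x => u x i 0). Proof. by move/(in_LplocP p0) : lu; exact. Qed.

(* [corr_vec u phi] is an L^p limit of combinations of the translates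
   [u (_ + y)] with [y] in [K] and total weight at most [S]; by convexity its
   energy on a disjoint family is at most [S^p] times the seminorm of [u]. *)
Lemma bmo_eps_ge_corr (I : finType) (h : I -> 'cV[R]_n) A (e b S : R) Omega :
  0 < e -> G A -> D !=set0 ->
  (forall i k, K k -> similarity e A (h i + k) @` D `<=` Omega) ->
  (forall i j x x', D x -> D x' -> similarity e A (h i) x = similarity e A (h j) x' -> i = j) ->
  0 < S -> (\int[mu]_y (`|phi y|)%:E <= S%:E)%E ->
  (forall i, b < alpha (corr_vec u phi) (similarity e A (h i) @` D)) ->
  ((e `^ (n%:R - p) * (#|I|%:R * b))%:E <=
    (S `^ p)%:E * bmo_eps p G D alpha Omega u e)%E.
Proof.
move=> e0 GA [x0 Dx0] DO Ddisj S0 phiS bD.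
have [boo|bfin] := eqVneq (bmo_eps p G D alpha Omega u e) +oo%E.
  by rewrite boo gt0_muley ?leey// lte_fin powR_gt0.
have b_ge0 := bmo_eps_ge0 p G D alpha u Omega e.
have bE : bmo_eps p G D alpha Omega u e = (fine (bmo_eps p G D alpha Omega u e))%:E.
  by rewrite fineK// ge0_fin_numE// lt_neqAle bfin leey.
set beta := fine _ in bE; have beta0 : 0 <= beta by rewrite -lee_fin -bE.
have cD i := copies_similarity D (h i) e0 GA.
have lv : in_Lploc p (corr_vec u phi).
  by apply: (in_Lploc_continuous p0) => i; exact: (corr_vec_continuous p1 lu ker).
(* Only finitely many copies are involved, so one tolerance [eta0] serves them all, and [corr_vec]
   can be replaced by a finite combination [w] of translates with energy still above [b] on each
   copy. *)
have /choice[eta etaP] : forall i, exists eta : R, 0 < eta /\ forall w, in_Lploc p w ->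
    (forall l, \int[mu]_(x in similarity e A (h i) @` D)
       (`|w x l 0 - corr_vec u phi x l 0| `^ p)%:E <= eta%:E)%E ->
    b < alpha w (similarity e A (h i) @` D).
  move=> i; have [eta eta0 H] :=
    alpha_lsc_local p1 GSO core D_open D_bounded (cD i) (lsc (cD i)) lv (bD i).
  by exists eta; split.
have /choice[rr rP] : forall i, exists r : R,
    open (similarity e A (h i) @` D) /\ similarity e A (h i) @` D `<=` cball n r.
  move=> i; have [oDi [r _ Dr]] := copies_open_bounded GSO D_open D_bounded (cD i).
  by exists r.
pose r := \sum_i `|rr i|.
have rrr i : rr i <= r.
  by apply: le_trans (ler_norm _) _; rewrite /r (bigD1 i)//= lerDl sumr_ge0.
pose eta0 := \big[Num.min/1]_i eta i.
have eta00 : 0 < eta0 by apply: lt_bigmin => // i _; case: (etaP i).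
have etai i : eta0 <= eta i by apply: (@ge_bigmin_seq _ _ _ _ _ i xpredT eta); rewrite ?mem_index_enum.
have [cK K0 [B HB] _] := ker.
have mphi := kernel_measurable ker.
have [N [c [y [yK cS approx]]]] := corr_approx r (ltW p1) (ltW S0) eta00 cK mphi
  (fun y Ky => proj1 (K0 y Ky)) (fun y => proj1 (HB y)) phiS lui.
pose ut j (x : 'cV[R]_n) := u (x + y j).
have lut j : in_Lploc p (ut j) by exact: (in_Lploc_shift p0 (y j) lu).
pose w (x : 'cV[R]_n) := \sum_j c j *: ut j x.
have lw : in_Lploc p w by exact: (in_Lploc_sum p0 c lut).
have bw i : b < alpha w (similarity e A (h i) @` D).
  apply: (proj2 (etaP i) w lw) => l.
  have [oDi Dr] := rP i.
  apply: le_trans (_ : (eta0%:E <= _)%E); last by rewrite lee_fin.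
  apply: le_trans (approx l).
  have mDi := open_cV_measurable oDi.
  have mdiff : measurable_fun setT
      (fun x => (`|corr (fun z => u z l 0) phi x - \sum_j c j * u (x + y j)%R l 0| `^ p)%:E).
    apply: measurable_normr_powR; apply: measurable_funB.
      by apply: continuous_cV_measurable; exact: corr_continuous ker (Lqloc1 (ltW p1) (lui l)).
    apply: measurable_sum => j; apply: measurable_funM => //.
    exact: (@measurable_fun_shift R n _ _ (fun z => u z l 0) (y j) (proj1 (lui l))).
  apply: (@le_trans _ _ (\int[mu]_(x in similarity e A (h i) @` D)
      (`|corr (fun z => u z l 0) phi x - \sum_j c j * u (x + y j)%R l 0| `^ p)%:E)%E).
    rewrite le_eqVlt; apply/orP; left; apply/eqP; apply: eq_integral => x _.
    congr (_%:E); congr (_ `^ p); rewrite distrC; congr `|_|; congr (_ - _).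
      by rewrite mxE.
    by rewrite /w summxE; apply: eq_bigr => j _; rewrite mxE.
  apply: ge0_subset_integral.
  - exact: mDi.
  - exact: measurable_cball.
  - exact: measurable_funTS.
  - by move=> x _; rewrite lee_fin powR_ge0.
  - by apply: subset_trans Dr _; exact: cball_le.
(* Translating [u] by [y j] amounts to translating the copies: for each [j] they form a disjoint
   family in [Omega], which the seminorm of [u] controls. *)
pose Fj j i := similarity e A (h i + y j) @` D.
have utE j i : alpha (ut j) (similarity e A (h i) @` D) = alpha u (Fj j i).
  have -> : ut j = u \o similarity 1 1%:M (y j).
    by apply/funext => x /=; rewrite similarityE scale1r.
  rewrite (alpha_comp core (y j) lu (cD i) ltr01 (subgroup1 GSO)); congr alpha.
  apply/seteqP; split=> [_ [_ [x Dx <-] <-]|_ [x Dx <-]].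
    by exists x => //; rewrite similarity_comp mul1r scale1r.
  exists (similarity e A (h i) x); first by exists x.
  by rewrite similarity_comp mul1r scale1r.
have FjD j i k : Fj j i `&` Fj j k !=set0 -> i = k.
  move=> [z [[x Dx xz] [x' Dx' x'z]]]; apply: (Ddisj i k x x' Dx Dx').
  by apply: (addIr (y j)); move: xz x'z; rewrite /similarity !addrA => -> ->.
have FjI j : injective (Fj j).
  move=> i k E; apply: (FjD j); rewrite -E setIid.
  by exists (similarity e A (h i + y j) x0), x0.
have Fjb j : e `^ (n%:R - p) * \sum_i alpha u (Fj j i) <= beta.
  rewrite -lee_fin -bE; apply: (bmo_eps_ge_fin core e0 lu _ (FjD j) (@FjI j)) => i.
  split; first by exists A, (h i + y j).
  by apply: DO; exact: yK.
have key : #|I|%:R * b <= S `^ p * \sum_j `|c j| / S * \sum_i alpha u (Fj j i).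
  apply: (@le_trans _ _ (\sum_i alpha w (similarity e A (h i) @` D))).
    rewrite mulr_natl -sumr_const; apply: ler_sum => i _; exact: ltW (bw i).
  apply: (@le_trans _ _ (\sum_i S `^ p * \sum_j `|c j| / S * alpha u (Fj j i))).
    apply: ler_sum => i _; apply: le_trans (alpha_comb p1 core (cD i) lut S0 cS) _.
    rewrite le_eqVlt; apply/orP; left; apply/eqP; congr (_ * _).
    by apply: eq_bigr => j _; rewrite utE.
  rewrite -mulr_sumr exchange_big/= le_eqVlt; apply/orP; left; apply/eqP.
  by congr (_ * _); apply: eq_bigr => j _; rewrite mulr_sumr.
have en0 := powR_ge0 e (n%:R - p).
rewrite bE -EFinM lee_fin; apply: le_trans (ler_wpM2l en0 key) _.
rewrite mulrCA; apply: ler_wpM2l; first exact: powR_ge0.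
rewrite mulr_sumr; apply: (@le_trans _ _ (\sum_j `|c j| / S * beta)).
  apply: ler_sum => j _; rewrite mulrCA; apply: ler_wpM2l; last exact: Fjb.
  by rewrite divr_ge0// ltW.
by rewrite -mulr_suml -mulr_suml; apply: ler_piMl => //; rewrite ler_pdivrMr// mul1r.
Qed.

(** On a grid of step [e L] in the cube of radius [r1] there are [N ^ n] disjoint copies, each with
    energy above [e ^ p a]. Weighted by [e ^ (n - p)], their sum is at least [(e N) ^ n a], which is
    bounded below independently of [e], against the vanishing lower limit. *)
Lemma kernel_rot_null Omega : open Omega -> K `<=` Omega ->
  bmo_liminf p G D alpha Omega u = 0%E -> rot_null G D alpha (corr_grad u g).
Proof.
move=> oO KO lim0 A GA; apply/eqP/negPn/negP => aN.
have lA := in_Lploc_linear p0 (corr_grad u g *m A).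
have D0 := alpha_neq0_nonempty p1 GSO core lA aN.
have a_gt0 : 0 < alpha (fun x => (corr_grad u g *m A) *m x) D.
  by rewrite lt_neqAle eq_sym aN/= (alpha_ge0 core lA (copies_ref D GSO)).
set aD := alpha _ D in a_gt0; pose a := aD / 2.
have a0 : 0 < a by rewrite divr_gt0.
have aaD : a < aD by rewrite /a; lra.
have [r0 r00 blow] := alpha_blow_up p1 GSO core D_bounded D_open lsc lu ker GA aaD.
have [cK K0 _ _] := ker.
have [d d0 dP] := compact_margin cK oO KO.
have [r r_gt0 Dr] := ex_strict_bound_gt0 D_bounded.
(* More than twice the norm of any [A x] with [x] in [D], so that copies centred at different points
   of the grid of step [e L] are disjoint. *)
pose L := 2 * (n%:R * `|A| * r) + 1.
have L0' : 0 <= n%:R * `|A| * r by rewrite !mulr_ge0// ltW.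
have L0 : 0 < L by rewrite ltr_wpDl// mulr_ge0.
have AL x : D x -> `|A *m x| <= n%:R * `|A| * r.
  move=> /Dr xr; apply: le_trans (norm_mulmx_le _ _) _.
  by apply: ler_wpM2l (ltW xr); rewrite mulr_ge0.
(* [r0] is the range of the blow-up; [d / 2] leaves room around the centre, so that a copy
   translated by a point of [K] stays in [Omega]. *)
pose r1 := Num.min r0 (d / 2).
have r10 : 0 < r1 by rewrite lt_min r00 divr_gt0.
have r1r0 : r1 <= r0 by rewrite ge_min lexx.
have r1d : r1 <= d / 2 by rewrite ge_min lexx orbT.
have phi_int : (\int[mu]_y (`|phi y|)%:E < +oo)%E by have /integrableP[] := kernel_integrable ker.
pose S := fine (\int[mu]_y (`|phi y|)%:E) + 1.
have phi_ge0 : (0 <= \int[mu]_y (`|phi y|)%:E)%E by apply: integral_ge0 => x _; rewrite lee_fin.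
have S0 : 0 < S by rewrite ltr_wpDl// fine_ge0.
have phiS : (\int[mu]_y (`|phi y|)%:E <= S%:E)%E.
  by rewrite -[leLHS]fineK ?ge0_fin_numE// lee_fin lerDl.
have Sp0 : 0 < S `^ p by exact: powR_gt0.
(* The lower bound for [(e N) ^ n a] given by [e N >= r1 / (2 L)], divided by the constant of
   [bmo_eps_ge_corr]. *)
pose c0 := (r1 / (2 * L)) ^+ n * a / S `^ p.
have c00 : 0 < c0 by rewrite !(divr_gt0, mulr_gt0, exprn_gt0).
suff : (c0%:E <= bmo_liminf p G D alpha Omega u)%E.
  by rewrite lim0 lee_fin leNgt c00.
apply: limf_einf_ge; near=> e.
have e0 : 0 < e by near: e; exact: nbhs_right_gt.
have er0 : e <= r0 by near: e; exact: nbhs_right_le.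
have eL2 : e <= r1 / (2 * L).
  by near: e; apply: nbhs_right_le; rewrite divr_gt0// mulr_gt0.
have eL0 : 0 < e * L by rewrite mulr_gt0.
have eLr : e * L <= r1 / 2.
  by rewrite -ler_pdivlMr// (le_trans eL2)// invfM mulrA.
pose N := Num.trunc (r1 / (e * L)).
have /andP[Nt tN] : N%:R <= r1 / (e * L) < N.+1%:R.
  by apply: truncn_itv; rewrite divr_ge0 ?ltW.
have NeL : e * L * N%:R <= r1 by rewrite mulrC -ler_pdivlMr.
have eN : r1 / (2 * L) <= e * N%:R.
  rewrite ler_pdivrMr ?mulr_gt0//.
  have : r1 < e * L * (N%:R + 1) by rewrite natr1 mulrC -ltr_pdivrMr.
  rewrite mulrDr mulr1 => H.
  rewrite (_ : e * N%:R * (2 * L) = 2 * (e * L * N%:R)); last by ring.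
  by lra.
pose h (z : {ffun 'I_n -> 'I_N}) : 'cV[R]_n := \col_i (e * L * (z i)%:R).
have h_le z : `|h z| <= r1.
  apply/(cV_norm_leP _ (ltW r10)) => i; rewrite mxE ger0_norm; last by rewrite (mulr_ge0 (ltW eL0)).
  by apply: le_trans NeL; rewrite (ler_wpM2l (ltW eL0))// ler_nat ltnW.
have hO : forall z k, K k -> similarity e A (h z + k) @` D `<=` Omega.
  move=> z k Kk _ [x Dx <-]; rewrite /similarity [h z + k]addrC addrCA; apply: dP => //.
  apply: le_trans (ler_normD _ _) _; rewrite normrZ gtr0_norm//.
  have /(ler_wpM2l (ltW e0)) H := AL x Dx.
  have := h_le z; have : e * (n%:R * `|A| * r) <= e * L.
    by apply: ler_wpM2l; rewrite ?(ltW e0)// /L mulr2n mulrDl mul1r -addrA lerDl addr_ge0.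
  by lra.
have hdisj : forall z z' x x', D x -> D x' ->
    similarity e A (h z) x = similarity e A (h z') x' -> z = z'.
  move=> z z' x x' Dx Dx' E; apply/ffunP => i; apply/val_inj/eqP.
  have Ei : L * ((z i)%:R - (z' i)%:R) = (A *m x') i 0 - (A *m x) i 0.
    have := congr1 (fun v : 'cV[R]_n => v i 0) E.
    have hi v w : similarity e A (h v) w i 0 = e * (A *m w) i 0 + e * L * (v i)%:R.
      by rewrite /similarity mxE [X in X + _]mxE [X in _ + X]mxE.
    rewrite !hi => H; apply: (mulfI (lt0r_neq0 e0)).
    by rewrite [RHS]mulrBr mulrA [LHS]mulrBr; lra.
  have a1 := le_trans (coord_le_norm _ i) (AL x Dx).
  have a2 := le_trans (coord_le_norm _ i) (AL x' Dx').
  have : `|L * ((z i)%:R - (z' i)%:R)| < L * 1.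
    rewrite Ei mulr1; apply: le_lt_trans (ler_normB _ _) _.
    by rewrite /L; lra.
  rewrite normrM gtr0_norm// ltr_pM2l// => H.
  rewrite eq_sym; move: H; rewrite ltr_norml => /andP[].
  rewrite ltrBrDr ltrBlDr => H1 H2.
  case: ltngtP => // zz.
    have : (z' i)%:R + 1 <= (z i)%:R :> R by rewrite natr1 ler_nat.
    by lra.
  have : (z i)%:R + 1 <= (z' i)%:R :> R by rewrite natr1 ler_nat.
  by lra.
have := bmo_eps_ge_corr e0 GA D0 hO hdisj S0 phiS
  (fun z => blow e (h z) e0 er0 (le_trans (h_le z) r1r0)).
rewrite -lee_pdivrMl ?powR_gt0//; apply: le_trans.
rewrite -EFinM lee_fin mulrC /c0; apply: ler_wpM2r; first by rewrite invr_ge0 ltW.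
rewrite card_ffun !card_ord natrX.
rewrite (_ : _ * _ = (e `^ (n%:R - p) * e `^ p) * N%:R ^+ n * a); last by ring.
rewrite -powRD; last by rewrite lt0r_neq0 ?implybT.
rewrite subrK powR_mulrn ?(ltW e0)// -exprMn; apply: ler_wpM2r (ltW a0) _ _ _.
apply: lerXn2r => //; rewrite nnegrE; first by rewrite divr_ge0 ?mulr_ge0 ?ltW.
by rewrite mulr_ge0 ?(ltW e0).
Unshelve. all: by end_near. Qed.

End mollified_energy.

(** * Test functions are C^{1,1} kernels *)

Section test_functions.
Context (R : realType) (n : nat).
Implicit Types (f : 'cV[R]_n -> R) (K : set 'cV[R]_n).

Lemma partial_mvt f (j : 'I_n) (b : 'cV[R]_n) (s : R) :
  (forall x, derivable f x (delta_mx j 0)) ->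
  exists2 t : R, `|t| <= `|s| &
    f (b + s *: delta_mx j 0) - f b = partial j f (b + t *: delta_mx j 0) * s.
Proof.
move=> df; pose d : 'cV[R]_n := delta_mx j 0; pose F (t : R) : R := f (b + t *: d).
have FD (t : R) : is_derive t (1 : R) F (partial j f (b + t *: d)).
  have E : (fun h : R => h^-1 *: ((F \o shift t) (h *: 1) - F t)) =
      (fun h : R => h^-1 *: ((f \o shift (b + t *: d)) (h *: d) - f (b + t *: d))).
    apply/funext => h /=; rewrite /F; congr (_ *: (f _ - _)).
    by rewrite scalerDl [h *: 1]mulr1 addrCA.
  have := df (b + t *: d); rewrite /derivable -E => dF.
  by apply: DeriveDef; [exact: dF|rewrite /partial /derive -E].
have Fc (c e : R) : {within `[c, e], continuous F}.
  apply: derivable_within_continuous => x _; exact: (@ex_derive _ _ _ _ _ _ _ (FD x)).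
have F0 : F 0 = f b by rewrite /F scale0r addr0.
have [s0|s0] := leP 0 s.
  have [t] := MVT_segment s0 (fun x _ => FD x) (Fc 0 s).
  rewrite in_itv/= => /andP[t0 ts]; rewrite F0 subr0 => E.
  by exists t; rewrite ?ger0_norm.
have [t] := MVT_segment (ltW s0) (fun x _ => FD x) (Fc s 0).
rewrite in_itv/= => /andP[ts t0]; rewrite F0 sub0r => E.
exists t; first by rewrite ler0_norm// ltr0_norm// lerN2.
by rewrite -opprB E mulrN opprK.
Qed.

(** [smooth] speaks of iterated partial derivatives only. Changing one coordinate at a time
    telescopes the increment into one-dimensional mean values, and the intermediate points stay
    within [|h|] of [a] in the maximum norm. *)
Lemma coordinatewise_mvt f (a h : 'cV[R]_n) :
  (forall j x, derivable f x (delta_mx j 0)) ->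
  exists c : 'I_n -> 'cV[R]_n, (forall k, `|c k - a| <= `|h|) /\
    f (a + h) - f a = \sum_k partial k f (c k) * h k 0.
Proof.
move=> df; pose hk (k : nat) : 'cV[R]_n := \col_i (if (i < k)%N then h i 0 else 0).
have hkS (k : 'I_n) : hk k.+1 = hk k + h k 0 *: delta_mx k 0.
  apply/colP => i; rewrite !mxE eqxx andbT ltnS leq_eqVlt.
  have [->|ik] := eqVneq i k; first by rewrite eqxx ltnn/= mulr1 add0r.
  by rewrite (negbTE (_ : nat_of_ord i != k))//= mulr0 addr0.
have /choice[t tP] : forall k : 'I_n, exists t : R, `|t| <= `|h k 0| /\
    f (a + hk k.+1) - f (a + hk k) = partial k f (a + hk k + t *: delta_mx k 0) * h k 0.
  move=> k; have [t t1 t2] := partial_mvt (a + hk k) (h k 0) (df k).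
  by exists t; split => //; rewrite hkS addrA.
exists (fun k : 'I_n => a + hk k + t k *: delta_mx k 0); split => [k|].
  rewrite -(addrA a) [a + _]addrC addrK; apply/(cV_norm_leP _ (normr_ge0 h)) => i.
  rewrite !mxE eqxx andbT; have [->|ik] := eqVneq i k.
    by rewrite ltnn add0r mulr1 (le_trans (proj1 (tP k)))// coord_le_norm.
  by rewrite mulr0 addr0; case: ifP => _; rewrite ?normr0// coord_le_norm.
have -> : a + h = a + hk n.
  by congr (_ + _); apply/colP => i; rewrite mxE ltn_ord.
have -> : f a = f (a + hk 0%N).
  by congr f; rewrite -[LHS]addr0; congr (_ + _); apply/colP => i; rewrite !mxE.
rewrite -(telescope_sumr (fun k => f (a + hk k)) (leq0n n)) big_mkord.
by apply: eq_bigr => k _; case: (tP k).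
Qed.

Lemma partial_eq0 K f j : closed K -> (forall x, ~ K x -> f x = 0) ->
  forall x, ~ K x -> partial j f x = 0.
Proof.
move=> cK f0 x Kx; rewrite /partial (@near_eq_derive _ _ _ f (cst 0) x).
  by rewrite derive_cst.
have : nbhs x (~` K) by apply: open_nbhs_nbhs; split => //; exact: closed_openC.
by apply: filterS => y /f0 ->.
Qed.

Lemma compact_support_bounded K f : compact K -> continuous f ->
  (forall x, ~ K x -> f x = 0) -> exists2 B : R, 0 <= B & forall x, `|f x| <= B.
Proof.
move=> cK cf f0.
have /compact_bounded/ex_strict_bound_gt0[B B0 HB] : compact (f @` K).
  by apply: continuous_compact => //; exact: continuous_subspaceT.
exists B; first exact: ltW.
move=> x; have [Kx|/f0 ->] := pselect (K x); last by rewrite normr0 ltW.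
by apply/ltW/HB; exists x.
Qed.

Lemma bounded_partials_lipschitz f (B : R) : 0 <= B ->
  (forall j x, derivable f x (delta_mx j 0)) -> (forall j x, `|partial j f x| <= B) ->
  forall a h, `|f (a + h) - f a| <= n%:R * B * `|h|.
Proof.
move=> B0 df fB a h; have [c [_ ->]] := coordinatewise_mvt a h df.
apply: le_trans (ler_norm_sum _ _ _) _.
apply: (@le_trans _ _ (\sum_(k < n) (B * `|h|))).
  by apply: ler_sum => k _; rewrite normrM ler_pM// coord_le_norm.
by rewrite sumr_const card_ord -mulrA mulr_natl.
Qed.

(** Compact support bounds the second partials, so the first ones are Lipschitz; inserted in the
    coordinatewise mean value formula, this makes the Taylor error quadratic. *)
Lemma test_function_kernel (Omega : set 'cV[R]_n) (phi : 'cV[R]_n -> R) : test_function Omega phi ->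
  C11_kernel (closure [set x | phi x != 0]) phi (grad phi).
Proof.
move=> [sphi cK _]; set K := closure _ in cK *.
have clK : closed K by exact: closed_closure.
have phi0 x : ~ K x -> phi x = 0.
  move=> Kx; apply: contra_notP Kx => /eqP px; exact: subset_closure.
have d0 j x : derivable phi x (delta_mx j 0) by have [_] := sphi [::]; exact.
have d1 i j x : derivable (partial i phi) x (delta_mx j 0).
  by have [_] := sphi [:: i]; exact.
have p0 j x : ~ K x -> partial j phi x = 0 by exact: partial_eq0.
have pp0 i j x : ~ K x -> partial j (partial i phi) x = 0.
  by apply: partial_eq0 => // y; exact: p0.
have [B B0 HB] := compact_support_bounded cK (proj1 (sphi [::])) phi0.
have /choice[B1 B1P] : forall j, exists B : R, 0 <= B /\ forall x, `|partial j phi x| <= B.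
  move=> j; have [B' B'0 H] := compact_support_bounded cK (proj1 (sphi [:: j])) (p0 j).
  by exists B'.
have /choice[B2 B2P] : forall ij : 'I_n * 'I_n, exists B : R, 0 <= B /\
    forall x, `|partial ij.2 (partial ij.1 phi) x| <= B.
  move=> [i j] /=.
  have [B' B'0 H] := compact_support_bounded cK (proj1 (sphi [:: j; i])) (pp0 i j).
  by exists B'.
pose C1 := \sum_j B1 j; pose C2 := \sum_ij B2 ij.
have C10 : 0 <= C1 by apply: sumr_ge0 => j _; case: (B1P j).
have C20 : 0 <= C2 by apply: sumr_ge0 => j _; case: (B2P j).
have H1 j x : `|partial j phi x| <= C1.
  apply: le_trans (proj2 (B1P j) x) _; rewrite /C1 (bigD1 j)//= lerDl.
  by apply: sumr_ge0 => k _; case: (B1P k).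
have H2 i j x : `|partial j (partial i phi) x| <= C2.
  apply: le_trans (proj2 (B2P (i, j)) x) _; rewrite /C2 (bigD1 (i, j))//= lerDl.
  by apply: sumr_ge0 => k _; case: (B2P k).
have lip i := bounded_partials_lipschitz C20 (d1 i) (H2 i).
have nC20 : 0 <= n%:R * C2 by rewrite mulr_ge0.
split=> //.
- move=> x Kx; split; first exact: phi0.
  by apply/colP => j; rewrite !mxE p0.
- exists (B + C1) => x; split; first by rewrite (le_trans (HB x))// lerDl.
  apply/(cV_norm_leP _ (addr_ge0 B0 C10)) => i; rewrite mxE.
  by rewrite (le_trans (H1 i x))// lerDr.
- exists (n%:R * C2 + n%:R * (n%:R * C2)); first by rewrite addr_ge0// mulr_ge0.
  move=> a h; split.
    have [c [ca ->]] := coordinatewise_mvt a h d0.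
    rewrite -sumrB; apply: le_trans (ler_norm_sum _ _ _) _.
    apply: (@le_trans _ _ (\sum_(k < n) (n%:R * C2 * `|h| * `|h|))).
      apply: ler_sum => k _; rewrite mxE -mulrBl normrM ler_pM ?coord_le_norm//.
      have := lip k a (c k - a); rewrite subrKC => /le_trans; apply.
      by rewrite ler_wpM2l.
    rewrite sumr_const card_ord -[leLHS]mulr_natl mulrDl.
    rewrite (_ : n%:R * _ = n%:R * (n%:R * C2) * `|h| ^+ 2); last by ring.
    by rewrite lerDr mulr_ge0// sqr_ge0.
  rewrite mulrDl; apply: (@le_trans _ _ (n%:R * C2 * `|h|)); last first.
    by rewrite lerDl !mulr_ge0.
  have H0 : 0 <= n%:R * C2 * `|h| by rewrite mulr_ge0.
  by apply/(cV_norm_leP _ H0) => i; rewrite !mxE; exact: lip.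
Qed.

End test_functions.

(** * Pairing with the operators D_L *)

Section kernel_pairing.
Context (R : realType) (m n : nat) (p : R).
Variables (L : 'M[R]_(m, n) -> 'M[R]_(m, n)).
Hypothesis L_comb : forall a A A', L (a *: A + A') = a *: L A + L A'.
Variables (u : 'cV[R]_n -> 'cV[R]_m) (K : set 'cV[R]_n) (phi : 'cV[R]_n -> R)
  (g : 'cV[R]_n -> 'cV[R]_n).
Hypotheses (p1 : 1 < p) (lu : in_Lploc p u) (ker : C11_kernel K phi g).
Let mu := lebesgue_cV R n.

Let p0 : 0 < p. Proof. exact: lt_trans p1. Qed.

Let L0 : L 0 = 0.
Proof.
have := L_comb 1 0 0; rewrite scaler0 addr0 scale1r.
by move/(congr1 (fun X => X - L 0)); rewrite addrK subrr.
Qed.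

Let L_sum (I : Type) (s : seq I) (c : I -> R) (A : I -> 'M[R]_(m, n)) :
  L (\sum_(k <- s) c k *: A k) = \sum_(k <- s) c k *: L (A k).
Proof.
elim: s => [|k s IH]; first by rewrite !big_nil.
by rewrite !big_cons L_comb IH.
Qed.

Let L_delta A : L A = \sum_(kl : 'I_m * 'I_n) A kl.1 kl.2 *: L (delta_mx kl.1 kl.2).
Proof.
rewrite {1}[A]matrix_sum_delta pair_bigA/=.
exact: (L_sum _ (fun kl => A kl.1 kl.2) (fun kl => delta_mx kl.1 kl.2)).
Qed.

(** Expanded on matrix units, the linear map [L] becomes a finite sum of scalar integrals and
    commutes with integration. The integrand vanishes outside [K], so [Omega] can be replaced by the
    whole space. *)
Lemma Rintegral_pairing Omega i j : K `<=` Omega ->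
  \int[mu]_(x in Omega) (L (u x *m (g x)^T) i j) = L (corr_grad u g) i j.
Proof.
move=> KO; have [_ K0 _ _] := ker.
have lu1 k : Lqloc 1 (fun x => u x k 0).
  by move/(in_LplocP p0) : lu => H; exact: Lqloc1 (ltW p1) (H k).
pose F (kl : 'I_m * 'I_n) (x : 'cV[R]_n) : R :=
  L (delta_mx kl.1 kl.2) i j * (u x kl.1 0 * g x kl.2 0).
have iF kl : mu.-integrable setT (EFin \o F kl).
  have [_ H] := kernel_integrable_mul ker (lu1 kl.1).
  have := integrableZl measurableT (L (delta_mx kl.1 kl.2) i j) (H kl.2).
  by congr (_.-integrable _ _).
rewrite Rintegral_mkcond.
transitivity (\int[mu]_x (\sum_kl F kl x)).
  apply: eq_Rintegral => x _; rewrite patchE; case: ifPn => [_|/negP xO].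
    rewrite L_delta summxE; apply: eq_bigr => kl _.
    by rewrite mxE mulrC mxE big_ord1 mxE.
  have gx : g x = 0.
    by apply: (proj2 (K0 x _)) => /KO xO'; apply: xO; rewrite inE.
  by rewrite big1// => kl _; rewrite /F gx mxE !mulr0.
rewrite (proj2 (Rintegral_sum _ iF)) [in RHS]L_delta summxE.
apply: eq_bigr => kl _; rewrite [RHS]mxE [RHS]mulrC [X in _ * X]mxE /corr.
have [_ H] := kernel_integrable_mul ker (lu1 kl.1).
rewrite (RintegralZl _ measurableT (H kl.2)); congr (_ * _).
by apply: eq_Rintegral => x _; rewrite subr0.
Qed.

End kernel_pairing.

Lemma DL_kernel (R : realType) m n (p : R) (L : 'M[R]_(m, n) -> 'M[R]_(m, n)) Omega u phi :
  (forall a A A', L (a *: A + A') = a *: L A + L A') ->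
  1 < p -> in_Lploc p u -> test_function Omega phi ->
  DL L Omega u phi = - L (corr_grad u (grad phi)).
Proof.
move=> LD p1 lu tphi; apply/matrixP => i j; rewrite !mxE; congr (- _).
case: (tphi) => _ _ KO.
exact: (Rintegral_pairing LD p1 lu (test_function_kernel tphi) i j KO).
Qed.

(** * An explicit bump *)

Section bump_kernel.
Context (R : realType) (n : nat).
Let mu := lebesgue_cV R n.

Let sq (x : 'cV[R]_n) : R := \sum_i x i 0 ^+ 2.
Let dot (x y : 'cV[R]_n) : R := \sum_i x i 0 * y i 0.
Let trunc (t : R) : R := Num.max 0 (1 - t).

(** With [sq] the squared Euclidean norm, this is the square of the positive part of [1 - |x|^2];
    squaring makes the gradient Lipschitz across the unit sphere. *)
Definition bump_fun (x : 'cV[R]_n) : R := trunc (sq x) ^+ 2.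
Definition bump_fun_grad (x : 'cV[R]_n) : 'cV[R]_n := (- 4 * trunc (sq x)) *: x.

Let sq_ge0 x : 0 <= sq x. Proof. by apply: sumr_ge0 => i _; exact: sqr_ge0. Qed.

Let sq_le x : sq x <= n%:R * `|x| ^+ 2.
Proof.
apply: (@le_trans _ _ (\sum_(i < n) `|x| ^+ 2)); last first.
  by rewrite sumr_const card_ord mulr_natl.
apply: ler_sum => i _; rewrite -real_normK ?num_real//.
by apply: lerXn2r; rewrite ?nnegrE// coord_le_norm.
Qed.

Let dot_le x y : `|dot x y| <= n%:R * (`|x| * `|y|).
Proof. exact: ler_sum_coord. Qed.

Let sqD x y : sq (x + y) = sq x + (2 * dot x y + sq y).
Proof.
rewrite /sq /dot mulr_sumr -!big_split/=; apply: eq_bigr => i _.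
by rewrite mxE; ring.
Qed.

Let trunc_ge0 t : 0 <= trunc t. Proof. by rewrite le_max lexx. Qed.

Let trunc_le1 t : 0 <= t -> trunc t <= 1.
Proof. by move=> t0; rewrite ge_max ler01 lerBlDr lerDl. Qed.

Let trunc0 t : 1 <= t -> trunc t = 0.
Proof. by move=> t1; apply/max_idPl; rewrite subr_le0. Qed.

Let trunc_sq0 x : 1 < `|x| -> trunc (sq x) = 0.
Proof.
move=> x1; apply: trunc0.
have /existsNP[i /negP] : ~ forall i, `|x i 0| <= 1.
  by move=> H; move: x1; rewrite ltNge => /negP; apply; apply/(cV_norm_leP _ ler01).
rewrite -ltNge => xi; rewrite /sq (bigD1 i)//= -[leLHS]addr0 lerD//.
  by rewrite -real_normK ?num_real// exprn_ege1// ltW.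
by apply: sumr_ge0 => j _; exact: sqr_ge0.
Qed.

Let trunc_lip t t' : `|trunc t' - trunc t| <= `|t' - t|.
Proof.
rewrite /trunc; have [] := leP 0 (1 - t); have [] := leP 0 (1 - t') => h1 h2.
- by rewrite (_ : _ - _ = t - t') 1?distrC//; ring.
- by rewrite sub0r normrN ger0_norm//; apply: le_trans (ler_norm _); lra.
- by rewrite subr0 ger0_norm// distrC; apply: le_trans (ler_norm _); lra.
- by rewrite subrr normr0.
Qed.

(** First-order expansion of the convex function [max(0, 1 - t)^2], with derivative
    [-2 max(0, 1 - t)]: the remainder is nonnegative by convexity, and the derivative has Lipschitz
    constant 2. *)
Let trunc2 t t' :
  0 <= trunc t' ^+ 2 - trunc t ^+ 2 + 2 * trunc t * (t' - t) <= (t' - t) ^+ 2.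
Proof.
rewrite /trunc; have [] := leP 0 (1 - t); have [] := leP 0 (1 - t') => h1 h2.
- rewrite (_ : _ + _ = (t' - t) ^+ 2); last by ring.
  by rewrite sqr_ge0 lexx.
- rewrite expr0n/= sub0r; apply/andP; split.
    have h3 : 0 <= 2 * (t' - t) - (1 - t) by lra.
    have := mulr_ge0 h2 h3; congr (0 <= _); ring.
  rewrite -subr_ge0; have := sqr_ge0 (1 - t'); congr (0 <= _); ring.
- rewrite expr0n/= subr0 mulr0 mul0r addr0 sqr_ge0/=.
  rewrite -[(t' - t) ^+ 2]sqrrN; apply: lerXn2r; rewrite ?nnegrE//; lra.
- by rewrite expr0n/= subrr mulr0 mul0r addr0 lexx sqr_ge0.
Qed.

Let bump_le1 x : 0 <= bump_fun x <= 1.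
Proof. by rewrite exprn_ge0//= exprn_ile1// trunc_le1. Qed.

Let grad_le x : trunc (sq x) * `|x| <= 1.
Proof.
have [x1|x1] := leP `|x| 1; last by rewrite trunc_sq0// mul0r.
by rewrite mulr_ile1// trunc_le1.
Qed.

Let grad_dot (a h : 'cV[R]_n) : \sum_j bump_fun_grad a j 0 * h j 0 = - 4 * trunc (sq a) * dot a h.
Proof. by rewrite mulr_sumr; apply: eq_bigr => j _; rewrite mxE mulrA. Qed.

Let far (a h : 'cV[R]_n) : 2 < `|a| -> `|h| <= 1 -> 1 < `|a + h|.
Proof.
move=> a2 h1; rewrite ltNge; apply/negP => ah.
have := ler_normB (a + h) h; rewrite addrK => ?.
by lra.
Qed.

(** Three regimes. For [|h| > 1] bounds on values and gradients suffice, as [|h| <= |h|^2]; for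
    [|h| <= 1] and [|a| > 2] everything vanishes; for [|a| <= 2] the expansion [trunc2] is applied
    to the increment [2 dot a h + sq h] of [sq], at most [5 n |h|] in modulus, hence the constant 25
    n^2. *)
Lemma bump_kernel : C11_kernel (cball n (1 : R)) bump_fun bump_fun_grad.
Proof.
have n0 : 0 <= n%:R :> R by exact: ler0n.
split.
- exact: compact_cball.
- by move=> x /negP; rewrite -ltNge => /trunc_sq0 s0; rewrite /bump_fun /bump_fun_grad s0 expr0n mulr0 scale0r.
- exists 4 => x; split.
    by have /andP[b0 b1] := bump_le1 x; rewrite ger0_norm// (le_trans b1)// ler1n.
  rewrite normrZ normrM (_ : `|-4| = 4 :> R); last by rewrite normrN ger0_norm.
  rewrite ger0_norm// -mulrA -[leRHS]mulr1 ler_wpM2l//.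
exists (25 * n%:R ^+ 2 + 4 * n%:R + 100 * (n%:R + 1)).
  by rewrite !addr_ge0// mulr_ge0// ?sqr_ge0// addr_ge0.
move=> a h; have ha := normr_ge0 h; have aa := normr_ge0 a.
have [h1|h1] := leP `|h| 1; last first.
  have hh2 : `|h| <= `|h| ^+ 2 by rewrite expr2 ler_peMl// ltW.
  have h2 : 1 <= `|h| ^+ 2 by rewrite (le_trans (ltW h1)).
  have nh2 : 0 <= n%:R * `|h| ^+ 2 by rewrite mulr_ge0// sqr_ge0.
  have nnh2 : 0 <= n%:R ^+ 2 * `|h| ^+ 2 by rewrite mulr_ge0// sqr_ge0.
  have nh : 0 <= n%:R * `|h| by rewrite mulr_ge0.
  have nnh : 0 <= n%:R ^+ 2 * `|h| by rewrite mulr_ge0// sqr_ge0.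
  split.
    rewrite grad_dot; have /andP[b0 b1] := bump_le1 a; have /andP[c0 c1] := bump_le1 (a + h).
    have E : `|trunc (sq a) * dot a h| <= n%:R * `|h|.
      rewrite normrM ger0_norm//.
      apply: le_trans (ler_wpM2l (trunc_ge0 _) (dot_le a h)) _.
      rewrite mulrCA ler_wpM2l// mulrA -[leRHS]mul1r ler_wpM2r//.
    apply: le_trans (ler_normB _ _) _.
    have : `|bump_fun (a + h) - bump_fun a| <= 1 by rewrite ler_norml; lra.
    rewrite -mulrA normrM (_ : `|-4| = 4 :> R); last by rewrite normrN ger0_norm.
    have : n%:R * `|h| <= n%:R * `|h| ^+ 2 by rewrite ler_wpM2l.
    rewrite !mulrDl mulrDr mulrDl -!mulrA; move: E; lra.
  apply: le_trans (ler_normB _ _) _.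
  have gb x : `|bump_fun_grad x| <= 4.
    rewrite normrZ normrM (_ : `|-4| = 4 :> R); last by rewrite normrN ger0_norm.
    by rewrite ger0_norm// -mulrA -[leRHS]mulr1 ler_wpM2l.
  have g1 := gb (a + h); have g2 := gb a.
  rewrite !mulrDl mulrDr mulrDl -!mulrA; lra.
have C0 : 0 <= 25 * n%:R ^+ 2 + 4 * n%:R + 100 * (n%:R + 1) :> R.
  by rewrite !addr_ge0// mulr_ge0// ?sqr_ge0// addr_ge0.
have [a2|a2] := leP `|a| 2; last first.
  have s0 : trunc (sq a) = 0 by apply: trunc_sq0; lra.
  have s1 : trunc (sq (a + h)) = 0 by apply: trunc_sq0; exact: far.
  split.
    rewrite grad_dot /bump_fun s0 s1 !expr0n/= mulr0 mul0r !subr0 normr0.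
    by rewrite mulr_ge0// sqr_ge0.
  by rewrite /bump_fun_grad s0 s1 mulr0 !scale0r subr0 normr0 mulr_ge0.
have hh2 : `|h| ^+ 2 <= `|h| by rewrite expr2 ler_piMl.
have d1 : `|2 * dot a h + sq h| <= 5 * n%:R * `|h|.
  apply: le_trans (ler_normD _ _) _; rewrite normrM ger0_norm// (ger0_norm (sq_ge0 h)).
  have t1 := dot_le a h; have t2 := sq_le h.
  have t3 : n%:R * (`|a| * `|h|) <= n%:R * (2 * `|h|) by rewrite ler_wpM2l// ler_wpM2r.
  have t4 : n%:R * `|h| ^+ 2 <= n%:R * `|h| by rewrite ler_wpM2l.
  rewrite -mulrA; lra.
have nh2 : 0 <= n%:R * `|h| ^+ 2 by rewrite mulr_ge0// sqr_ge0.
have nnh2 : 0 <= n%:R ^+ 2 * `|h| ^+ 2 by rewrite mulr_ge0// sqr_ge0.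
have nh : 0 <= n%:R * `|h| by rewrite mulr_ge0.
have nnh : 0 <= n%:R ^+ 2 * `|h| by rewrite mulr_ge0// sqr_ge0.
split.
  rewrite grad_dot; have := trunc2 (sq a) (sq (a + h)).
  rewrite sqD [sq a + _ - _]addrC addKr -/(bump_fun a).
  rewrite -sqD -/(bump_fun (a + h)).
  set X := 2 * dot a h + sq h in d1 *.
  have X2 : X ^+ 2 <= 25 * n%:R ^+ 2 * `|h| ^+ 2.
    rewrite -real_normK ?num_real// (_ : 25 * _ * _ = (5 * n%:R * `|h|) ^+ 2); last by ring.
    by apply: lerXn2r; rewrite ?nnegrE// !mulr_ge0.
  have T0 := trunc_ge0 (sq a); have T1 := trunc_le1 (sq_ge0 a).
  have ts0 : 0 <= trunc (sq a) * sq h by rewrite mulr_ge0.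
  have ts1 : trunc (sq a) * sq h <= n%:R * `|h| ^+ 2.
    by apply: le_trans (sq_le h); rewrite ler_piMl.
  rewrite (_ : 2 * trunc (sq a) * X = 4 * (trunc (sq a) * dot a h) + 2 * (trunc (sq a) * sq h)); last first.
    by rewrite /X; ring.
  rewrite -!mulrA => /andP[l1 l2]; rewrite ler_norml !mulrDl mulrDr mulrDl -!mulrA.
  have hh0 : 0 <= `|h| ^+ 2 by exact: sqr_ge0.
  move: X2; rewrite -!mulrA => X2.
  by apply/andP; split; lra.
rewrite /bump_fun_grad scalerDr addrAC -scalerBl -mulrBr.
apply: le_trans (ler_normD _ _) _. rewrite [`|_ *: a|]normrZ [`|_ *: h|]normrZ !normrM.
rewrite (_ : `|-4| = 4 :> R); last by rewrite normrN ger0_norm.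
rewrite (ger0_norm (trunc_ge0 _)) -!mulrA.
have T1 := trunc_le1 (sq_ge0 (a + h)).
have e1 : trunc (sq (a + h)) * `|h| <= `|h| by rewrite ler_piMl.
have e2 : `|trunc (sq (a + h)) - trunc (sq a)| * `|a| <= 5 * n%:R * `|h| * 2.
  apply: ler_pM => //; apply: le_trans (trunc_lip _ _) _.
  by rewrite sqD [sq a + _ - _]addrC addKr.
move: e2; rewrite !mulrDl mulrDr -!mulrA; lra.
Qed.

Lemma bump_ge0 x : 0 <= bump_fun x.
Proof. by case/andP: (bump_le1 x). Qed.

Lemma bump_mass_gt0 : 0 < \int[mu]_x bump_fun x.
Proof.
(* On the cube of radius [d] one has [sq x <= n d <= 1/2], so the bump is at least 1/4 there. *)
pose d : R := (2 * (n%:R + 1))^-1.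
have n1 : 1 <= n%:R + 1 :> R by rewrite lerDr.
have n10 : 0 < 2 * (n%:R + 1) :> R by rewrite mulr_gt0// ltr_wpDl.
have d0 : 0 < d by rewrite invr_gt0.
have d1 : d <= 1 by rewrite invf_le1// -[leLHS]mulr1 -[1 * 1]/(1 * 1 : R) ler_pM// ler1n.
have mb : measurable_fun setT bump_fun by exact: (kernel_measurable bump_kernel).
have ib := kernel_integrable bump_kernel.
have mball : measurable (ball (0 : 'cV[R]_n) d).
  by apply: open_cV_measurable; exact: ball_open.
rewrite -lte_fin; apply: (@lt_le_trans _ _ ((4^-1)%:E * mu (ball 0%R d))%E).
  by rewrite lebesgue_cV_ball// -EFinM lte_fin mulr_gt0// exprn_gt0// mulr_gt0.
rewrite -(integral_cst mu mball (4^-1)%:E) /Rintegral fineK; last first.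
  by apply: integrable_fin_num => //; exact: measurableT.
rewrite integral_mkcond; apply: ge0_le_integral.
- exact: measurableT.
- by move=> x _; rewrite patchE; case: ifP => _; rewrite ?lee_fin// invr_ge0.
- by apply/(measurable_restrictT _ mball); exact: measurable_cst.
- exact/measurable_EFinP.
move=> x _; rewrite patchE; case: ifPn => [/set_mem|_]; last by rewrite lee_fin bump_ge0.
rewrite -ball_normE/= sub0r normrN => /ltW xd; rewrite lee_fin.
have sd : sq x <= 2^-1.
  apply: le_trans (sq_le x) _.
  apply: (@le_trans _ _ (n%:R * d)).
    by rewrite ler_wpM2l// expr2 (le_trans _ xd)// ler_piMl// (le_trans xd).
  by rewrite /d ler_pdivrMr// mulrA mulVf// mul1r lerDl.
have -> : 4^-1 = (2^-1) ^+ 2 :> R by rewrite exprVn -natrX.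
apply: lerXn2r; rewrite ?nnegrE ?invr_ge0//.
by rewrite /trunc le_max; apply/orP; right; lra.
Qed.

End bump_kernel.

(** * From vanishing gradients to local constancy *)

Section local_constancy.
Context (R : realType) (n : nat).
Implicit Types (f v : 'cV[R]_n -> R) (r : R).
Let mu := lebesgue_cV R n.

(** Cutting the segment from 0 to [x] into [N + 1] equal pieces bounds the total increment by
    [C |x|^2 / (N + 1)], which tends to 0. *)
Lemma quadratic_modulus_constant v r (C : R) :
  (forall x x', `|x| <= r -> `|x'| <= r -> `|v x - v x'| <= C * `|x - x'| ^+ 2) ->
  forall x, `|x| <= r -> v x = v 0.
Proof.
move=> vC x xr; pose t N (k : nat) : 'cV[R]_n := (k%:R / N.+1%:R) *: x.
have key N : `|v x - v 0| <= C * `|x| ^+ 2 / N.+1%:R.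
  have tr k : (k <= N.+1)%N -> `|t N k| <= r.
    move=> kN; apply: le_trans xr; rewrite normrZ ger0_norm ?divr_ge0//.
    by rewrite ler_piMl// ler_pdivrMr// mul1r ler_nat.
  have -> : v x - v 0 = v (t N N.+1) - v (t N 0%N).
    by rewrite /t mul0r scale0r mulfV ?scale1r// pnatr_eq0.
  rewrite -(telescope_sumr (fun k => v (t N k)) (leq0n N.+1)) big_mkord.
  apply: le_trans (ler_norm_sum _ _ _) _.
  apply: (@le_trans _ _ (\sum_(k < N.+1) (C * (N.+1%:R^-1 * `|x|) ^+ 2))).
    apply: ler_sum => k _; apply: le_trans (vC _ _ (tr _ (ltn_ord k)) (tr _ (ltnW (ltn_ord k)))) _.
    rewrite /t -scalerBl -mulrBl -natrB// subSnn normrZ mul1r.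
    by rewrite (@ger0_norm _ (N.+1%:R^-1)) ?invr_ge0.
  rewrite sumr_const card_ord -[leLHS]mulr_natl le_eqVlt; apply/orP; left; apply/eqP.
  have : N.+1%:R != 0 :> R by rewrite pnatr_eq0.
  by move: (N.+1%:R : R) => y y0; field.
apply/eqP; rewrite -subr_eq0 -normr_eq0 eq_le normr_ge0 andbT leNgt.
apply/negP => a0; set a := `|_| in key a0.
have := key (Num.trunc (C * `|x| ^+ 2 / a)).
rewrite ler_pdivlMr// leNgt => /negP; apply.
have C0 : 0 <= C * `|x| ^+ 2 by have := vC x 0 xr; rewrite normr0 subr0 => H; apply: le_trans (H (le_trans _ xr)).
have /andP[_] := truncn_itv (divr_ge0 C0 (ltW a0)).
by rewrite ltr_pdivrMr// [X in _ < X -> _]mulrC.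
Qed.

(** The constant is the mean [a] of [f] over the cube: a constant [c] within [e / 2] of [f] in L^1
    is within [e / 2] of [a] as well, so [f] is within [e] of [a]. *)
Lemma ae_constant_cball f r : 0 < r -> Lqloc 1 f ->
  (forall e : R, 0 < e -> exists c : R,
    (\int[mu]_(x in cball n r) (`|f x - c|)%:E <= e%:E)%E) ->
  exists c, {ae mu, forall x, cball n r x -> f x = c}.
Proof.
move=> r0 lf H; pose A := cball n r; have mA : measurable A by exact: measurable_cball.
have mf : measurable_fun setT f by case: lf.
have iA : mu.-integrable A (EFin \o f) by exact: integrable_cball.
have icst (c : R) : mu.-integrable A (EFin \o cst c).
  exact: (@integrable_cball R n (cst c) r (Lqloc_cst n c ltr01)).
have ifc c : mu.-integrable A (EFin \o (fun x => f x - c)).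
  have := integrableB mA iA (icst c); congr (_.-integrable _ _).
have mA0 : 0 < fine (mu A).
  apply: fine_gt0; rewrite cball_lty andbT.
  apply: (@lt_le_trans _ _ (mu (ball (0 : 'cV[R]_n) r))).
    by rewrite lebesgue_cV_ball// lte_fin exprn_gt0// mulr_gt0.
  apply: le_measure; rewrite ?inE//.
    by apply: open_cV_measurable; exact: ball_open.
  by move=> x; rewrite -ball_normE/= sub0r normrN => /ltW.
pose a := (\int[mu]_(x in A) f x) / fine (mu A); exists a.
have mfa : measurable_fun A (EFin \o (fun x => f x - a)).
  by apply/measurable_EFinP/measurable_funTS; exact: measurable_funB.
suff : (\int[mu]_(x in A) `|(EFin \o (fun x => (f x - a)%R)) x| = 0)%E.
  move=> /(ae_eq_integral_abs mu mA mfa); apply: filterS => x fx Ax.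
  by have /eqP := fx Ax; rewrite eqe subr_eq0 => /eqP.
apply/eqP; rewrite eq_le integral_ge0 ?andbT//.
apply/lee_addgt0Pr => e e0; rewrite add0e.
have [c cP] := H (e / 2) (divr_gt0 e0 (ltr0n R 2)).
have iabs : mu.-integrable A (EFin \o (fun x => `|f x - c|)).
  by have := integrable_abse (ifc c); congr (_.-integrable _ _).
have cP' : \int[mu]_(x in A) `|f x - c| <= e / 2.
  by rewrite -lee_fin /Rintegral fineK//; apply: integrable_fin_num.
have ac : `|a - c| * fine (mu A) <= e / 2.
  apply: le_trans cP'; apply: le_trans (le_normr_Rintegral mA (ifc c)).
  rewrite (RintegralB mA iA (icst c)) (Rintegral_cst mu mA).
  rewrite (_ : \int[mu]_(x in A) f x = a * fine (mu A)); last by rewrite /a divfK// gt_eqF.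
  by rewrite -mulrBl normrM [X in _ <= _ * X]gtr0_norm.
apply: (@le_trans _ _ (\int[mu]_(x in A) ((`|f x - c|)%:E + (`|a - c|)%:E))%E).
  apply: ge0_le_integral.
  - exact: mA.
  - by move=> x _; exact: abse_ge0.
  - exact: measurableT_comp.
  - apply: emeasurable_funD; last exact: measurable_cst.
    by case/integrableP : iabs.
  - move=> x _; rewrite lee_fin (_ : f x - a = (f x - c) - (a - c)); last by ring.
    exact: ler_normB.
rewrite ge0_integralD; last 5 first.
- exact: mA.
- by move=> x _; rewrite lee_fin.
- by case/integrableP : iabs.
- by move=> x _; rewrite lee_fin.
- exact: measurable_cst.
have -> : (\int[mu]_(x in A) (`|a - c|)%:E = (`|a - c| * fine (mu A))%:E)%E.
  rewrite EFinM fineK; first exact: (integral_cst mu mA).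
  by rewrite ge0_fin_numE ?measure_ge0// cball_lty.
by rewrite [e in leRHS]splitr EFinD; apply: leeD.
Qed.

(** The mollification of [f] by a bump of radius [rho] has zero gradient on the cube, so by
    [corr_C11] its increments are quadratic and it is constant; divided by the mass [M] of the bump,
    it is close to [f] in L^1. *)
Lemma locally_constant f r : 0 < r -> Lqloc 1 f ->
  (forall K phi g, C11_kernel K phi g -> K `<=` cball n (2 * r) ->
    forall j, corr f (fun z => g z j 0) 0 = 0) ->
  exists c, {ae mu, forall x, cball n r x -> f x = c}.
Proof.
move=> r0 lf Hf; have mf : measurable_fun setT f by case: lf.
apply: ae_constant_cball => // e e0.
have M10 := bump_mass_gt0 R n; set M1 := \int[_]_x _ in M10.
have e1 : 0 < e / (M1 + 1) by rewrite divr_gt0// addr_gt0.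
have [d d0 dP] := Lqloc_shift_cvg ltr01 lf (r + r) e1.
(* [d] gives closeness of translates, [r] keeps the supports in the cube of radius [2 r], and 1
   gives [M <= M1], so that the final error [(M + 1) / (M1 + 1)] times [e] is at most [e]. *)
pose rho := Num.min d (Num.min r 1).
have rho0 : 0 < rho by rewrite !lt_min d0 r0 ltr01.
have rhod : rho <= d by rewrite ge_min lexx.
have rhor : rho <= r by rewrite !ge_min lexx orbT.
have rho1 : rho <= 1 by rewrite !ge_min lexx !orbT.
have irho : 0 < rho^-1 by rewrite invr_gt0.
pose K : set 'cV[R]_n := [set x | cball n 1 (rho^-1 *: x + 0)].
pose phi (x : 'cV[R]_n) := bump_fun (rho^-1 *: x + 0).
pose g (x : 'cV[R]_n) := rho^-1 *: bump_fun_grad (rho^-1 *: x + 0).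
have ker : C11_kernel K phi g by exact: (kernel_affine (bump_kernel R n) 0 irho).
have Krho x : K x -> `|x| <= rho.
  rewrite /K/= addr0 /cball/= normrZ gtr0_norm//.
  by rewrite ler_pdivrMl// mulr1.
have mphi := kernel_measurable ker.
have phi0 x : 0 <= phi x by exact: bump_ge0.
have [_ K0 _ _] := ker.
have phirho y : phi y != 0 -> `|y| <= rho.
  move=> py; apply: Krho; apply: contrapT => /K0[py0 _].
  by move: py; rewrite py0 eqxx.
pose M := \int[mu]_x phi x.
have ME : M = rho ^+ n * M1.
  have := Rintegral_affine 0 irho (kernel_measurable (bump_kernel R n)).
  by rewrite -exprVn invrK.
have M0 : 0 < M by rewrite ME mulr_gt0// exprn_gt0.
have MM1 : M <= M1 by rewrite ME ler_piMl ?(ltW M10)// exprn_ile1// ltW.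
have iphi := kernel_integrable ker.
have phiM : (\int[mu]_y (`|phi y|)%:E <= M%:E)%E.
  rewrite /M /Rintegral fineK; last by apply: integrable_fin_num => //; exact: measurableT.
  rewrite le_eqVlt; apply/orP; left; apply/eqP.
  by apply: eq_integral => y _; rewrite ger0_norm.
have vconst : forall x, `|x| <= r -> corr f phi x = corr f phi 0.
  have [C C0 HC] := corr_C11 ker lf (ltW r0).
  apply: (@quadratic_modulus_constant _ _ C) => x x' xr x'r.
  have [+ _] := HC x x' xr x'r; rewrite big1 ?addr0// => j _.
  suff -> : corr f (fun z => g z j 0) x' = 0 by rewrite mul0r.
  have Kr : [set z | K (z - x')] `<=` cball n (2 * r).
    move=> z /= /Krho zx; rewrite /cball/= -[z](subrK x').
    by rewrite (le_trans (ler_normD _ _))// mulr2n mulrDl mul1r lerD// (le_trans zx).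
  have <- := Hf _ _ _ (kernel_shift ker x') Kr j.
  by apply: eq_Rintegral => z _; rewrite subr0.
exists (corr f phi 0 / M).
have vE x : \int[mu]_y (phi y * (f (x + 0) - f (x + y))) = M * f x - corr f phi x.
  have lfx : Lqloc 1 (fun y => f (y + x)) by exact: Lqloc_shift.
  have [iprod _] := kernel_integrable_mul ker lfx.
  rewrite (corrE x mf mphi).
  transitivity (\int[mu]_y (f x * phi y - f (y + x) * phi y)).
    by apply: eq_Rintegral => y _; rewrite addr0 mulrBr ![phi y * _]mulrC [y + x]addrC.
  have ifphi : mu.-integrable setT (EFin \o (fun y => f x * phi y)).
    by have := integrableZl measurableT (f x) iphi; congr (_.-integrable _ _).
  rewrite (RintegralB measurableT ifphi iprod) (RintegralZl _ measurableT iphi) mulrC.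
  by congr (_ - _); apply: eq_Rintegral => y _; rewrite addrC.
have fdP h : `|h| <= rho -> (\int[mu]_(x in cball n (r + rho)%R)
    (`|f (x + h)%R - f x| `^ 1)%:E <= (e / (M1 + 1))%:E)%E.
  move=> hr; apply: le_trans (dP h (le_trans hr rhod)).
  apply: ge0_subset_integral.
  - exact: measurable_cball.
  - exact: measurable_cball.
  - apply: measurable_funTS; apply: measurable_normr_powR; apply: measurable_funB => //.
    exact: (@measurable_fun_shift R n _ _ f h mf).
  - by move=> x _; rewrite lee_fin powR_ge0.
  - by apply: cball_le; rewrite lerD2l.
have sgd y : phi y != 0 -> `|cst (0 : 'cV[R]_n) y - y| <= rho.
  by move=> py; rewrite /cst sub0r normrN phirho.
have H := @corr_error_le R n phi (cst 0) f 1 M r rho rho (e / (M1 + 1)) (lexx 1) (ltW M0)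
  (ltW e1) mphi phiM phirho (measurable_cst _) sgd mf fdP.
have mv : measurable_fun setT (corr f phi).
  by apply: continuous_cV_measurable; exact: corr_continuous ker lf.
apply: (@le_trans _ _ ((M^-1)%:E * \int[mu]_(x in cball n r)
   (`|\int[mu]_y (phi y * (f (x + 0)%R - f (x + y)%R))| `^ 1)%:E)%E).
  rewrite -ge0_integralZl; last 4 first.
  - exact: measurable_cball.
  - apply: measurable_funTS; apply: measurable_normr_powR.
    under eq_fun do rewrite vE.
    by apply: measurable_funB => //; exact: measurable_funM.
  - by move=> x _; rewrite lee_fin powR_ge0.
  - by rewrite lee_fin invr_ge0 ltW.
  rewrite le_eqVlt; apply/orP; left; apply/eqP; apply: eq_integral => x /set_mem xr.
  rewrite -EFinM vE powRr1// vconst//; congr (_%:E).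
  rewrite -[M^-1]gtr0_norm ?invr_gt0// -normrM mulrBr mulrA mulVf ?gt_eqF// mul1r.
  by rewrite [M^-1 * _]mulrC gtr0_norm// invr_gt0.
apply: le_trans (lee_wpmul2l _ H) _; first by rewrite lee_fin invr_ge0 ltW.
have M10' : 0 < M + 1 by rewrite addr_gt0.
rewrite -EFinM lee_fin powRr1 ?(ltW M10')//.
rewrite (_ : _ * _ = (M + 1) / (M1 + 1) * e); last first.
  by field; rewrite !gt_eqF// addr_gt0.
by rewrite ler_piMl ?(ltW e0)// ler_pdivrMr ?addr_gt0// mul1r lerD2r.
Qed.

End local_constancy.

(** * Constancy on connected open sets *)

Section constancy.
Context (R : realType) (n : nat).
Let mu := lebesgue_cV R n.

Lemma ae_shift (P : 'cV[R]_n -> Prop) (h : 'cV[R]_n) :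
  {ae mu, forall x, P (x + h)} -> {ae mu, forall x, P x}.
Proof.
move=> [A [mA A0 PA]]; exists [set x : 'cV[R]_n | A (x - h)]; split.
- exact: (measurable_shift (- h) mA).
- by rewrite -A0; exact: (lebesgue_cV_shift (- h) mA).
- by move=> x Px; apply: PA; rewrite /= subrK.
Qed.

Lemma ae_ball_ex (P : 'cV[R]_n -> Prop) (y : 'cV[R]_n) (s : R) : 0 < s ->
  {ae mu, forall z, ball y s z -> P z} -> exists2 z, ball y s z & P z.
Proof.
move=> s0 [A [mA A0 PA]]; apply: contrapT => N.
have bA : ball y s `<=` A.
  move=> z zs; apply: PA => /(_ zs) Pz; apply: N; by exists z.
have : (mu (ball y s) <= mu A)%E.
  by apply: le_measure; rewrite ?inE//; apply: open_cV_measurable; exact: ball_open.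
rewrite /mu lebesgue_cV_ball// A0 lee_fin leNgt => /negP; apply.
by rewrite exprn_gt0// mulr_gt0.
Qed.

(* The compact sets of points of [Omega] with norm at most [k] and distance at
   least [1/k] to the complement exhaust [Omega]. *)
Lemma ae_of_locally (P : 'cV[R]_n -> Prop) (Omega : set 'cV[R]_n) : open Omega ->
  (forall x, Omega x -> exists2 r : R, 0 < r &
     {ae mu, forall y, ball x r y -> P y}) ->
  {ae mu, forall x, Omega x -> P x}.
Proof.
move=> oO loc.
pose N (k : nat) : set 'cV[R]_n :=
  \bigcup_(y in ~` Omega) ball y k.+1%:R^-1.
pose C k : set 'cV[R]_n := cball n (k%:R : R) `&` ~` N k.
have cC k : compact (C k).
  apply: (@cV_compactP _ _ _ k%:R); last by move=> x [].
  apply: closedI; first by apply: compact_closed => //; exact: compact_cball.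
  by apply: open_closedC; apply: bigcup_open => y _; exact: ball_open.
have CO k : C k `<=` Omega.
  move=> x [_ xN]; apply: contrapT => xO; apply: xN; exists x => //.
  by apply: ballxx; rewrite invr_gt0.
have exhaust x : Omega x -> exists k, C k x.
  move=> Ox; have /nbhs_ballP[e /= e0 eO] : nbhs x Omega by exact: open_nbhs_nbhs.
  pose k := maxn (Num.trunc (e^-1)) (Num.trunc `|x|).+1; exists k; split.
    rewrite /cball/=; apply: (@le_trans _ _ (Num.trunc `|x|).+1%:R).
      by have /andP[_ /ltW] := truncn_itv (normr_ge0 x).
    by rewrite ler_nat leq_maxr.
  move=> [y yO yx]; apply: yO; apply: eO; apply: ball_sym; move: yx.
  apply: le_ball; rewrite -[leRHS]invrK lef_pV2 ?posrE ?invr_gt0//.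
  have ie0 : 0 <= e^-1 by rewrite invr_ge0 ltW.
  have /andP[_ /ltW/le_trans] := truncn_itv ie0; apply.
  by rewrite ler_nat ltnS leq_maxl.
have aeC k : {ae mu, forall x, C k x -> P x}.
  have /choice[r rP] : forall x, exists r : R, 0 < r /\
      (Omega x -> {ae mu, forall y, ball x r y -> P y}).
    move=> x; have [Ox|Ox] := pselect (Omega x); last by exists 1; split.
    by have [r r0 H] := loc x Ox; exists r.
  have [] := (_ : @cover_compact _ (C k)) 'cV[R]_n (C k) (fun x => ball x (r x)).
  - by rewrite -compact_cover.
  - by move=> y _; exact: ball_open.
  - by move=> x Cx; exists x => //; apply: ballxx; case: (rP x).
  move=> D' D'C CD'.
  have ae_seq (s : seq 'cV[R]_n) : {subset s <= C k} ->
      {ae mu, forall y i, i \in s -> ball i (r i) y -> P y}.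
    elim: s => [_|x s IH sC]; first exact: aeW.
    have Ox : Omega x by apply: (CO k); apply: set_mem; apply: sC; exact: mem_head.
    have sC' : {subset s <= C k} by move=> z zs; apply: sC; rewrite in_cons zs orbT.
    apply: filterS2 (proj2 (rP x) Ox) (IH sC') => y Hx Hs i.
    by rewrite in_cons => /predU1P[->|/Hs].
  apply: filterS (ae_seq (finmap.enum_fset D') D'C) => y yD' /CD'[i iD' iy].
  exact: (yD' i iD').
have := ae_foralln aeC; apply: filterS => x xC Ox.
by have [k] := exhaust x Ox; exact: xC.
Qed.

(** [rc] records at each point a radius and the local constant. If [y] lies in the ball of [x], the
    two balls share a set of positive measure, so the constants agree. Level sets of the local
    constant are therefore open, and each is closed in [Omega] as well; connectedness leaves only
    one. *)
Lemma ae_constant_connected (f : 'cV[R]_n -> R) (Omega : set 'cV[R]_n) :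
  open Omega -> connected Omega -> Lqloc 1 f ->
  (forall K phi g, C11_kernel K phi g -> K `<=` Omega ->
    forall j, corr f (fun z => g z j 0) 0 = 0) ->
  exists c, {ae mu, forall x, Omega x -> f x = c}.
Proof.
move=> oO cO lf Hf; have mf : measurable_fun setT f by case: lf.
have [EO|/set0P[x0 Ox0]] := eqVneq Omega set0.
  by exists 0; apply: aeW => x; rewrite EO.
have /choice[rc rcP] : forall x, exists rc : R * R, Omega x ->
    [/\ 0 < rc.1, ball x rc.1 `<=` Omega &
        {ae mu, forall y, ball x rc.1 y -> f y = rc.2}].
  move=> x; have [Ox|Ox] := pselect (Omega x); last by exists (0, 0).
  have /nbhs_ballP[e /= e0 eO] : nbhs x Omega by exact: open_nbhs_nbhs.
  pose r := e / 4; have r0 : 0 < r by rewrite divr_gt0.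
  have re : 2 * r < e by rewrite /r; lra.
  have lfx : Lqloc 1 (fun y => f (y + x)) by exact: Lqloc_shift.
  have [|c cP] := locally_constant r0 lfx.
    (* Correlating the translate of [f] with [g] amounts to correlating [f] with the kernel moved by
       [x], whose support lies in [Omega] because [2 r < e]. *)
    move=> K phi g ker Kr j; have kx := kernel_shift ker x.
    have KO : [set z | K (z - x)] `<=` Omega.
      move=> z /Kr zx; apply: eO; rewrite -ball_normE/= distrC.
      by apply: le_lt_trans re.
    rewrite -[RHS](Hf _ _ _ kx KO j) /corr.
    rewrite -[RHS](Rintegral_shift x); last first.
      apply: measurable_funM => //.
      under eq_fun do rewrite subr0.
      exact: (kernel_grad_measurable kx).
    by apply: eq_Rintegral => z _; rewrite !subr0 addrK.
  exists (r, c) => _; split => //=.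
    by apply: subset_trans eO; apply: le_ball; apply: le_trans (ltW re); rewrite ler_peMl ?(ltW r0)// ler1n.
  apply: (ae_shift (h := x)); apply: filterS cP => y H; rewrite -ball_normE/=.
  have -> : x - (y + x) = - y by rewrite [y + x]addrC opprD addrA subrr sub0r.
  by rewrite normrN => /ltW; exact: H.
have overlap x y : Omega x -> Omega y -> ball x (rc x).1 y -> (rc y).2 = (rc x).2.
  move=> Ox Oy xy; have [rx _ aex] := rcP x Ox; have [ry _ aey] := rcP y Oy.
  have /nbhs_ballP[s /= s0 sx] : nbhs y (ball x (rc x).1).
    by apply: open_nbhs_nbhs; split => //; exact: ball_open.
  pose t := Num.min s (rc y).1; have t0 : 0 < t by rewrite lt_min s0.
  have [|z zt [<- <-]//] := @ae_ball_ex (fun z => f z = (rc y).2 /\ f z = (rc x).2) y t t0.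
  apply: filterS2 aex aey => z zx zy zt; split.
    by apply: zy; apply: le_ball zt; rewrite ge_min lexx orbT.
  by apply: zx; apply: sx; apply: le_ball zt; rewrite ge_min lexx.
pose A := [set y | Omega y /\ (rc y).2 = (rc x0).2].
have open_level (B : set R) : open [set y | Omega y /\ B (rc y).2].
  rewrite openE => y [Oy By]; have [ry bO _] := rcP y Oy.
  apply/nbhs_ballP; exists (rc y).1 => // z yz; have Oz := bO z yz.
  by split=> //; rewrite (overlap y z).
have AE : A = Omega.
  apply: cO; first by exists x0.
    by exists A; [exact: (open_level [set (rc x0).2])|apply/seteqP; split=> [y|y []//] /= [Oy cy]].
  exists (~` [set y | Omega y /\ (rc y).2 <> (rc x0).2]).
    by apply: open_closedC; exact: (open_level (~` [set (rc x0).2])).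
  apply/seteqP; split=> [y [Oy cy]|y [Oy cy]]; split=> //.
    by case.
  by apply: contrapT => N; apply: cy.
exists (rc x0).2; apply: ae_of_locally => // x Ox; have [r0 _ H] := rcP x Ox.
exists (rc x).1 => //; have : A x by rewrite AE.
by case=> _ <-.
Qed.

End constancy.

(** Change of variable: the Jacobian gives [e ^- n], and the factor [e] cancels the [e^-1] in the
    gradient of the rescaled kernel. *)
Lemma corr_grad_affine (R : realType) m n (p : R) (u : 'cV[R]_n -> 'cV[R]_m) K phi
    (g : 'cV[R]_n -> 'cV[R]_n) (e : R) (h : 'cV[R]_n) :
  1 < p -> in_Lploc p u -> C11_kernel K phi g -> 0 < e ->
  corr_grad (fun x => u (e *: x + h)) g =
  (e ^- n * e) *: corr_grad u (fun z => e^-1 *: g (e^-1 *: z + - (e^-1 *: h))).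
Proof.
move=> p1 lu ker e0; apply/matrixP => i j; rewrite !mxE.
have ie0 : 0 < e^-1 by rewrite invr_gt0.
have ker' := kernel_affine ker (- (e^-1 *: h)) ie0.
have lu1 : Lqloc 1 (fun x => u x i 0).
  by move/(in_LplocP (lt_trans ltr01 p1)) : lu => H; exact: Lqloc1 (ltW p1) (H i).
pose F (z : 'cV[R]_n) := u z i 0 * (e^-1 *: g (e^-1 *: z + - (e^-1 *: h))) j 0.
have [_ /(_ j) iF] := kernel_integrable_mul ker' lu1.
have mF : measurable_fun setT (fun z => e * F z).
  by apply: measurable_funM => //; apply/measurable_EFinP; case/integrableP : iF.
have := Rintegral_affine h e0 mF.
rewrite (RintegralZl _ measurableT iF) mulrA /corr => E.
transitivity (\int[lebesgue_cV R n]_x (e * F (e *: x + h))).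
  apply: eq_Rintegral => x _; rewrite /F subr0 mxE mulrCA; congr (_ * _).
  rewrite mulrA mulfV ?gt_eqF// mul1r scalerDr scalerA mulVf ?gt_eqF// scale1r.
  by rewrite addrK.
rewrite E; congr (_ * _); apply: eq_Rintegral => z _.
by rewrite subr0.
Qed.

Lemma opnorm0 (R : realType) m n : opnorm (0 : 'M[R]_(m, n)) = 0.
Proof.
rewrite /opnorm (_ : [set _ | _ in _] = [set 0]) ?sup1//.
apply/seteqP; split=> [_ [x _ <-]|_ ->]; first by rewrite mul0mx enorm0.
by exists 0; rewrite ?mul0mx ?enorm0//= enorm0 ler01.
Qed.

(** * Vanishing of the projected derivative and its consequences *)

Section consequences.
Context (R : realType) (m n : nat) (p : R) (G : set 'M[R]_n) (D : set 'cV[R]_n).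
Variable alpha : ('cV[R]_n -> 'cV[R]_m) -> set 'cV[R]_n -> R.
Hypotheses (p1 : 1 < p) (GSO : subgroup_of_SO G) (core : core_functional p G D alpha).
Hypotheses (D_bounded : bounded_set D) (D_open : open D).
Hypothesis lsc : forall D', copies G D setT D' -> lsc_on_Lp p (fun v => alpha v D').
Variables (Omega : set 'cV[R]_n) (u : 'cV[R]_n -> 'cV[R]_m).
Hypotheses (Omega_open : open Omega) (lu : in_Lploc p u).
Hypothesis lim0 : bmo_liminf p G D alpha Omega u = 0%E.

Let p0 : 0 < p. Proof. exact: lt_trans p1. Qed.
Let N := psi_null p G D alpha.

Lemma kernel_psi_null K phi (g : 'cV[R]_n -> 'cV[R]_n) : C11_kernel K phi g ->
  K `<=` Omega -> N (corr_grad u g).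
Proof.
move=> ker KO; rewrite /N (psi_nullE p1 GSO core D_bounded).
exact: (kernel_rot_null p1 GSO core D_bounded D_open lsc lu ker Omega_open KO lim0).
Qed.

Let N_comb (a : R) A A' : N A -> N A' -> N (a *: A + A').
Proof.
rewrite /N (psi_nullE p1 GSO core D_bounded).
exact: (rot_null_comb p1 GSO core).
Qed.

Let N0 : N 0.
Proof.
rewrite /N (psi_nullE p1 GSO core D_bounded) => B GB.
transitivity (alpha (fun _ => 0) D).
  by congr alpha; apply/funext => x; rewrite !mul0mx.
exact: (alpha_cst p1 core _ (copies_ref D GSO)).
Qed.

(** The composition with a homothety lets one statement serve the first claim, with [e = 1] and
    [h = 0], and the strong case, where a copy in [Omega] is pulled back to [D]. The rescaled kernel
    is supported in [Omega], so its pairing with [u] is a null matrix. *)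
Lemma DL_proj_along_affine (P : {vspace 'M[R]_(m, n)}) U (e : R) (h : 'cV[R]_n) :
  direct_sum P N -> 0 < e -> (forall x, U x -> Omega (e *: x + h)) ->
  DL_eq0 (proj_along P N) U (fun x => u (e *: x + h)).
Proof.
move=> PN e0 UO phi tphi; have ie0 : 0 < e^-1 by rewrite invr_gt0.
have luF := in_Lploc_affine p0 h e0 lu.
rewrite (DL_kernel (proj_along_comb N_comb PN) p1 luF tphi).
have ker := test_function_kernel tphi; have [_ _ KU] := tphi.
rewrite (corr_grad_affine h p1 lu ker e0) (proj_along_null PN) ?oppr0//.
rewrite -[X in N X]addr0; apply: N_comb N0.
apply: kernel_psi_null (kernel_affine ker (- (e^-1 *: h)) ie0) _ => z /= Kz.
have -> : z = e *: (e^-1 *: z - e^-1 *: h) + h.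
  by rewrite scalerBr !scalerA mulfV ?gt_eqF// !scale1r subrK.
exact: UO (KU _ Kz).
Qed.

Lemma corr_grad_eq0 K phi (g : 'cV[R]_n -> 'cV[R]_n) :
  (forall A : 'M[R]_(m, n), A != 0 -> (0 < psi p G D alpha A)%E) ->
  C11_kernel K phi g -> K `<=` Omega -> corr_grad u g = 0.
Proof.
move=> psi_gt0 ker KO; have NA := kernel_psi_null ker KO.
by apply/eqP/negPn/negP => /psi_gt0; rewrite (NA : psi _ _ _ _ _ = 0%E) ltxx.
Qed.

(** As the group is trivial, the copy is pulled back to [D] by a homothety. The projected derivative
    of the pulled-back field is represented by [V = 0], so the strong bound leaves no energy. The
    complement [P] is the one supplied by strongness, possibly different from that of the theorem;
    the vanishing holds for every complement. *)
Lemma strong_alpha_eq0 : G = [set 1%:M] -> strong_core_functional p G D alpha ->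
  forall D', copies G D Omega D' -> alpha u D' = 0.
Proof.
move=> G1 [_ [P [PN [c3 c30 strong]]]] _ [e e0 [[A [h [GA ->]]] DO]].
have cD := copies_ref D GSO.
have A1 : A = 1%:M by move: GA; rewrite G1.
have FE : u \o similarity e A h = fun x => u (e *: x + h).
  by apply/funext => x /=; rewrite A1 similarityE.
have luF := in_Lploc_affine p0 h e0 lu.
rewrite -(alpha_comp core h lu cD e0 GA) FE.
apply/eqP; rewrite eq_le (alpha_ge0 core luF cD) andbT -lee_fin.
have z0 : (\int[lebesgue_cV R n]_(x in D) (opnorm (0 : 'M[R]_(m, n)) `^ p)%:E = 0)%E.
  by apply: integral0_eq => x _; rewrite opnorm0 powR0// gt_eqF.
suff /(strong _ _ luF) : in_WLp (proj_along P N) p D (fun x => u (e *: x + h)) (fun _ => 0).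
  by rewrite z0 mule0.
split.
- split=> [i j|]; first by apply: measurable_funTS; case: luF => + _; exact.
  have [r r0 Dr] := ex_strict_bound_gt0 D_bounded.
  apply: le_lt_trans (proj2 luF _ (@compact_cball R n r)).
  apply: ge0_subset_integral.
  + exact: open_cV_measurable.
  + exact: measurable_cball.
  + apply: measurable_funTS; apply: measurable_enorm_powR => i.
    by case: luF => + _; exact.
  + by move=> x _; rewrite lee_fin powR_ge0.
  + by move=> x /Dr /ltW.
- split=> [i j|]; last by rewrite z0.
  by rewrite (_ : (fun x => _) = cst (0 : R))//; apply/funext => x; rewrite mxE.
- move=> phi tphi; rewrite (DL_proj_along_affine PN e0 _ tphi).
    apply/matrixP => i j; rewrite !mxE; apply/esym.
    rewrite (@eq_Rintegral _ _ _ _ _ (cst 0)); last by move=> x _; rewrite mul0r.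
    by rewrite /Rintegral integral0_eq.
  by move=> x Dx; apply: DO; exists x => //; rewrite A1 similarityE.
Qed.

End consequences.

Theorem corollary4p5 (R : realType) (m n : nat) (m_gt0 : (0 < m)%N)
    (n_gt0 : (0 < n)%N)
    (Omega : set 'cV[R]_n) (Omega_open : open Omega)
    (Omega_connected : connected Omega)
    (p : R) (p_gt1 : 1 < p)
    (G : set 'M[R]_n) (G_subgroup : subgroup_of_SO G)
    (D : set 'cV[R]_n) (D_bounded : bounded_set D) (D_open : open D)
    (alpha : ('cV[R]_n -> 'cV[R]_m) -> set 'cV[R]_n -> R)
    (alpha_core : core_functional p G D alpha)
    (u : 'cV[R]_n -> 'cV[R]_m) (u_Lploc : in_Lploc p u)
    (P : {vspace 'M[R]_(m, n)})
    (P_direct : direct_sum P (psi_null p G D alpha))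
    (alpha_lsc : forall D', copies G D setT D' ->
      lsc_on_Lp p (fun v => alpha v D'))
    (u_liminf : bmo_liminf p G D alpha Omega u = 0%E) :
  [/\ DL_eq0 (proj_along P (psi_null p G D alpha)) Omega u,
      (forall A : 'M[R]_(m, n), A != 0 -> (0 < psi p G D alpha A)%E) ->
        DL_eq0 id Omega u /\
        exists c : 'cV[R]_m,
          {ae lebesgue_cV R n, forall x, Omega x -> u x = c} &
      G = [set 1%:M] -> strong_core_functional p G D alpha ->
        forall D', copies G D Omega D' -> alpha u D' = 0].
Proof.
have strongP := strong_alpha_eq0 p_gt1 G_subgroup alpha_core D_bounded D_open
  alpha_lsc Omega_open u_Lploc u_liminf.
have projP := DL_proj_along_affine p_gt1 G_subgroup alpha_core D_bounded D_open
  alpha_lsc Omega_open u_Lploc u_liminf P_direct.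
split=> [phi tphi|psi_gt0|]; last exact: strongP.
  have := projP Omega 1 0 ltr01; rewrite (_ : (fun x => _) = u); last first.
    by apply/funext => x; rewrite scale1r addr0.
  by apply=> // x Ox; rewrite scale1r addr0.
have grad0 := corr_grad_eq0 p_gt1 G_subgroup alpha_core D_bounded D_open
  alpha_lsc Omega_open u_Lploc u_liminf psi_gt0.
split=> [phi tphi|].
  rewrite (DL_kernel _ p_gt1 u_Lploc tphi)//.
  have [_ _ KO] := tphi.
  by rewrite (grad0 _ _ _ (test_function_kernel tphi) KO) oppr0.
(* A row of [corr_grad] collects the correlations of one component of [u] with the kernel gradient;
   they all vanish, so each component is constant by connectedness. *)
have /choice[c cP] : forall i, exists c : R,
    {ae lebesgue_cV R n, forall x, Omega x -> u x i 0 = c}.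
  move=> i; have p_gt0 : 0 < p by exact: lt_trans p_gt1.
  have /(in_LplocP p_gt0)/(_ i)/(Lqloc1 (ltW p_gt1)) lui := u_Lploc.
  apply: (ae_constant_connected Omega_open Omega_connected lui) => K phi g ker KO j.
  by have /matrixP/(_ i j) := grad0 _ _ _ ker KO; rewrite !mxE.
exists (\col_i c i); have : {ae lebesgue_cV R n, forall x i, Omega x -> u x i 0 = c i} by exact: filter_forall.
apply: filterS => x cx Ox.
by apply/colP => i; rewrite mxE; exact: cx.
Qed.
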